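(* Let $1<p<2<r$ and let $g\colon\Omega\to\mathbb R$ be a function. (i) If $p>r/(r-1)$, $g\in\mathbb L^{p,\infty}$ and $g-g\circ T\in\mathbb L^{r,\infty}$, then for any square integrable martingale differences sequence $(m\circ T^i)_{i\geqslant 0}$, the function $f:=m+g-g\circ T$ satisfies the law of the iterated logarithm. (ii) If $p=r/(r-1)$, $g\in\mathbb L^p$ and $g-g\circ T\in\mathbb L^r$, then for any square integrable martingale differences sequence $(m\circ T^i)_{i\geqslant 0}$, the function $f:=m+g-g\circ T$ satisfies the law of the iterated logarithm.
   Context: $(\Omega,\mathcal F,\mu)$ is a probability space and $T\colon\Omega\to\Omega$ is a bijective, bi-measurable, measure-preserving map; the system is ergodic, i.e. $T^{-1}A=A$ with $A\in\mathcal F$ implies $\mu(A)\in\{0,1\}$. For measurable $f\colon\Omega\to\mathbb R$ and $n\geqslant 1$, $S_n(f):=\sum_{j=0}^{n-1}f\circ T^j$. $f$ satisfies the law of the iterated logarithm if there exists a (real) constant $C(f)$ such that for almost every $\omega\in\Omega$, $\limsup_{n\to+\infty}\frac{S_n(f)(\omega)}{\sqrt{n\log\log n}}=C(f)$ and $\liminf_{n\to+\infty}\frac{S_n(f)(\omega)}{\sqrt{n\log\log n}}=-C(f)$. For $q>1$, $\mathbb L^{q,\infty}$ is the space of measurable functions $h\colon\Omega\to\mathbb R$ with $\|h\|_{q,\infty}^q:=\sup_{t>0}t^q\mu\{|h|>t\}<\infty$. $(m\circ T^i)_{i\geqslant 0}$ is a martingale differences sequence if it is one (integrable, adapted, with zero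 conditional expectations given the past) with respect to some filtration; it is square integrable if $m\in\mathbb L^2$. *)

(* Defs.v *)
From mathcomp Require Import all_boot all_order all_algebra.
From mathcomp Require Import all_classical all_reals all_analysis.

Set Implicit Arguments.
Unset Strict Implicit.
Unset Printing Implicit Defensive.

Import Order.TTheory GRing.Theory Num.Theory.
Import numFieldNormedType.Exports.

Local Open Scope classical_set_scope.
Local Open Scope ring_scope.

Section dynamical_system.
Context (d : measure_display) (Omega : measurableType d) (R : realType).
Variables (mu : probability Omega R) (T : Omega -> Omega).

Definition bimeasurable_bijection : Prop :=
  [/\ bijective T,
      forall A, measurable A -> measurable (T @^-1` A) &
      forall A, measurable A -> measurable (T @` A)].

Definition measure_preserving : Prop :=
  forall A, measurable A -> mu (T @^-1` A) = mu A.

Definition ergodic : Prop :=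
  forall A, measurable A -> T @^-1` A = A ->
    mu A = 0%:E \/ mu A = 1%:E.

Definition birkhoff_sum (f : Omega -> R) (n : nat) (w : Omega) : R :=
  \sum_(j < n) f (iter j T w).

(* The terms n <= 2, for which ln (ln n) is not positive, get junk (but
   finite) values and do not affect the upper and lower limits. *)
Definition lil_ratio (f : Omega -> R) (w : Omega) (n : nat) : R :=
  birkhoff_sum f n w / Num.sqrt (n%:R * ln (ln n%:R)).

(* The upper and lower limits are taken in \bar R, so that the equalities
   with the real numbers C and - C include the finiteness of the limits. *)
Definition law_of_the_iterated_logarithm (f : Omega -> R) : Prop :=
  exists C : R, {ae mu, forall w,
    limn_esup (fun n => (lil_ratio f w n)%:E) = C%:E /\
    limn_einf (fun n => (lil_ratio f w n)%:E) = (- C)%:E}.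

End dynamical_system.

Section martingale_differences.
Context (d : measure_display) (Omega : measurableType d) (R : realType).
Variable mu : probability Omega R.

Definition is_sub_sigma_algebra (G : set (set Omega)) : Prop :=
  sigma_algebra setT G /\ G `<=` measurable.

Definition measurable_wrt (G : set (set Omega)) (X : Omega -> R) : Prop :=
  forall B : set R, measurable B -> G (X @^-1` B).

Definition integrable_rv (X : Omega -> R) : Prop :=
  mu.-integrable setT (EFin \o X).

(* Y is a version of the conditional expectation of X given G. *)
Definition is_cond_exp (G : set (set Omega)) (X Y : Omega -> R) : Prop :=
  [/\ measurable_wrt G Y, integrable_rv Y &
      forall A, G A ->
        (\int[mu]_(w in A) (Y w)%:E = \int[mu]_(w in A) (X w)%:E)%E].

Definition filtration (F : nat -> set (set Omega)) : Prop :=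
  (forall i, is_sub_sigma_algebra (F i)) /\
  (forall i j, (i <= j)%N -> F i `<=` F j).

(* No condition is put on E[X 0]; for X i = m \o iter i T with T measure
   preserving, E[X 0] = E[X 1] = 0 follows from the last condition. *)
Definition martingale_differences (X : nat -> Omega -> R) : Prop :=
  exists F : nat -> set (set Omega),
    [/\ filtration F,
        forall i, integrable_rv (X i),
        forall i, measurable_wrt (F i) (X i) &
        forall i, is_cond_exp (F i) (X i.+1) (cst 0)].

End martingale_differences.

Section weak_Lq.
Context (d : measure_display) (Omega : measurableType d) (R : realType).
Variable mu : probability Omega R.

(* The q-th power of the norm of the space of index (q, oo). *)
Definition weak_norm_pow (q : R) (h : Omega -> R) : \bar R :=
  ereal_sup [set ((t `^ q)%:E * mu [set w | (t < `|h w|)%R])%E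
            | t in [set t : R | 0 < t]].

Definition weak_Lfun (q : R) (h : Omega -> R) : Prop :=
  measurable_fun setT h /\ (weak_norm_pow q h < +oo)%E.

End weak_Lq.

(* Main.v *)
(* Birkhoff's theorem applied to the integrable function
   g^2 - g^2 o T = (g - g o T)(g + g o T) gives g o T^n = o(sqrt n) almost
   surely, so the coboundary does not contribute and it remains to prove the
   law for the square integrable martingale differences X_j = m o T^j.

   Truncating X_j at the level delta sqrt (j / log log j) and recentering
   changes the sums by o(sqrt (n log log n)) only: the conditional expectation
   of the small part is minus that of the large part, and the expectations of
   the large parts divided by sqrt (j log log j) are summable because X_j is
   square integrable.  For the truncated differences Y_j the products
   M = prod (1 + lam Y_j) are nonnegative martingales, and
   log M = lam S - (1 + O(delta)) lam^2 Q / 2, where Q = sum Y_j^2 is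
   asymptotic to n times the variance by the ergodic theorem; no conditional
   variance is needed.

   Upper bound: Markov's inequality for M stopped at the crossing of a level,
   along a geometric sequence.  Lower bound: on the k-th block a combination
   M(lam) - c M(lam (1 - eta)) - c M(lam (1 + eta)), suitably scaled, is at most
   1, has mean of order 1/k, and is nonpositive when the block sum stays small.
   Betting against it on every block yields a nonnegative supermartingale which
   would tend to infinity if only finitely many block sums were large. *)

Require Import Defs.
From HB Require Import structures.
From mathcomp Require Import all_boot all_order all_algebra.
From mathcomp Require Import all_classical all_reals all_analysis.
From mathcomp Require Import measurable_realfun ring lra zify.

Set Implicit Arguments.
Unset Strict Implicit.
Unset Printing Implicit Defensive.

Import Order.TTheory GRing.Theory Num.Theory.
Import numFieldNormedType.Exports.

Local Open Scope classical_set_scope.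
Local Open Scope ring_scope.

(** * The ergodic theorem *)

Section measure_preserving_integral.
Context (d : measure_display) (Omega : measurableType d) (R : realType).
Variables (mu : probability Omega R) (T : Omega -> Omega).
Hypothesis mT : measurable_fun setT T.
Hypothesis T_mp : measure_preserving mu T.

(** The condition [p = r / (r - 1)] says that [p] and [r] are conjugate, so Young's inequality makes
    the products of [g - g \o T] with [g] and with [g \o T] integrable. In the weak case the strict
    inequality leaves room to lower both exponents to a conjugate pair of strong ones. What shapes
    the martingale part is that the filtration is arbitrary: nothing ties it to [T], so neither
    conditional variances nor the centerings produced by truncation need be stationary, and the
    ergodic theorem does not apply to them. The factors [1 + lam Y_j] have conditional mean 1 by
    centering alone, and their logarithms involve realised squares, which are governed by the
    stationary squares of [m \o T^j]; the centerings are controlled only in mean, by stationary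
    tails. The ergodic theorem yields the quadratic variation only almost surely and asymptotically,
    while the martingale estimates need sure bounds. Hence the variation is built into the crossing
    event of the upper half, and in the lower half the products are frozen once it reaches its
    target. The bet replaces lower bounds for tail probabilities and any independence between
    blocks. *)

Lemma integrable_mp (f : Omega -> R) : mu.-integrable setT (EFin \o f) ->
  mu.-integrable setT (EFin \o (f \o T)).
Proof.
move=> /integrableP[mf fi]; apply/integrableP; split.
  apply/measurable_EFinP; apply: measurableT_comp => //.
  exact/measurable_EFinP.
move: fi; rewrite (@eq_measure_integral _ _ _ setT (pushforward mu T) mu); last first.
  by move=> A mA _; rewrite -[LHS]T_mp.
rewrite ge0_integral_pushforward//.
exact: measurableT_comp.
Qed.

Lemma integral_mp (f : Omega -> R) (A : set Omega) : measurable A ->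
  mu.-integrable setT (EFin \o f) ->
  (\int[mu]_(x in T @^-1` A) (f (T x))%:E = \int[mu]_(x in A) (f x)%:E)%E.
Proof.
move=> mA fi.
rewrite (@eq_measure_integral _ _ _ A (pushforward mu T) mu); last first.
  by move=> B mB _; rewrite -[LHS]T_mp.
rewrite (@integral_pushforward _ _ _ _ _ _ mT)//.
  exact: measurable_int fi.
apply: integrableS (integrable_mp fi) => //.
by rewrite -[X in measurable X]setTI; exact: mT.
Qed.

End measure_preserving_integral.

(** * Garsia's maximal argument *)

Section maximal_sum.
Context (d : measure_display) (Omega : measurableType d) (R : realType).
Variables (mu : probability Omega R) (T : Omega -> Omega).
Hypothesis mT : measurable_fun setT T.
Hypothesis T_mp : measure_preserving mu T.
Hypothesis T_erg : ergodic mu T.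
Variable f : Omega -> R.
Hypothesis f_int : mu.-integrable setT (EFin \o f).

(* The maximum of the Birkhoff sums of orders 1, ..., n + 1. *)
Fixpoint maxsum (n : nat) (w : Omega) : R :=
  if n is n'.+1 then f w + Num.max 0 (maxsum n' (T w)) else f w.

Lemma le_maxsumS n w : maxsum n w <= maxsum n.+1 w.
Proof.
elim: n w => [|n IH] w /=; first by rewrite lerDl le_max lexx.
rewrite lerD2l ge_max !le_max lexx /=; apply/orP; right; exact: IH.
Qed.

Lemma le_maxsum w : {homo maxsum ^~ w : m n / (m <= n)%N >-> m <= n}.
Proof. by apply: homo_leq => //; [exact: le_trans|move=> n; exact: le_maxsumS]. Qed.

Lemma birkhoff_sumSr n w :
  birkhoff_sum T f n.+1 w = f w + birkhoff_sum T f n (T w).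
Proof.
rewrite /birkhoff_sum big_ord_recl; congr (_ + _).
by apply: eq_bigr => i _; rewrite -iterSr.
Qed.

Lemma birkhoff_sum_le_maxsum n w : birkhoff_sum T f n.+1 w <= maxsum n w.
Proof.
elim: n w => [|n IH] w; first by rewrite /birkhoff_sum big_ord1.
by rewrite birkhoff_sumSr /= lerD2l le_max IH orbT.
Qed.

Lemma measurable_maxsum n : measurable_fun setT (maxsum n).
Proof.
have mf : measurable_fun setT f by apply/measurable_EFinP; exact: measurable_int f_int.
elim: n => [//|n IH] /=.
apply: measurable_funD => //; apply: measurable_maxr => //.
exact: measurableT_comp.
Qed.

Lemma integrable_maxsum n : mu.-integrable setT (EFin \o maxsum n).
Proof.
elim: n => [//|n IH] /=.
rewrite (_ : EFin \o _ =
  (EFin \o f) \+ (EFin \o (fun w => (Num.max 0 (maxsum n (T w)))%R)))%E//.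
apply: integrableD => //.
have := integrable_mp mT T_mp IH.
apply: le_integrable => //.
  apply/measurable_EFinP; apply: measurable_maxr => //.
  apply: measurableT_comp => //; exact: measurable_maxsum.
move=> x _ /=; rewrite lee_fin ger0_norm ?le_max ?lexx//.
by rewrite ge_max normr_ge0 ler_norm.
Qed.

Let A := [set w | forall c : R, exists n, c < maxsum n w].

Let measurable_A : measurable A.
Proof.
have -> : A = \bigcap_(k : nat) \bigcup_n [set w | k%:R < maxsum n w].
  apply/seteqP; split => w /= Aw.
    by move=> k _; have [n ?] := Aw k%:R; exists n.
  move=> c; have [n _ /= cn] := Aw (Num.truncn c).+1 I.
  by exists n; apply: lt_trans cn; rewrite truncnS_gt.
apply: bigcapT_measurable => k; apply: bigcupT_measurable => n.
rewrite (_ : mkset _ = maxsum n @^-1` `]k%:R, +oo[%classic); last first.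
  by apply/seteqP; split => w /=; rewrite in_itv /= andbT.
by rewrite -[X in measurable X]setTI; apply: measurable_maxsum.
Qed.

Let A_invariant : T @^-1` A = A.
Proof.
apply/seteqP; split => w /= Aw c.
  have [n hn] := Aw (c - f w); exists n.+1 => /=.
  rewrite addrC -ltrBlDr; apply: lt_le_trans hn _.
  by rewrite le_max lexx orbT.
have [n hn] := Aw (Num.max c 0 + f w); exists n.
have := lt_le_trans hn (le_maxsumS n w).
by rewrite /= addrC ltrD2l lt_max !gt_max ltxx andbF /= => /andP[].
Qed.

(** Invariance of [A] lets [maxsum n \o T] be replaced by [maxsum n] under the integral over [A], so
    each [D n] has a nonnegative integral. By the recursion, [D n] is [f] plus the negative part of
    [maxsum n \o T], which vanishes on [A] for large [n]; domination by [|f| + |f \o T|] allows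
    passing to the limit. *)
Let integral_A_ge0 : (0 <= \int[mu]_(w in A) (f w)%:E)%E.
Proof.
pose D n w := maxsum n.+1 w - maxsum n (T w).
have DE n w : D n w = f w + Num.max 0 (- maxsum n (T w)).
  rewrite /D /= -addrA; congr (_ + _); rewrite addr_maxl sub0r subrr.
  by rewrite maxC.
have Dint n : mu.-integrable setT (EFin \o D n).
  rewrite (_ : EFin \o D n = (EFin \o maxsum n.+1) \- (EFin \o (maxsum n \o T)))%E//.
  apply: integrableB => //; first exact: integrable_maxsum.
  by apply: integrable_mp => //; exact: integrable_maxsum.
have ID n : (0 <= \int[mu]_(w in A) (D n w)%:E)%E.
  under eq_integral do rewrite /D EFinB.
  rewrite integralB//=; last 2 first.
  - by apply: integrableS (integrable_maxsum n.+1).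
  - apply: integrableS (integrable_mp mT T_mp (integrable_maxsum n)) => //.
  have := @integral_mp _ _ _ _ _ mT T_mp (maxsum n) A measurable_A (integrable_maxsum n).
  rewrite A_invariant => ->.
  rewrite sube_ge0; last first.
    rewrite integrable_fin_num//.
      by apply: integrableS (integrable_maxsum n).
  apply: le_integral => //.
  - by apply: integrableS (integrable_maxsum n).
  - by apply: integrableS (integrable_maxsum n.+1).
  - by move=> x _; rewrite lee_fin le_maxsumS.
have [|||||_ _ cv] := @dominated_convergence _ _ _ mu A measurable_A
  (fun n => EFin \o D n) (EFin \o f)
  ((abse \o (EFin \o f)) \+ (abse \o (EFin \o (f \o T))))%E.
- by move=> n; apply: measurable_funTS; exact: measurable_int (Dint n).
- by apply: measurable_funTS; exact: measurable_int f_int.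
- apply: aeW => w Aw; apply: cvg_near_cst.
  have /(_ 0)[n0 hn0] : A (T w) by rewrite -[A _]/((T @^-1` A) w) A_invariant.
  exists n0 => // n /= n0n; rewrite DE max_l ?addr0// oppr_le0.
  exact: le_trans (ltW hn0) (le_maxsum _ n0n).
- apply: (integrableS measurableT) => //.
  apply: (integrableD measurableT).
    exact: integrable_abse f_int.
  exact: (integrable_abse (integrable_mp mT T_mp f_int)).
- apply: aeW => w n _ /=; rewrite lee_fin DE.
  apply: le_trans (ler_normD _ _) _; rewrite lerD2l.
  rewrite ger0_norm ?le_max ?lexx// ge_max normr_ge0 /=.
  rewrite lerNl; apply: le_trans (le_maxsum (T w) (leq0n n)).
  by rewrite lerNl -normrN ler_norm.
rewrite -(cvg_lim _ cv)//; apply: lime_ge; first by apply/cvg_ex; eexists; exact: cv.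
by apply: nearW => n; exact: ID.
Qed.

(* The invariant set on which the Birkhoff sums are unbounded above cannot
   have full measure, since the integral of f over it is nonnegative. *)
Lemma birkhoff_sum_ae_bounded : (\int[mu]_w (f w)%:E < 0)%E ->
  {ae mu, forall w, exists c : R, forall n, birkhoff_sum T f n.+1 w <= c}.
Proof.
move=> f_lt0; exists A; split => //.
  have [//|A1] := T_erg measurable_A A_invariant.
  exfalso; move: f_lt0; apply/negP; rewrite -leNgt.
  have CA0 : mu (~` A) = 0%E.
    by rewrite probability_setC// A1 subee.
  rewrite -(setvU A) integral_setU//=.
  - rewrite null_set_integral ?add0e//.
    + exact: measurableC.
    + by apply: measurable_funTS; exact: (measurable_int mu).
  - exact: measurableC.
  - by rewrite setvU; exact: measurable_int f_int.
  - by apply/disj_setPS => x [].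
move=> w /= nb c; apply: contrapT => nc; apply: nb; exists c => n.
rewrite leNgt; apply/negP => cn; apply: nc; exists n.
exact: lt_le_trans cn (birkhoff_sum_le_maxsum n w).
Qed.

End maximal_sum.

(** * Birkhoff's pointwise theorem for an ergodic map *)

Section birkhoff.
Context (d : measure_display) (Omega : measurableType d) (R : realType).
Variables (mu : probability Omega R) (T : Omega -> Omega).
Hypothesis mT : measurable_fun setT T.
Hypothesis T_mp : measure_preserving mu T.
Hypothesis T_erg : ergodic mu T.

Lemma birkhoff_sum_cst (c : R) n w : birkhoff_sum T (cst c) n w = n%:R * c.
Proof. by rewrite /birkhoff_sum /= sumr_const card_ord mulr_natl. Qed.

Lemma birkhoff_sumD (f g : Omega -> R) n w :
  birkhoff_sum T (f \+ g) n w = birkhoff_sum T f n w + birkhoff_sum T g n w.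
Proof. exact: big_split. Qed.

Lemma birkhoff_sumN (f : Omega -> R) n w :
  birkhoff_sum T (\- f) n w = - birkhoff_sum T f n w.
Proof. exact: sumrN. Qed.

(** Half of [e] makes the integral of [f - a] negative, so its Birkhoff sums are almost surely
    bounded above; the other half, multiplied by [n], absorbs that random bound. *)
Lemma birkhoff_upper (f : Omega -> R) : mu.-integrable setT (EFin \o f) ->
  forall e : R, 0 < e -> {ae mu, forall w, \forall n \near \oo,
    birkhoff_sum T f n w <= n%:R * (\int[mu]_x f x + e)}.
Proof.
move=> fi e e0; pose a := \int[mu]_x f x + e / 2.
have gi : mu.-integrable setT (EFin \o (f \- cst a)).
  rewrite (_ : EFin \o _ = (EFin \o f) \- (EFin \o cst a))%E//.
  apply: integrableB => //; exact: finite_measure_integrable_cst.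
have If : (\int[mu]_x (f x)%:E = (\int[mu]_x f x)%:E)%E.
  by rewrite /Rintegral fineK// integrable_fin_num.
have ga : (\int[mu]_w ((f \- cst a) w)%:E < 0)%E.
  under eq_integral do rewrite EFinB.
  rewrite integralB//=; last exact: finite_measure_integrable_cst.
  rewrite integral_cst//=.
  have -> : mu setT = 1%E := probability_setT mu.
  rewrite mule1 If -EFinB lte_fin /a; lra.
have := birkhoff_sum_ae_bounded mT T_mp T_erg gi ga.
apply: filterS => w [c hc].
near=> n.
have n0 : (0 < n)%N by near: n; exact: nbhs_infty_gt.
have : c <= n%:R * (e / 2).
  rewrite -ler_pdivrMr; last by lra.
  by near: n; exact: nbhs_infty_ger.
have := hc n.-1; rewrite prednK// => h1 h2.
have {}h1 := le_trans h1 h2; move: h1.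
rewrite (_ : f \- cst a = f \+ (\- cst a)) // birkhoff_sumD birkhoff_sumN.
rewrite birkhoff_sum_cst /a; lra.
Unshelve. all: by end_near. Qed.

Theorem birkhoff_ergodic (f : Omega -> R) : mu.-integrable setT (EFin \o f) ->
  {ae mu, forall w,
    (birkhoff_sum T f n w / n%:R) @[n --> \oo] --> \int[mu]_x f x}.
Proof.
move=> fi.
have Nfi : mu.-integrable setT (EFin \o (\- f)).
  by rewrite (_ : EFin \o _ = -%E \o (EFin \o f)) //; exact: integrableN.
have IN : \int[mu]_x (- f x) = - \int[mu]_x f x.
  rewrite -mulN1r -RintegralZl//; apply: eq_Rintegral => x _ /=; by rewrite mulN1r.
pose e k : R := k.+1%:R^-1.
have e0 k : 0 < e k by rewrite invr_gt0.
have U k := birkhoff_upper fi (e0 k).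
have L k := birkhoff_upper Nfi (e0 k).
move/ae_foralln : U => U; move/ae_foralln : L => L.
apply: filterS2 U L => w U L.
apply/cvgrPdist_le => eps eps0.
have [k _ hk] := near_infty_natSinv_lt (PosNum eps0).
have {hk} := hk k (leqnn k); rewrite /= -/(e k) => hk.
near=> n.
have n0 : 0 < n%:R :> R by rewrite ltr0n; near: n; exact: nbhs_infty_gt.
have u : birkhoff_sum T f n w <= n%:R * (\int[mu]_x f x + e k) by near: n; exact: U.
have : birkhoff_sum T (\- f) n w <= n%:R * (\int[mu]_x (- f x) + e k) by near: n; exact: L.
rewrite birkhoff_sumN IN => l.
rewrite ler_distlC -[X in _ - X <= _ <= _]/eps; apply/andP; split.
  rewrite ler_pdivlMr//; nra.
rewrite ler_pdivrMr//; nra.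
Unshelve. all: by end_near. Qed.

End birkhoff.

(** * Martingale transforms *)

Section bounded_measurable.
Context (d : measure_display) (Omega : measurableType d) (R : realType).
Implicit Types (G : set (set Omega)) (f g h : Omega -> R).

(** Sub-sigma-algebras are sets of sets here; passing to the type generated by [G] gives access to
    the closure properties of measurable functions. *)
Lemma measurable_wrtP G f : sigma_algebra setT G ->
  measurable_wrt G f <-> measurable_fun setT (f : g_sigma_algebraType G -> R).
Proof.
move=> sG; have mG := measurable_g_measurableTypeE sG; split => mf.
  by move=> _ B mB; rewrite setTI mG; exact: mf.
by move=> B mB; rewrite -mG -[X in measurable X]setTI; exact: mf.
Qed.

Lemma sub_measurable_wrt G G' f : G `<=` G' ->
  measurable_wrt G f -> measurable_wrt G' f.
Proof. by move=> GG' mf B mB; apply: GG'; exact: mf. Qed.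

Lemma measurable_wrt_cst G (c : R) : sigma_algebra setT G ->
  measurable_wrt G (cst c : Omega -> R).
Proof. by move=> sG; apply/(measurable_wrtP _ sG); exact: measurable_cst. Qed.

Lemma measurable_wrtD G f g : sigma_algebra setT G ->
  measurable_wrt G f -> measurable_wrt G g -> measurable_wrt G (f \+ g).
Proof.
move=> sG /(measurable_wrtP _ sG) mf /(measurable_wrtP _ sG) mg.
by apply/(measurable_wrtP _ sG); exact: measurable_funD.
Qed.

Lemma measurable_wrtM G f g : sigma_algebra setT G ->
  measurable_wrt G f -> measurable_wrt G g -> measurable_wrt G (f \* g).
Proof.
move=> sG /(measurable_wrtP _ sG) mf /(measurable_wrtP _ sG) mg.
by apply/(measurable_wrtP _ sG); exact: measurable_funM.
Qed.

Lemma measurable_wrt_indic G (A : set Omega) : sigma_algebra setT G ->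
  G A -> measurable_wrt G (\1_A : Omega -> R).
Proof.
move=> sG GA; apply/(measurable_wrtP _ sG).
by apply: (@measurable_indic _ (g_sigma_algebraType G)); rewrite measurable_g_measurableTypeE.
Qed.

Lemma measurable_wrt_sum G (n : nat) (F : nat -> Omega -> R) :
  sigma_algebra setT G -> (forall i, (i < n)%N -> measurable_wrt G (F i)) ->
  measurable_wrt G (fun w => \sum_(i < n) F i w).
Proof.
move=> sG; elim: n => [|n IH] mF.
  rewrite (_ : (fun _ => _) = cst 0); first exact: measurable_wrt_cst.
  by apply/funext => w; rewrite big_ord0.
rewrite (_ : (fun _ => _) = (fun w => \sum_(i < n) F i w) \+ F n).
  by apply: measurable_wrtD (mF _ _) => //; apply: IH => i ?; apply/mF/ltnW.
by apply/funext => w; rewrite big_ord_recr.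
Qed.

Lemma wrt_preimage_ge G f (c : R) : measurable_wrt G f -> G [set w | c <= f w].
Proof.
move=> mf; have := mf `[c, +oo[%classic (measurable_itv _).
by congr G; apply/seteqP; split => w /=; rewrite in_itv/= andbT.
Qed.

Lemma wrt_preimage_le G f (c : R) : measurable_wrt G f -> G [set w | f w <= c].
Proof.
move=> mf; have := mf `]-oo, c]%classic (measurable_itv _).
by congr G; apply/seteqP; split => w /=; rewrite in_itv/=.
Qed.

Lemma wrt_preimage_gt G f (c : R) : measurable_wrt G f -> G [set w | c < f w].
Proof.
move=> mf; have := mf `]c, +oo[%classic (measurable_itv _).
by congr G; apply/seteqP; split => w /=; rewrite in_itv/= andbT.
Qed.

Lemma wrt_setC G A : sigma_algebra setT G -> G A -> G (~` A).
Proof. by case=> _ GC _ GA; rewrite -setTD; exact: GC. Qed.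

Lemma wrt_setT G : sigma_algebra setT G -> G setT.
Proof. by case=> G0 GC _; rewrite -[setT]setD0; exact: GC. Qed.

Lemma wrt_setI G A B : sigma_algebra setT G -> G A -> G B -> G (A `&` B).
Proof.
move=> sG; rewrite -(measurable_g_measurableTypeE sG); exact: measurableI.
Qed.

(** The test functions against which centering is expressed. They are stable under sums and
    products, and integrable as soon as [G] consists of measurable sets. *)
Definition bounded_wrt G h :=
  measurable_wrt G h /\ exists M : R, forall w, `|h w| <= M.

Lemma bounded_wrt_cst G (c : R) : sigma_algebra setT G ->
  bounded_wrt G (cst c : Omega -> R).
Proof. by move=> sG; split; [exact: measurable_wrt_cst|exists `|c|]. Qed.

Lemma bounded_wrtD G f g : sigma_algebra setT G ->
  bounded_wrt G f -> bounded_wrt G g -> bounded_wrt G (f \+ g).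
Proof.
move=> sG [mf [M hM]] [mg [N hN]]; split; first exact: measurable_wrtD.
by exists (M + N) => w; apply: le_trans (ler_normD _ _) _; exact: lerD.
Qed.

Lemma bounded_wrtM G f g : sigma_algebra setT G ->
  bounded_wrt G f -> bounded_wrt G g -> bounded_wrt G (f \* g).
Proof.
move=> sG [mf [M hM]] [mg [N hN]]; split; first exact: measurable_wrtM.
by exists (M * N) => w; rewrite normrM; apply: ler_pM.
Qed.

Lemma bounded_wrtZ G (c : R) f : sigma_algebra setT G ->
  bounded_wrt G f -> bounded_wrt G (fun w => c * f w).
Proof. by move=> sG; exact/bounded_wrtM/bounded_wrt_cst. Qed.

Lemma bounded_wrt_indic G (A : set Omega) : sigma_algebra setT G ->
  G A -> bounded_wrt G (\1_A : Omega -> R).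
Proof.
move=> sG GA; split; first exact: measurable_wrt_indic.
by exists 1 => w; rewrite indicE; case: (_ \in _); rewrite ?normr1 ?normr0.
Qed.

Lemma sub_bounded_wrt G G' f : G `<=` G' -> bounded_wrt G f -> bounded_wrt G' f.
Proof. by move=> GG' [mf bf]; split => //; exact: sub_measurable_wrt mf. Qed.

Variable mu : probability Omega R.

Lemma bounded_wrt_integrable G h : G `<=` measurable -> bounded_wrt G h ->
  mu.-integrable setT (EFin \o h).
Proof.
move=> Gm [mh [M hM]]; apply: measurable_bounded_integrable => //.
- by rewrite -ge0_fin_numE//; exact: fin_num_measure.
- by move=> _ B mB; rewrite setTI; apply/Gm/mh.
- exists M; split; first exact: num_real.
  by move=> x Mx w _; exact: le_trans (hM w) (ltW Mx).
Qed.

End bounded_measurable.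

(** * Exponential martingales with predictable coefficients *)

Section martingale_transform.
Context (d : measure_display) (Omega : measurableType d) (R : realType).
Variable mu : probability Omega R.

(* [G j] is the past before [Y j] is observed. *)
Record bounded_mds (G : nat -> set (set Omega)) (Y : nat -> Omega -> R) : Prop :=
  BoundedMds {
    mds_filtration : filtration G ;
    mds_bounded : forall j, bounded_wrt (G j.+1) (Y j) ;
    mds_centered : forall j h, bounded_wrt (G j) h ->
      \int[mu]_w (h w * Y j w) = 0 }.

Variables (G : nat -> set (set Omega)) (Y : nat -> Omega -> R).
Hypothesis mds : bounded_mds G Y.

Lemma mds_sigma j : sigma_algebra setT (G j).
Proof. by have [/(_ j)[]] := mds_filtration mds. Qed.

Lemma mds_measurable j : G j `<=` measurable.
Proof. by have [/(_ j)[]] := mds_filtration mds. Qed.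

Lemma mds_mono i j : (i <= j)%N -> G i `<=` G j.
Proof. by have [_] := mds_filtration mds; exact. Qed.

Lemma mdsZ (c : R) : bounded_mds G (fun j w => c * Y j w).
Proof.
split; first exact: mds_filtration mds.
- by move=> j; apply: bounded_wrtZ; [exact: mds_sigma|exact: mds_bounded mds j].
- move=> j h bh.
  rewrite (_ : (fun w => h w * (c * Y j w)) = (fun w => (c * h w) * Y j w)).
    apply: (mds_centered mds (h := fun w => c * h w)).
    by apply: bounded_wrtZ => //; exact: mds_sigma.
  by apply/funext => w; ring.
Qed.

Lemma mdsN : bounded_mds G (fun j w => - Y j w).
Proof.
rewrite (_ : (fun j w => _) = (fun j w => -1 * Y j w)); first exact: mdsZ.
by apply/funext => j; apply/funext => w; rewrite mulN1r.
Qed.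

(** The discrete stochastic exponential of the transform of [Y] by [I], from index [a] on. Random
    coefficients serve twice below: to stop at a crossing and to freeze a block. *)
Definition mds_exp (I : nat -> Omega -> R) (a n : nat) (w : Omega) : R :=
  \prod_(i < n) (1 + I (a + i)%N w * Y (a + i)%N w).

Lemma bounded_mds_exp I a n : (forall j, bounded_wrt (G j) (I j)) ->
  bounded_wrt (G (a + n)%N) (mds_exp I a n).
Proof.
move=> bI; elim: n => [|n IH].
  rewrite (_ : mds_exp I a 0 = cst 1); first by apply: bounded_wrt_cst; exact: mds_sigma.
  by apply/funext => w; rewrite /mds_exp big_ord0.
rewrite (_ : mds_exp I a n.+1 =
  mds_exp I a n \* (cst 1 \+ (I (a + n)%N \* Y (a + n)%N))); last first.
  by apply/funext => w; rewrite /mds_exp big_ord_recr.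
have sG := mds_sigma (a + n.+1).
apply: bounded_wrtM => //.
  by apply: sub_bounded_wrt IH; apply: mds_mono; rewrite leq_add2l.
apply: bounded_wrtD => //; first exact: bounded_wrt_cst.
apply: bounded_wrtM => //.
  by apply: sub_bounded_wrt (bI _); apply: mds_mono; rewrite leq_add2l.
by rewrite addnS; exact: mds_bounded mds _.
Qed.

(** The increment of the product is a bounded function of the past times [Y (a + n)], so centering
    kills it. In the betting argument the weight [h] is the capital accumulated before the block. *)
Lemma integral_mds_exp I a n h : (forall j, bounded_wrt (G j) (I j)) ->
  bounded_wrt (G a) h ->
  \int[mu]_w (h w * mds_exp I a n w) = \int[mu]_w h w.
Proof.
move=> bI bh; elim: n => [|n IH].
  by apply: eq_Rintegral => w _; rewrite /mds_exp big_ord0 mulr1.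
have sG := mds_sigma (a + n).
have bhE : bounded_wrt (G (a + n)%N) (h \* mds_exp I a n).
  apply: bounded_wrtM => //; last exact: bounded_mds_exp.
  by apply: sub_bounded_wrt bh; apply: mds_mono; rewrite leq_addr.
have bhEI := bounded_wrtM sG bhE (bI (a + n)%N).
rewrite (_ : (fun w => _) = ((h \* mds_exp I a n) \+
  ((h \* mds_exp I a n \* I (a + n)%N) \* Y (a + n)%N))); last first.
  by apply/funext => w; rewrite /mds_exp big_ord_recr /=; ring.
rewrite RintegralD//=.
- by rewrite IH (mds_centered mds bhEI) addr0.
- by apply: bounded_wrt_integrable bhE; exact: mds_measurable.
- apply: (@bounded_wrt_integrable _ _ _ mu (G (a + n).+1)).
    exact: mds_measurable.
  apply: bounded_wrtM; first exact: mds_sigma.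
    by apply: sub_bounded_wrt bhEI; exact: mds_mono.
  exact: mds_bounded mds _.
Qed.

End martingale_transform.

(** * Exponential estimates on a block *)

Section exponential_estimates.
Context (R : realType).
Implicit Types (x c D eta : R).

(** Mean value theorem on the segment from 0 to [x]: the derivative is [y (c - 1 + c y)] times an
    exponential. For [c = 1 + 2 D] or [c = 1 - 2 D] and [|y| <= D <= 1/2] the bracket keeps one
    sign, which yields both bounds on [1 + x] below. *)
Lemma mul_expR_taylor c x : exists2 xi, 0 <= xi * x /\ `|xi| <= `|x| &
  (1 + x) * expR (c * x ^+ 2 / 2 - x) =
  1 + xi * x * (c - 1 + c * xi) * expR (c * xi ^+ 2 / 2 - xi).
Proof.
pose f y : R := (1 + y) * expR (c * y ^+ 2 / 2 - y).
pose df y : R := y * (c - 1 + c * y) * expR (c * y ^+ 2 / 2 - y).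
have fdf : forall y : R, is_derive y (1 : R) f (df y).
  move=> y; rewrite /f /df; apply: is_derive_eq.
  by rewrite /GRing.scale /=; field.
have fc : continuous f.
  move=> z; apply/differentiable_continuous/derivable1_diffP.
  by have [] := fdf z.
have f0 : f 0 = 1 by rewrite /f expr0n /= !mulr0 mul0r subr0 expR0 addr0 mulr1.
have [x0|x0] := leP 0 x.
  have [|xi xiI] := @MVT_segment _ f df 0 x x0 (fun y _ => fdf y).
    exact: continuous_subspaceT.
  move: xiI; rewrite in_itv /= => /andP[xi0 xix] E.
  exists xi; first by rewrite mulr_ge0// !ger0_norm.
  have -> : (1 + x) * expR (c * x ^+ 2 / 2 - x) = f 0 + (f x - f 0) by rewrite /f; ring.
  rewrite E f0 /df; ring.
have [|xi xiI] := @MVT_segment _ f df x 0 (ltW x0) (fun y _ => fdf y).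
  exact: continuous_subspaceT.
move: xiI; rewrite in_itv /= => /andP[xi0 xix] E.
exists xi; first by rewrite mulr_le0 ?(ltW x0)// !ler0_norm ?(ltW x0)// lerN2.
have -> : (1 + x) * expR (c * x ^+ 2 / 2 - x) = f 0 - (f 0 - f x) by rewrite /f; ring.
rewrite E f0 /df; ring.
Qed.

Lemma expR_le_1Dx D x : 0 <= D <= 2^-1 -> `|x| <= D ->
  expR (x - (1 + 2 * D) * x ^+ 2 / 2) <= 1 + x.
Proof.
move=> /andP[D0 D2] xD.
have [xi [xix xi_x] E] := mul_expR_taylor (1 + 2 * D) x.
have xiD : - D <= xi by move: (le_trans xi_x xD); rewrite ler_norml => /andP[].
have K : 1 <= (1 + x) * expR ((1 + 2 * D) * x ^+ 2 / 2 - x).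
  rewrite E lerDl; apply: mulr_ge0 (expR_ge0 _); apply: mulr_ge0 xix _.
  nra.
rewrite -[X in expR X]opprB expRN -[_^-1]mul1r ler_pdivrMr ?expR_gt0//.
Qed.

Lemma expR_ge_1Dx D x : 0 <= D <= 2^-1 -> `|x| <= D ->
  1 + x <= expR (x - (1 - 2 * D) * x ^+ 2 / 2).
Proof.
move=> /andP[D0 D2] xD.
have [xi [xix xi_x] E] := mul_expR_taylor (1 - 2 * D) x.
have xiD : xi <= D by exact: le_trans (ler_norm _) (le_trans xi_x xD).
have K : (1 + x) * expR ((1 - 2 * D) * x ^+ 2 / 2 - x) <= 1.
  rewrite E gerDl; apply: mulr_le0_ge0 (expR_ge0 _); apply: mulr_ge0_le0 xix _.
  nra.
rewrite -[X in expR X]opprB expRN -[_^-1]mul1r ler_pdivlMr ?expR_gt0//.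
Qed.

Lemma prod_1Dx_ge D (y : nat -> R) mu n : 0 <= D <= 2^-1 ->
  (forall i, (i < n)%N -> `|mu * y i| <= D) ->
  expR (mu * (\sum_(i < n) y i) - (1 + 2 * D) * mu ^+ 2 * (\sum_(i < n) y i ^+ 2) / 2)
  <= \prod_(i < n) (1 + mu * y i).
Proof.
move=> D2 yD.
rewrite [X in expR X](_ : _ =
    \sum_(i < n) (mu * y i - (1 + 2 * D) * (mu * y i) ^+ 2 / 2)); last first.
  rewrite sumrB -mulr_sumr; congr (_ - _).
  by rewrite mulr_sumr mulr_suml; apply: eq_bigr => i _; ring.
rewrite expR_sum; apply: ler_prod => i _.
by rewrite expR_ge0 expR_le_1Dx// yD.
Qed.

Lemma prod_1Dx_le D (y : nat -> R) mu n : 0 <= D <= 2^-1 ->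
  (forall i, (i < n)%N -> `|mu * y i| <= D) ->
  \prod_(i < n) (1 + mu * y i) <=
  expR (mu * (\sum_(i < n) y i) - (1 - 2 * D) * mu ^+ 2 * (\sum_(i < n) y i ^+ 2) / 2).
Proof.
move=> D2 yD.
rewrite [X in expR X](_ : _ =
    \sum_(i < n) (mu * y i - (1 - 2 * D) * (mu * y i) ^+ 2 / 2)); last first.
  rewrite sumrB -mulr_sumr; congr (_ - _).
  by rewrite mulr_sumr mulr_suml; apply: eq_bigr => i _; ring.
rewrite expR_sum; apply: ler_prod => i _.
rewrite expR_ge_1Dx ?yD// andbT.
by apply: le_trans (expR_ge0 _) (expR_le_1Dx D2 (yD _ _)).
Qed.

(* Below [s] and [q] stand for a sum and its quadratic variation, [v] for the
   target value of [q], and [A = lam ^+ 2 * v]; the payoff compares the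
   exponential at [lam] with those at [lam * (1 - eta)] and [lam * (1 + eta)],
   which dominate it when [s] is too small, respectively too large. *)
Definition payoff (A eta M M1 M2 : R) : R :=
  expR (- (A * (2^-1 + 2 * eta))) *
    (M - expR (- (A * eta ^+ 2)) * M1 - expR (- (A * eta ^+ 2)) * M2).

(** Suppose [s = A (1 + x)], [C = A] and [D = 0]. The log-ratio of the exponential at
    [lam (1 + eta)] to the one at [lam] is [eta x A - eta^2 A / 2]; for [lam (1 - eta)] the first
    term changes sign. With the coefficient [expR (- (A eta^2))], domination thus starts at
    [|x| = 3 eta / 2]; the thresholds use [2 eta], and the margin pays for [D]. Below the threshold
    the scaled [M] is at most 1 by itself. *)
Lemma payoff_le1 A eta D s C M M1 M2 :
  0 <= A -> 0 < eta <= 2^-1 -> 0 <= D -> D <= eta ^+ 2 / 40 ->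
  0 <= C -> C <= A * (1 + D) ->
  M <= expR (s - (1 - 2 * D) * C / 2) -> 0 <= M1 ->
  expR ((1 + eta) * s - (1 + 2 * D) * ((1 + eta) ^+ 2 * C) / 2) <= M2 ->
  payoff A eta M M1 M2 <= 1.
Proof.
move=> A0 /andP[e0 e2] D0 De C0 CA hM hM1 hM2; rewrite /payoff.
have [h|h] := leP (s - (1 - 2 * D) * C / 2) (A * (2^-1 + 2 * eta)).
  apply: (@le_trans _ _ (expR (- (A * (2^-1 + 2 * eta))) * M)).
    apply: ler_wpM2l; first exact: expR_ge0.
    rewrite -addrA gerDl -opprD oppr_le0 addr_ge0// mulr_ge0 ?expR_ge0//.
    exact: le_trans (expR_ge0 _) hM2.
  rewrite expRN mulrC ler_pdivrMr ?expR_gt0// mul1r.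
  by apply: le_trans hM _; rewrite ler_expR.
have MM2 : M <= expR (- (A * eta ^+ 2)) * M2.
  apply: le_trans hM _.
  apply: le_trans (ler_wpM2l (expR_ge0 _) hM2).
  rewrite -expRD ler_expR.
  (* Inserting [eta] times [h] eliminates [s]; what is left is linear in [C], namely [K2], and
     [C <= A (1 + D)] reduces it to this inequality. *)
  have K : (1 + D) * (1 + eta) * (eta + 4 * D + 2 * D * eta) <= eta + 2 * eta ^+ 2.
    have D1 : D <= eta / 80 by nra.
    have h1 : eta + 4 * D + 2 * D * eta <= eta * (1 + eta / 8) by nra.
    have h2 : (1 + D) * (1 + eta) <= (1 + eta / 80) * (1 + eta) by nra.
    have h3 : (1 + eta / 80) * (1 + eta) * (1 + eta / 8) <= 1 + 2 * eta by nra.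
    apply: le_trans (_ : (1 + eta / 80) * (1 + eta) * (eta * (1 + eta / 8)) <= _).
      by apply: ler_pM => //; nra.
    nra.
  have K2 : C * ((1 + eta) * (eta + 4 * D + 2 * D * eta)) <= A * (eta + 2 * eta ^+ 2).
    apply: le_trans (_ : A * (1 + D) * ((1 + eta) * (eta + 4 * D + 2 * D * eta)) <= _).
      by apply: ler_wpM2r CA; nra.
    by rewrite -mulrA ler_wpM2l// mulrA.
  have := ler_wpM2l (ltW e0) (ltW h).
  nra.
apply: (@le_trans _ _ 0) => //; apply: mulr_ge0_le0; first exact: expR_ge0.
have := mulr_ge0 (expR_ge0 (- (A * eta ^+ 2))) hM1; lra.
Qed.

(** Mirror image, dominating with [lam (1 - eta)]. Here [C] has a favourable sign, so an excess of
    quadratic variation over [A] helps, whereas in [payoff_le1] it costs the factor [1 + D]. *)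
Lemma payoff_le0 A eta D s C M M1 M2 :
  0 <= A -> 0 < eta <= 2^-1 -> 0 <= D -> D <= eta ^+ 2 / 40 ->
  A <= C -> s <= (1 - 2 * eta) * A ->
  M <= expR (s - (1 - 2 * D) * C / 2) -> 0 <= M2 ->
  expR ((1 - eta) * s - (1 + 2 * D) * ((1 - eta) ^+ 2 * C) / 2) <= M1 ->
  payoff A eta M M1 M2 <= 0.
Proof.
move=> A0 /andP[e0 e2] D0 De AC sA hM hM2 hM1; rewrite /payoff.
have MM1 : M <= expR (- (A * eta ^+ 2)) * M1.
  apply: le_trans hM _.
  apply: le_trans (ler_wpM2l (expR_ge0 _) hM1).
  rewrite -expRD ler_expR.
  have K : 2 * (eta - eta ^+ 2) <= 2 * eta - eta ^+ 2 - 2 * D * (1 + (1 - eta) ^+ 2).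
    have h1 : (1 - eta) ^+ 2 <= 1 by nra.
    have h2 : 2 * D * (1 + (1 - eta) ^+ 2) <= 4 * D by nra.
    nra.
  have K2 : A * (2 * (eta - eta ^+ 2)) <= C * (2 * eta - eta ^+ 2 - 2 * D * (1 + (1 - eta) ^+ 2)).
    by apply: ler_pM => //; nra.
  clear K; have := ler_wpM2l (ltW e0) sA.
  nra.
apply: mulr_ge0_le0; first exact: expR_ge0.
have := mulr_ge0 (expR_ge0 (- (A * eta ^+ 2))) hM2; lra.
Qed.

End exponential_estimates.

(** * Block sums and the probability of crossing a level *)

Section blocks.
Context (d : measure_display) (Omega : measurableType d) (R : realType).
Variable mu : probability Omega R.
Variables (G : nat -> set (set Omega)) (Y : nat -> Omega -> R).
Hypothesis mds : bounded_mds mu G Y.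

Definition block_sum (a n : nat) (w : Omega) : R := \sum_(i < n) Y (a + i)%N w.
Definition block_var (a n : nat) (w : Omega) : R := \sum_(i < n) Y (a + i)%N w ^+ 2.

Lemma measurable_block_sum a n j : (a + n <= j)%N ->
  measurable_wrt (G j) (block_sum a n).
Proof.
move=> anj; apply: (measurable_wrt_sum (F := fun i => Y (a + i)%N)).
  exact: mds_sigma mds j.
move=> i i_n; have [mY _] := mds_bounded mds (a + i).
by apply: sub_measurable_wrt mY; apply: (mds_mono mds); lia.
Qed.

Lemma measurable_block_var a n j : (a + n <= j)%N ->
  measurable_wrt (G j) (block_var a n).
Proof.
move=> anj; apply: (measurable_wrt_sum (F := fun i w => Y (a + i)%N w ^+ 2)).
  exact: mds_sigma mds j.
move=> i i_n; have [mY _] := mds_bounded mds (a + i).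
rewrite (_ : (fun w => _) = Y (a + i)%N \* Y (a + i)%N).
  by apply: measurable_wrtM; (try exact: mds_sigma mds _);
    apply: sub_measurable_wrt mY; apply: (mds_mono mds); lia.
by apply/funext => w; rewrite expr2.
Qed.

(** The bound on the quadratic variation belongs to the event: it is known only almost surely and
    for large [n], while the probability estimate must hold for each fixed [N]. *)
Definition crossing N x v : set Omega :=
  [set w | exists2 n, (n <= N)%N & x <= block_sum 0 n w /\ block_var 0 n w <= v].

Lemma crossing_wrt N x v : G N (crossing N x v).
Proof.
rewrite (_ : crossing N x v = \bigcup_(n in `I_N.+1)
  ([set w | x <= block_sum 0 n w] `&` [set w | block_var 0 n w <= v])).
  have sG := mds_sigma mds N.
  rewrite -(measurable_g_measurableTypeE sG).
  apply: (@bigcup_measurable _ (g_sigma_algebraType (G N))) => n /= nN.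
  rewrite measurable_g_measurableTypeE//; apply: wrt_setI => //.
    by apply: wrt_preimage_ge; apply: measurable_block_sum; lia.
  by apply: wrt_preimage_le; apply: measurable_block_var; lia.
by apply/seteqP; split => w [n nN h]; exists n.
Qed.

(* Stop the exponential martingale as soon as the event occurs. *)
Lemma crossing_prob N lam x v D : 0 <= lam -> 0 <= D <= 2^-1 ->
  (forall j w, (j < N)%N -> `|lam * Y j w| <= D) ->
  (mu (crossing N x v) <=
   (expR (- (lam * x - (1 + 2 * D) * lam ^+ 2 * v / 2)))%:E)%E.
Proof.
move=> lam0 D2 hY; set L := lam * x - _.
pose I j w : R := lam * \1_(~` crossing j x v) w.
have bI j : bounded_wrt (G j) (I j).
  have sG := mds_sigma mds j.
  apply: bounded_wrtZ => //; apply: bounded_wrt_indic => //.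
  by apply: wrt_setC => //; exact: crossing_wrt.
have sG0 := mds_sigma mds 0.
have b1 : bounded_wrt (G 0) (cst 1 : Omega -> R) by exact: bounded_wrt_cst.
have := integral_mds_exp mds (N) bI b1.
under eq_Rintegral do rewrite mul1r.
have E1 : \int[mu]_w (cst 1 w) = 1 :> R.
  rewrite Rintegral_cst//=; have -> : mu setT = 1%E := probability_setT mu.
  by rewrite mulr1.
rewrite E1 => IE.
have mC : measurable (crossing N x v) by exact: mds_measurable mds N _ (crossing_wrt _ _ _).
have bE := bounded_mds_exp mds 0 N bI.
have bC : bounded_wrt (G N) (fun w => expR L * \1_(crossing N x v) w).
  by apply: bounded_wrtZ; last apply: bounded_wrt_indic (crossing_wrt _ _ _);
    exact: mds_sigma mds _.
have : \int[mu]_w (expR L * \1_(crossing N x v) w) <= 1.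
  rewrite -IE; apply: le_Rintegral => //.
  - by apply: bounded_wrt_integrable bC; exact: mds_measurable mds _.
  - by apply: bounded_wrt_integrable bE; exact: mds_measurable mds _.
  move=> w _; rewrite /mds_exp.
  have E0 n : (n <= N)%N -> 0 <= \prod_(i < n) (1 + I (0 + i)%N w * Y (0 + i)%N w).
    move=> nN; apply: prodr_ge0 => i _; rewrite /I add0n.
    have iN : (i < N)%N by exact: leq_trans (ltn_ord i) nN.
    have := hY i w iN; rewrite ler_norml => /andP[h1 h2].
    rewrite indicE; case: (_ \in _); rewrite ?mulr1 ?mulr0 ?mul0r; lra.
  rewrite indicE; case: (boolP (w \in _)) => [|_]; last by rewrite mulr0 E0.
  rewrite inE mulr1 => -[n nN hn].
  (* From the first crossing [k] on the coefficient is 0, so the product keeps the value it had at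
     [k], where both conditions of the event bound it below by [expR L]. *)
  pose P i := `[< x <= block_sum 0 i w /\ block_var 0 i w <= v >].
  have exP : exists i, P i by exists n; apply/asboolP.
  case: (ex_minnP exP) => k /asboolP[xk kv] kmin.
  have kN : (k <= N)%N by apply: leq_trans nN; apply: kmin; apply/asboolP.
  have Ilt i : (i < k)%N -> I i w = lam.
    move=> ik; rewrite /I indicE mem_set ?mulr1// => -[i' i'i hi'].
    have := kmin i' (asboolT hi'); lia.
  have Ige i : (k <= i)%N -> I i w = 0.
    move=> ki; rewrite /I indicE memNset ?mulr0//; apply; by exists k.
  rewrite -(subnKC kN) big_split_ord /= [X in _ <= _ * X]big1 ?mulr1; last first.
    by move=> i _; rewrite add0n Ige ?leq_addr// mul0r addr0.
  rewrite (eq_bigr (fun i : 'I_k => 1 + lam * Y i w)); last first.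
    by move=> i _; rewrite add0n Ilt.
  apply: le_trans (prod_1Dx_ge (y := Y ^~ w) D2 _); last first.
    by move=> i ik; apply: hY; exact: leq_trans kN.
  rewrite ler_expR /L lerB//.
    by rewrite ler_wpM2l.
  rewrite ler_pM2r// ler_wpM2l//; move: D2 => /andP[D0 _].
  by rewrite mulr_ge0 ?sqr_ge0//; lra.
rewrite RintegralZl//; last exact: integrable_indic.
rewrite /Rintegral integral_indic// setIT => h.
rewrite -[mu _]fineK ?fin_num_measure// lee_fin expRN.
by rewrite -[X in _ <= X]mul1r ler_pdivlMr ?expR_gt0// mulrC.
Qed.

End blocks.

(** * The bet on one block *)

Section lower_block.
Context (d : measure_display) (Omega : measurableType d) (R : realType).
Variable mu : probability Omega R.
Variables (G : nat -> set (set Omega)) (Y : nat -> Omega -> R).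
Hypothesis mds : bounded_mds mu G Y.

Lemma frozen_sum (y : nat -> R) (v e : R) (N : nat) : 0 < v ->
  (forall i, (i < N)%N -> y i ^+ 2 <= e) ->
  let z i := (\sum_(k < i) y k ^+ 2 < v)%R%:R * y i in
  (\sum_(k < N) y k ^+ 2 < v /\
    \sum_(k < N) z k = \sum_(k < N) y k /\
    \sum_(k < N) z k ^+ 2 = \sum_(k < N) y k ^+ 2) \/
  exists2 n, (n <= N)%N & \sum_(k < N) z k = \sum_(k < n) y k /\
    \sum_(k < N) z k ^+ 2 = \sum_(k < n) y k ^+ 2 /\
    v <= \sum_(k < n) y k ^+ 2 <= v + e.
Proof.
move=> v0 + z; elim: N => [|N IH] ye; first by left; rewrite !big_ord0.
have ye' i : (i < N)%N -> y i ^+ 2 <= e by move=> iN; apply: ye; exact: ltnW.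
have := ye N (ltnSn N).
rewrite !big_ord_recr /=; case: (IH ye') => [[Qv [-> ->]]|[n nN [-> [-> /andP[vn nv]]]]] yN.
  have zN : z N = y N by rewrite /z Qv mul1r.
  rewrite zN; have [h|h] := ltP (\sum_(k < N) y k ^+ 2 + y N ^+ 2) v.
    by left.
  right; exists N.+1 => //; rewrite !big_ord_recr /=; split => //; split => //.
  by rewrite h /= lerD// ltW.
have zN : z N = 0.
  rewrite /z ltNge (le_trans vn) ?mul0r//=.
  rewrite -(subnKC nN) big_split_ord /= lerDl; apply: sumr_ge0 => *; exact: sqr_ge0.
right; exists n; first exact: leqW.
by rewrite zN expr0n /= !addr0 vn nv.
Qed.

Definition active a v (j : nat) (w : Omega) : R :=
  \1_[set w | block_var Y a (j - a) w < v] w.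

Lemma bounded_active a v mu' j : bounded_wrt (G j) (fun w => mu' * active a v j w).
Proof.
have sG := mds_sigma mds j.
apply: bounded_wrtZ => //; have [ja|/ltnW aj] := leqP j a.
  (* Truncated subtraction makes the block empty for [j <= a], so the coefficient is constant there,
     hence measurable with respect to any [G j]. *)
  rewrite (_ : active a v j = cst (0 < v)%R%:R); first exact: bounded_wrt_cst.
  apply/funext => w; rewrite /active indicE /block_var.
  rewrite (_ : (j - a = 0)%N); last by lia.
  by congr ((_ : bool)%:R); apply/idP/idP; rewrite in_setE /= big_ord0.
apply: bounded_wrt_indic => //.
rewrite (_ : mkset _ = ~` [set w | v <= block_var Y a (j - a) w]).
  apply: wrt_setC => //; apply: wrt_preimage_ge; apply: measurable_block_var mds _ _ _ _.
  by rewrite subnKC.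
by apply/seteqP; split => w /=; rewrite ltNge => /negP.
Qed.

Definition block_exp a n v mu' := mds_exp Y (fun j w => mu' * active a v j w) a n.

(* Result of betting one unit against a large block sum: the payoff is at most
   1, and the price is at most its mean. *)
Definition betting_factor a n lam v eta (w : Omega) : R :=
  let A := lam ^+ 2 * v in
  1 + expR (- (A * (2^-1 + 2 * eta))) / 2 -
    payoff A eta (block_exp a n v lam w) (block_exp a n v (lam * (1 - eta)) w)
      (block_exp a n v (lam * (1 + eta)) w).

Lemma bounded_block_exp a n v mu' : bounded_wrt (G (a + n)%N) (block_exp a n v mu').
Proof. by apply: bounded_mds_exp mds _ _ _ _ => j; exact: bounded_active. Qed.

Lemma bounded_betting_factor a n lam v eta :
  bounded_wrt (G (a + n)%N) (betting_factor a n lam v eta).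
Proof.
have sG := mds_sigma mds (a + n).
pose A := lam ^+ 2 * v.
pose k1 := expR (- (A * (2^-1 + 2 * eta))).
pose k2 := expR (- (A * eta ^+ 2)).
rewrite (_ : betting_factor a n lam v eta = cst (1 + k1 / 2) \+
  ((fun w => - k1 * block_exp a n v lam w) \+
   ((fun w => k1 * k2 * block_exp a n v (lam * (1 - eta)) w) \+
    (fun w => k1 * k2 * block_exp a n v (lam * (1 + eta)) w)))).
  apply: bounded_wrtD => //; first exact: bounded_wrt_cst.
  apply: bounded_wrtD => //; first exact/bounded_wrtZ/bounded_block_exp.
  by apply: bounded_wrtD => //; exact/bounded_wrtZ/bounded_block_exp.
by apply/funext => w; rewrite /betting_factor /payoff /= -/k1 -/k2; ring.
Qed.

(** The three block exponentials weighted by [h] all integrate to the mean of [h], so the payoff has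
    mean [k1 (1 - 2 k2)] times that of [h]. Since [k2 <= 1/4], this covers the price [k1 / 2]: a
    supermartingale step. *)
Lemma integral_betting_factor a n lam v eta h :
  expR (- (lam ^+ 2 * v * eta ^+ 2)) <= 4^-1 ->
  (forall w, 0 <= h w) -> bounded_wrt (G a) h ->
  \int[mu]_w (h w * betting_factor a n lam v eta w) <= \int[mu]_w h w.
Proof.
move=> k4 h0 bh; have sG := mds_sigma mds (a + n).
have bh' : bounded_wrt (G (a + n)%N) h.
  by apply: sub_bounded_wrt bh; apply: (mds_mono mds); exact: leq_addr.
have int f : bounded_wrt (G (a + n)%N) f -> mu.-integrable setT (EFin \o f).
  by apply: bounded_wrt_integrable; exact: mds_measurable mds _.
pose A := lam ^+ 2 * v.
pose k1 := expR (- (A * (2^-1 + 2 * eta))).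
pose k2 := expR (- (A * eta ^+ 2)).
pose M mu' w := h w * block_exp a n v mu' w.
have bM mu' : bounded_wrt (G (a + n)%N) (M mu').
  by apply: bounded_wrtM => //; exact: bounded_block_exp.
have IM mu' : \int[mu]_w M mu' w = \int[mu]_w h w.
  exact: (integral_mds_exp mds n (bounded_active a v mu') bh).
rewrite (_ : (fun w => _) = (fun w => (1 + k1 / 2) * h w) \+
  ((fun w => - k1 * M lam w) \+
   ((fun w => k1 * k2 * M (lam * (1 - eta)) w) \+
    (fun w => k1 * k2 * M (lam * (1 + eta)) w)))); last first.
  by apply/funext => w; rewrite /M /betting_factor /payoff /= -/k1 -/k2; ring.
rewrite RintegralD//=; [|apply: int..]; last 2 first.
- exact: bounded_wrtZ.
- apply: bounded_wrtD => //; first exact: bounded_wrtZ.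
  by apply: bounded_wrtD => //; exact: bounded_wrtZ.
rewrite RintegralD//=; [|apply: int..]; last 2 first.
- exact: bounded_wrtZ.
- by apply: bounded_wrtD => //; exact: bounded_wrtZ.
rewrite RintegralD//=; [|apply: int; exact: bounded_wrtZ..].
rewrite !RintegralZl//; [|exact: int..].
rewrite !IM.
have : 0 <= \int[mu]_w h w by apply: Rintegral_ge0.
have := expR_gt0 (- (A * (2^-1 + 2 * eta))).
rewrite -/k1 => /ltW k10 I0; move: k4; rewrite -/A -/k2 => k4.
have k4' : 0 <= 4^-1 - k2 by rewrite subr_ge0.
have := mulr_ge0 (mulr_ge0 k10 I0) k4'; lra.
Qed.

(** The first bound keeps the capital nonnegative, the second is the gain on a block without a large
    sum. The latter constrains all partial sums because the freezing index depends on [w]. *)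
Lemma betting_factor_bounds a n lam v eta D w :
  0 < v -> 0 <= lam -> 0 < eta <= 2^-1 -> 0 <= D <= eta ^+ 2 / 40 ->
  1 <= lam ^+ 2 * v ->
  (forall i, (i < n)%N -> `|lam * (1 + eta) * Y (a + i)%N w| <= D) ->
  expR (- (lam ^+ 2 * v * (2^-1 + 2 * eta))) / 2 <= betting_factor a n lam v eta w /\
  (v <= block_var Y a n w ->
   (forall k, (k <= n)%N -> lam * block_sum Y a k w <= (1 - 2 * eta) * (lam ^+ 2 * v)) ->
   1 + expR (- (lam ^+ 2 * v * (2^-1 + 2 * eta))) / 2 <= betting_factor a n lam v eta w).
Proof.
move=> v0 lam0 /andP[e0 e2] /andP[D0 De] A1 hY.
pose A := lam ^+ 2 * v; rewrite -/A in A1 *.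
pose y i := Y (a + i)%N w.
pose z i := (\sum_(k < i) y k ^+ 2 < v)%R%:R * y i.
have D2 : 0 <= D <= 2^-1 by rewrite D0 /=; nra.
(* Since [A >= 1], a step bounded by [D] after scaling by [lam (1 + eta)] has square at most [D v];
   this is the overshoot behind [C <= A (1 + D)]. *)
have y2 i : (i < n)%N -> y i ^+ 2 <= D * v.
  move=> i_n; have h := hY i i_n.
  have : (lam * (1 + eta) * y i) ^+ 2 <= D ^+ 2.
    rewrite -(real_normK (num_real (_ * y i))) -(real_normK (num_real D)).
    by rewrite lerXn2r// ?nnegrE// [`|D|]ger0_norm.
  rewrite !exprMn => h2.
  have h3 : lam ^+ 2 * y i ^+ 2 <= D ^+ 2.
    apply: le_trans h2; rewrite -mulrA ler_wpM2l ?sqr_ge0// ler_peMl ?sqr_ge0//; nra.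
  have h4 : A * y i ^+ 2 <= D * v.
    rewrite /A mulrAC; apply: le_trans (ler_wpM2r (ltW v0) h3) _.
    by rewrite ler_wpM2r ?(ltW v0)//; nra.
  apply: le_trans h4; rewrite ler_peMl ?sqr_ge0//.
have zE mu' : block_exp a n v mu' w = \prod_(i < n) (1 + mu' * z i).
  apply: eq_bigr => i _; rewrite /z /active addKn indicE.
  have -> : (w \in [set w' | block_var Y a i w' < v]) = (\sum_(k < i) y k ^+ 2 < v).
    by apply/idP/idP; rewrite in_setE.
  by rewrite -mulrA.
have zD mu' : 0 <= mu' <= lam * (1 + eta) -> forall i, (i < n)%N -> `|mu' * z i| <= D.
  move=> /andP[m0 ml] i i_n; apply: le_trans (hY i i_n).
  rewrite (normrM mu') (normrM (lam * _)); apply: ler_pM => //.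
    by rewrite !ger0_norm//; exact: le_trans ml.
  by rewrite /z normrM ger0_norm// ler_piMl//; case: (_ < _).
pose s := \sum_(i < n) z i; pose q := \sum_(i < n) z i ^+ 2.
have q0 : 0 <= q by apply: sumr_ge0 => *; exact: sqr_ge0.
have l1 : 0 <= lam <= lam * (1 + eta) by apply/andP; nra.
have l2 : 0 <= lam * (1 - eta) <= lam * (1 + eta) by apply/andP; split; nra.
have l3 : 0 <= lam * (1 + eta) <= lam * (1 + eta) by rewrite lexx andbT; nra.
have M1 := prod_1Dx_le D2 (zD _ l1).
have M2 := prod_1Dx_ge D2 (zD _ l2).
have M3 := prod_1Dx_ge D2 (zD _ l3).
rewrite -!zE -/s -/q in M1 M2 M3.
rewrite (_ : lam * s - _ = lam * s - (1 - 2 * D) * (lam ^+ 2 * q) / 2) in M1; last by ring.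
rewrite (_ : _ * s - _ = (1 - eta) * (lam * s) -
  (1 + 2 * D) * ((1 - eta) ^+ 2 * (lam ^+ 2 * q)) / 2) in M2; last by ring.
rewrite (_ : _ * s - _ = (1 + eta) * (lam * s) -
  (1 + 2 * D) * ((1 + eta) ^+ 2 * (lam ^+ 2 * q)) / 2) in M3; last by ring.
have fs := frozen_sum v0 y2; rewrite /= -/z -/s -/q in fs.
have C0 : 0 <= lam ^+ 2 * q by rewrite mulr_ge0 ?sqr_ge0.
have CA : lam ^+ 2 * q <= A * (1 + D).
  rewrite /A -mulrA ler_wpM2l ?sqr_ge0// mulrDr mulr1.
  case: fs => [[qv [_ ->]]|[k kn [_ [-> /andP[_]]]]]; last by rewrite (mulrC v).
  by rewrite (le_trans (ltW qv))// lerDl mulr_ge0// ltW.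
have A0 : 0 <= A by lra.
have e02 : 0 < eta <= 2^-1 by rewrite e0.
have M20 := le_trans (expR_ge0 _) M2.
have M30 := le_trans (expR_ge0 _) M3.
rewrite /betting_factor -/A; split.
  by have := payoff_le1 A0 e02 D0 De C0 CA M1 M20 M3; lra.
move=> vQ hS.
case: fs => [[]|[k kn [sE [qE /andP[vk _]]]]].
  by rewrite ltNge vQ.
have sA : lam * s <= (1 - 2 * eta) * A by rewrite sE; exact: hS.
have AC : A <= lam ^+ 2 * q by rewrite /A ler_wpM2l ?sqr_ge0// qE.
by have := payoff_le0 A0 e02 D0 De AC sA M1 M30 M2; lra.
Qed.

End lower_block.

(** * The upper half of the law of the iterated logarithm *)

Section borel_cantelli_log.
Context (d : measure_display) (Omega : measurableType d) (R : realType).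
Variable mu : probability Omega R.

(** Reading [expR (- s * ln k)] as a power of [k], this compares the terms of a convergent Riemann
    series with the increments of a decreasing sequence; the sum then telescopes. *)
Lemma expR_ln_telescope (s : R) (k : nat) : 0 < s -> (0 < k)%N ->
  s * expR (- (1 + s) * ln k.+1%:R) <=
  expR (- s * ln k%:R) - expR (- s * ln k.+1%:R).
Proof.
move=> s0 k0.
have k0' : 0 < k%:R :> R by rewrite ltr0n.
have -> : expR (- s * ln k%:R) =
    expR (- s * ln k.+1%:R) * expR (s * (ln k.+1%:R - ln k%:R)) :> R.
  by rewrite -expRD; congr expR; ring.
rewrite -[X in _ <= _ - X]mulr1 -mulrBr.
have -> : - (1 + s) * ln k.+1%:R = - s * ln k.+1%:R + - ln k.+1%:R :> R by ring.
rewrite expRD mulrCA; apply: ler_wpM2l; first exact: expR_ge0.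
rewrite expRN lnK ?posrE//.
have h : k.+1%:R^-1 <= ln k.+1%:R - ln k%:R :> R.
  rewrite -lerN2 opprB -ln_div ?posrE//.
  have -> : k%:R / k.+1%:R = 1 + (- k.+1%:R^-1) :> R.
    by rewrite -[X in X / _](_ : k.+1%:R - 1 = _) ?mulrBl ?divff ?mul1r// -natr1 addrK.
  apply: le_ln1Dx; rewrite ltrN2 invf_lt1 ?ltr0n// ltr1n; lia.
have := expR_ge1Dx (s * (ln k.+1%:R - ln k%:R)).
move=> h2; rewrite lerBrDl; apply: le_trans h2; rewrite lerD2l.
by apply: ler_wpM2l h; exact: ltW.
Qed.

Lemma borel_cantelli_ln (E : nat -> set Omega) (s : R) : 0 < s ->
  (forall k, measurable (E k)) ->
  (\forall k \near \oo, (mu (E k) <= (expR (- (1 + s) * ln k%:R))%:E)%E) ->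
  {ae mu, forall w, \forall k \near \oo, ~ E k w}.
Proof.
move=> s0 mE [k0 _ hE].
(* The shift goes past the rank [k0] from which the bound holds and makes the index in the
   telescoping estimate positive. *)
pose E' k := E (k + k0).+2.
have E'0 : mu (lim_sup_set E') = 0%E.
  apply: lim_sup_set_cvg0; first by move=> k; exact: mE.
  apply: (@le_lt_trans _ _ (s^-1)%:E); last exact: ltry.
  apply: lime_le; first exact: is_cvg_nneseries.
  apply: nearW => n /=.
  pose f k : R := expR (- s * ln (k + k0).+1%:R).
  apply: (@le_trans _ _ (s^-1 * (f 0%N - f n))%:E); last first.
    rewrite lee_fin -[leRHS]mulr1 ler_wpM2l ?invr_ge0 ?(ltW s0)//.
    rewrite /f (@le_trans _ _ (expR (- s * ln (0 + k0).+1%:R)))//.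
      by rewrite gerBl expR_ge0.
    rewrite -[leRHS]expR0 ler_expR mulNr oppr_le0 mulr_ge0 ?(ltW s0)// ln_ge0//.
    by rewrite ler1n.
  elim: n => [|n IH]; first by rewrite big_geq// subrr mulr0.
  rewrite big_nat_recr//=.
  apply: (@le_trans _ _ ((s^-1 * (f 0%N - f n))%:E + (s^-1 * (f n - f n.+1))%:E)%E).
    apply: leeD => //; apply: le_trans (hE _ _) _; first by rewrite /=; lia.
    rewrite lee_fin ler_pdivlMl//.
    by have := @expR_ln_telescope s (n + k0).+1 s0 isT.
  rewrite -EFinD lee_fin -mulrDr [leLHS](_ : _ = s^-1 * (f 0%N - f n.+1))//.
  by congr (_ * _); ring.
have mE' : measurable (lim_sup_set E').
  by apply: bigcapT_measurable => n; apply: bigcup_measurable => k _; exact: mE.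
exists (lim_sup_set E'); split => // w /= h n _.
apply: contrapT => nh; apply: h; exists (n + k0).+2 => //= k nk Ek.
rewrite /= in nk.
apply: nh; exists (k - k0.+2)%N; first by rewrite /=; lia.
by rewrite /E' (_ : ((k - k0.+2) + k0).+2 = k)//; lia.
Qed.

End borel_cantelli_log.

Section upper_lil.
Context (d : measure_display) (Omega : measurableType d) (R : realType).
Variable mu : probability Omega R.

(** [ln k] plays the role of the iterated logarithm of [theta ^+ k], so steps are at most [dl] times
    the critical level at the end of a geometric block. All ratios are included: the upper half
    takes one close to 1, the lower half a large integer. *)
Definition small_steps (dl : R) (Y : nat -> Omega -> R) : Prop :=
  forall theta : R, 1 < theta -> \forall k \near \oo, forall j w,
    j%:R <= theta ^+ k -> `|Y j w| <= dl * Num.sqrt (theta ^+ k / ln k%:R).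

Definition unit_variance (Y : nat -> Omega -> R) : Prop :=
  {ae mu, forall w, (block_var Y 0 n w / n%:R) @[n --> \oo] --> (1 : R)}.

Lemma near_nat_ln_ge (c : R) : \forall n \near \oo, c <= ln (n%:R : R).
Proof.
near=> n.
have : expR c <= n%:R by near: n; exact: nbhs_infty_ger.
move=> h; have n0 : 0 < n%:R :> R by exact: lt_le_trans (expR_gt0 c) h.
by rewrite -(expRK c) ler_ln ?posrE ?expR_gt0.
Unshelve. all: by end_near. Qed.

Lemma near_nat_lnln_ge (c : R) : \forall n \near \oo, c <= ln (ln (n%:R : R)).
Proof.
near=> n.
have h : expR c <= ln (n%:R : R) by near: n; exact: near_nat_ln_ge.
have n0 : 0 < ln (n%:R : R) by exact: lt_le_trans (expR_gt0 c) h.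
by rewrite -(expRK c) ler_ln ?posrE ?expR_gt0.
Unshelve. all: by end_near. Qed.

Lemma upper_arith (e l u L N : R) : 0 < e <= 1 -> 0 <= l -> 0 <= u ->
  0 <= N * L -> l <= (1 + e / 4) * L -> u <= (1 + e / 4) * N ->
  2 * (1 + e) * l * u <= (1 + e) ^+ 2 * (2 * (N * L)).
Proof.
move=> /andP[e0 e1] l0 u0 NL hl hu.
have h1 := ler_pM l0 u0 hl hu.
have h2 : (1 + e) * (1 + e / 4) ^+ 2 <= (1 + e) ^+ 2 by nra.
have h3 := ler_wpM2r NL h2.
have b0 : 0 <= 1 + e by lra.
have h4 := ler_wpM2l b0 h1; lra.
Qed.

(** For the level [x k] and the variance [u k], [lam k = x k / u k] optimizes the Gaussian exponent,
    which is [b] times [ln k] with [b = 1 + e]. Allowing for [D] both in the exponential and in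
    [v k] still leaves [1 + e / 2] times [ln k], enough for Borel-Cantelli. *)
Theorem upper_lil (G : nat -> set (set Omega)) (Y : nat -> Omega -> R) (e dl : R) :
  0 < e <= 1 -> 0 <= dl <= e / 32 -> bounded_mds mu G Y -> small_steps dl Y ->
  unit_variance Y ->
  {ae mu, forall w, \forall n \near \oo,
    block_sum Y 0 n w <= (1 + e) * Num.sqrt (2 * (n%:R * ln (ln n%:R)))}.
Proof.
move=> /andP[e0 e1] /andP[dl0 dle] mds sY uY.
pose theta := 1 + e / 4; have th1 : 1 < theta by rewrite /theta; lra.
have th0 : 0 < theta by lra.
pose u k := theta ^+ k.
have u0 k : 0 < u k by rewrite exprn_gt0.
pose D := e / 16; pose b := 1 + e.
pose lam k := Num.sqrt (2 * b * ln k%:R / u k).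
pose x k := Num.sqrt (2 * b * ln k%:R * u k).
pose v k := (1 + D) * u k.
pose E k := crossing Y (Num.truncn (u k)) (x k) (v k).
have mE k : measurable (E k).
  exact: (mds_measurable mds (crossing_wrt mds _ _ _)).
have PE : \forall k \near \oo, (mu (E k) <= (expR (- (1 + e / 2) * ln k%:R))%:E)%E.
  near=> k.
  have k0 : (0 < k)%N by near: k; exact: nbhs_infty_gt.
  have lk : 0 < ln k%:R :> R.
    by apply: lt_le_trans (_ : 1 <= _) => //; near: k; exact: near_nat_ln_ge.
  have bl : 0 <= 2 * b * ln k%:R by apply: mulr_ge0 (ltW lk); rewrite /b; lra.
  have blu : 0 <= 2 * b * ln k%:R / u k by apply: divr_ge0 bl (ltW (u0 k)).
  have lam0 : 0 <= lam k by exact: sqrtr_ge0.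
  have D2 : 0 <= D <= 2^-1 by rewrite /D; lra.
  have hY j w : (j < Num.truncn (u k))%N -> `|lam k * Y j w| <= D.
    move=> jk; rewrite normrM ger0_norm//.
    have : `|Y j w| <= dl * Num.sqrt (u k / ln k%:R).
      have ju : j%:R <= theta ^+ k.
        apply: (@le_trans _ _ (Num.truncn (u k))%:R).
          by rewrite ler_nat ltnW.
        by rewrite truncn_le ltW.
      by move: j w ju {jk}; near: k; exact: sY.
    move=> h; apply: le_trans (ler_wpM2l lam0 h) _.
    rewrite mulrCA /lam -sqrtrM//.
    have -> : 2 * b * ln k%:R / u k * (u k / ln k%:R) = 2 * b.
      by field; rewrite !gt_eqF//.
    have h2 : Num.sqrt (2 * b) <= 2.
      rewrite -(@ler_pXn2r _ 2)// ?nnegrE ?sqrtr_ge0// sqr_sqrtr /b; lra.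
    apply: le_trans (ler_wpM2l dl0 h2) _; rewrite /D; lra.
  have := crossing_prob mds (x k) (v k) lam0 D2 hY.
  move/le_trans; apply; rewrite lee_fin ler_expR mulNr lerN2.
  have -> : lam k * x k = 2 * b * ln k%:R.
    rewrite /lam /x -sqrtrM//.
    have -> : 2 * b * ln k%:R / u k * (2 * b * ln k%:R * u k) = (2 * b * ln k%:R) ^+ 2.
      by field; rewrite gt_eqF.
    by rewrite sqrtr_sqr ger0_norm.
  rewrite /lam sqr_sqrtr//.
  have -> : (1 + 2 * D) * (2 * b * ln k%:R / u k) * v k / 2 =
      (1 + 2 * D) * (1 + D) * b * ln k%:R.
    by rewrite /v; field; rewrite gt_eqF.
  rewrite -mulrBl ler_wpM2r ?(ltW lk)// /D /b; nra.
have e20 : 0 < e / 2 by lra.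
have := borel_cantelli_ln e20 mE PE.
apply: filterS2 uY => w uY BC.
(* The least [k] with [n < theta ^+ k]. The bounds [u k <= theta n] and
   [ln k <= (1 + e / 4) ln (ln n)] each cost a factor [1 + e / 4], and [(1 + e / 4)^2 <= 1 + e]. *)
pose kk n : nat := (Num.truncn (ln n%:R / ln theta : R)).+1.
have lth : 0 < ln theta by rewrite ln_gt0.
have nEkk : \forall m \near \oo, ~ E (kk m) w.
  case: BC => K _ hK; near=> m; apply: hK => /=.
  rewrite /kk ltnW// ltnS truncn_ge_nat.
    rewrite ler_pdivlMr//; near: m; exact: near_nat_ln_ge.
  by rewrite divr_ge0 ?(ltW lth)//; near: m; exact: near_nat_ln_ge.
near=> n.
have n0 : (0 < n)%N by near: n; exact: nbhs_infty_gt.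
have n0' : 0 < n%:R :> R by rewrite ltr0n.
have ln1 : 1 <= ln n%:R :> R by near: n; exact: near_nat_ln_ge.
have lln : (4 / e) * ln ((ln theta)^-1 + 1) <= ln (ln n%:R).
  by near: n; exact: near_nat_lnln_ge.
have lln0 : 0 <= ln (ln n%:R) :> R by rewrite ln_ge0.
have [k kE] : exists k, k = kk n by exists (kk n).
have q0 : 0 <= ln n%:R / ln theta by rewrite divr_ge0 ?(ltW lth)//; lra.
have kle : k%:R - 1 <= ln n%:R / ln theta.
  by rewrite kE /kk -natr1 addrK truncn_le.
have klt : ln n%:R / ln theta < k%:R by rewrite kE /kk truncnS_gt.
have nu : n%:R < u k.
  rewrite -ltr_ln ?posrE// /u lnXn// -[ln theta *+ _]mulr_natl.
  by rewrite -ltr_pdivrMr.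
have un : u k <= theta * n%:R.
  rewrite /u kE /kk exprS ler_wpM2l ?(ltW th0)//.
  rewrite -ler_ln ?posrE ?exprn_gt0// lnXn// -[ln theta *+ _]mulr_natl -ler_pdivlMr//.
  by move: kle; rewrite kE /kk -natr1 addrK.
have lnk : ln k%:R <= (1 + e / 4) * ln (ln n%:R).
  have h0 : k%:R <= ln n%:R * ((ln theta)^-1 + 1) by rewrite mulrDr mulr1; lra.
  have c0 : 0 < (ln theta)^-1 + 1 by rewrite addr_gt0 ?invr_gt0.
  have l0 : 0 < ln n%:R :> R by lra.
  have k0 : 0 < k%:R :> R by rewrite kE ltr0n.
  have h : ln k%:R <= ln (ln n%:R * ((ln theta)^-1 + 1)).
    by rewrite ler_ln ?posrE ?mulr_gt0.
  rewrite lnM ?posrE// in h.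
  apply: (le_trans h).
  move: lln; rewrite -ler_pdivlMl; last by rewrite divr_gt0.
  rewrite invf_div; lra.
have nE : ~ E k w by rewrite kE; near: n.
have Qn : block_var Y 0 n w <= v k.
  apply: (@le_trans _ _ ((1 + D) * n%:R)); last first.
    by rewrite /v ler_wpM2l ?(ltW nu)// /D; lra.
  rewrite -ler_pdivrMr//; near: n.
  have D0 : 0 < D by rewrite /D; lra.
  move/cvgrPdist_le : uY => /(_ _ D0); apply: filterS => m.
  by rewrite ler_distl => /andP[+ _]; lra.
have nN : (n <= Num.truncn (u k))%N by rewrite truncn_ge_nat ?(ltW (u0 k))// ltW.
have Sx : block_sum Y 0 n w <= x k.
  rewrite leNgt; apply/negP => xS; apply: nE; exists n => //; split => //; exact: ltW.
apply: (le_trans Sx).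
have e1' : 0 <= 1 + e by rewrite addr_ge0// ltW.
rewrite -[X in X * _](ger0_norm e1') -sqrtr_sqr -sqrtrM ?sqr_ge0//.
apply: ler_wsqrtr.
have lk0 : 0 <= ln k%:R :> R by rewrite ln_ge0// kE ler1n.
have h3 : 0 <= n%:R * ln (ln n%:R) :> R by rewrite mulr_ge0.
by apply: upper_arith lk0 (ltW (u0 k)) h3 lnk un; rewrite e0.
Unshelve. all: by end_near. Qed.

End upper_lil.

(** * The lower half of the law of the iterated logarithm *)

Section lower_lil.
Context (d : measure_display) (Omega : measurableType d) (R : realType).
Variable mu : probability Omega R.

Lemma markov_bounded (G : set (set Omega)) (f : Omega -> R) (L : R) :
  sigma_algebra setT G -> G `<=` measurable -> bounded_wrt G f ->
  (forall w, 0 <= f w) -> \int[mu]_w f w <= 1 -> 0 < L ->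
  (mu [set w | (L <= f w)%R] <= (L^-1)%:E)%E.
Proof.
move=> sG Gm bf f0 f1 L0; pose C := [set w | L <= f w].
have GC : G C by apply: wrt_preimage_ge; case: bf.
have mC : measurable C by exact: Gm.
have : \int[mu]_w (L * \1_C w) <= 1.
  apply: le_trans f1; apply: le_Rintegral => //.
  - by apply: bounded_wrt_integrable Gm _; apply: bounded_wrtZ => //; exact: bounded_wrt_indic.
  - exact: bounded_wrt_integrable Gm bf.
  move=> w _; rewrite indicE; case: (boolP (w \in C)); last by rewrite mulr0.
  by rewrite inE mulr1.
rewrite RintegralZl//; last exact: integrable_indic.
rewrite /Rintegral integral_indic// setIT => h.
rewrite -/C -[mu _]fineK ?fin_num_measure// lee_fin.
by rewrite -[X in _ <= X]mul1r ler_pdivlMr// mulrC.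
Qed.

(** The square of [1 + x / 2] is at least [1 + x], and the product of the factors [1 + 1 / (k + 1)]
    telescopes; so half the harmonic gains still give an unbounded product. *)
Lemma prod_1Dhalf_inv (k0 n : nat) :
  (k0 + n).+1%:R / k0.+1%:R <= (\prod_(i < n) (1 + (2 * (k0 + i).+1%:R)^-1)) ^+ 2 :> R.
Proof.
elim: n => [|n IH]; first by rewrite big_ord0 addn0 divff// expr1n.
rewrite big_ord_recr /= exprMn.
have h : (k0 + n.+1).+1%:R / (k0 + n).+1%:R <= (1 + (2 * (k0 + n).+1%:R)^-1) ^+ 2 :> R.
  have c0 : (k0 + n).+1%:R != 0 :> R by rewrite pnatr_eq0.
  rewrite addnS -(natr1 (k0 + n).+1) mulrDl divff//.
  rewrite invfM mul1r; move: (_.+1%:R^-1) => x; nra.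
apply: le_trans (ler_pM _ _ IH h); rewrite ?divr_ge0//.
by rewrite [leRHS]mulrC mulrA divfK ?pnatr_eq0.
Qed.

Variables (G : nat -> set (set Omega)) (Y : nat -> Omega -> R).
Hypothesis mds : bounded_mds mu G Y.
Variables (N : nat -> nat) (lam v : nat -> R) (eta D : R) (K : nat).
Hypothesis N_mono : forall k, (N k <= N k.+1)%N.
Hypothesis eta_bounds : 0 < eta <= 2^-1.
Hypothesis D_bounds : 0 <= D <= eta ^+ 2 / 40.
Hypothesis v_gt0 : forall k, (K <= k)%N -> 0 < v k.
Hypothesis lam_ge0 : forall k, (K <= k)%N -> 0 <= lam k.
Hypothesis A_ge1 : forall k, (K <= k)%N -> 1 <= lam k ^+ 2 * v k.
Hypothesis A_ln : forall k, (K <= k)%N ->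
  lam k ^+ 2 * v k * (2^-1 + 2 * eta) = ln k.+1%:R.
Hypothesis A_large : forall k, (K <= k)%N ->
  expR (- (lam k ^+ 2 * v k * eta ^+ 2)) <= 4^-1.
Hypothesis steps : forall k j w, (K <= k)%N -> (j < N k.+1)%N ->
  `|lam k * (1 + eta) * Y j w| <= D.

Definition stuck k w :=
  v k <= block_var Y (N k) (N k.+1 - N k) w /\
  forall i, (i <= N k.+1 - N k)%N ->
    lam k * block_sum Y (N k) i w <= (1 - 2 * eta) * (lam k ^+ 2 * v k).

Let factor k := betting_factor Y (N k) (N k.+1 - N k) (lam k) (v k) eta.

Let factor_bounds k w : (K <= k)%N ->
  (2 * k.+1%:R)^-1 <= factor k w /\
  (stuck k w -> 1 + (2 * k.+1%:R)^-1 <= factor k w).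
Proof.
move=> Kk.
have st i : (i < N k.+1 - N k)%N -> `|lam k * (1 + eta) * Y (N k + i)%N w| <= D.
  by move=> ik; apply: steps => //; have := N_mono k; lia.
have [h1 h2] := betting_factor_bounds (v_gt0 Kk) (lam_ge0 Kk) eta_bounds D_bounds
  (A_ge1 Kk) st.
(* [A_ln] is designed for this identity: the price of a bet is half of [1 / (k + 1)], which tends to
   0 but has a divergent sum. *)
have E : expR (- (lam k ^+ 2 * v k * (2^-1 + 2 * eta))) / 2 = (2 * k.+1%:R)^-1.
  by rewrite A_ln// expRN lnK ?posrE// invfM mulrC.
rewrite E in h1 h2.
by split => // -[h3 h4]; exact: h2.
Qed.

Let capital k0 n w := \prod_(i < n) factor (k0 + i)%N w.

Let capital_ge0 k0 n w : (K <= k0)%N -> 0 <= capital k0 n w.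
Proof.
move=> Kk0; apply: prodr_ge0 => i _.
have [h _] := @factor_bounds (k0 + i)%N w (leq_trans Kk0 (leq_addr _ _)).
by apply: le_trans h; rewrite invr_ge0 mulr_ge0.
Qed.

Let capitalS k0 n : capital k0 n.+1 = capital k0 n \* factor (k0 + n)%N.
Proof. by apply/funext => w; rewrite /capital big_ord_recr. Qed.

Let bounded_capital k0 n : bounded_wrt (G (N (k0 + n))) (capital k0 n).
Proof.
elim: n => [|n IH].
  rewrite (_ : capital k0 0 = cst 1); first exact/bounded_wrt_cst/(mds_sigma mds).
  by apply/funext => w; rewrite /capital big_ord0.
rewrite capitalS; apply: bounded_wrtM; first exact: mds_sigma mds _.
  by apply: sub_bounded_wrt IH; apply: (mds_mono mds); rewrite addnS; exact: N_mono.
rewrite addnS -[X in G X](subnKC (N_mono (k0 + n))).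
exact: (bounded_betting_factor mds).
Qed.

Let integral_capital k0 n : (K <= k0)%N -> \int[mu]_w capital k0 n w <= 1.
Proof.
move=> Kk0; elim: n => [|n IH].
  rewrite (_ : (fun w => _) = cst 1); last by apply/funext => w; rewrite /capital big_ord0.
  rewrite Rintegral_cst//=; have -> : mu setT = 1%E := probability_setT mu.
  by rewrite mulr1.
apply: le_trans IH; rewrite capitalS /=.
apply: (integral_betting_factor mds).
- by apply: A_large; exact: leq_trans Kk0 (leq_addr _ _).
- by move=> w; exact: capital_ge0.
- exact: bounded_capital.
Qed.

(* Betting against the event multiplies the capital, whose mean stays at
   most 1, by at least the divergent product of the factors 1 + 1/(2(k+1))
   whenever every block is stuck. *)
Lemma not_always_stuck :
  {ae mu, forall w, forall k0, exists2 k, (k0 <= k)%N & ~ stuck k w}.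
Proof.
apply/ae_foralln => k0'; pose k0 := maxn K k0'.
have Kk0 : (K <= k0)%N by exact: leq_maxl.
pose P n : R := \prod_(i < n) (1 + (2 * (k0 + i).+1%:R)^-1).
have P0 n : 0 < P n.
  by apply: prodr_gt0 => i _; rewrite addr_gt0// invr_gt0 mulr_gt0.
pose C n := [set w | P n <= capital k0 n w].
have mC n : measurable (C n).
  apply: (mds_measurable mds (j := N (k0 + n))); apply: wrt_preimage_ge.
  by have [] := bounded_capital k0 n.
have muC n : (mu (C n) <= ((P n)^-1)%:E)%E.
  apply: (@markov_bounded (G (N (k0 + n)))) => //.
  - exact: mds_sigma mds _.
  - exact: mds_measurable mds _.
  - by move=> w; exact: capital_ge0.
  - exact: integral_capital.
have mCC : measurable (\bigcap_n C n) by exact: bigcapT_measurable.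
exists (\bigcap_n C n); split => //.
  apply/eqP; rewrite eq_le measure_ge0 andbT.
  apply/lee_addgt0Pr => eps eps0; rewrite add0e.
  (* Then [n.+1] exceeds [k0.+1 / eps^2], so the square of [P n] is at least [eps^-2] and [C n] has
     probability at most [eps]. *)
  pose n := Num.truncn (k0.+1%:R / eps ^+ 2).
  apply: (@le_trans _ _ (mu (C n))).
    by apply: le_measure; rewrite ?inE//; exact: bigcap_inf.
  apply: le_trans (muC n) _; rewrite lee_fin.
  rewrite -[eps]invrK lef_pV2 ?posrE ?invr_gt0//.
  rewrite -(@ler_pXn2r _ 2) ?nnegrE ?invr_ge0 ?(ltW eps0) ?(ltW (P0 _))//.
  apply: le_trans (prod_1Dhalf_inv k0 n).
  rewrite ler_pdivlMr// exprVn mulrC.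
  apply: le_trans (ltW (truncnS_gt _)) _.
  by rewrite ler_nat ltnS leq_addl.
move=> w /= nw n _; rewrite /C /= /P /capital.
apply: ler_prod => i _.
apply/andP; split; first by rewrite addr_ge0// invr_ge0 mulr_ge0.
have [_] := @factor_bounds (k0 + i)%N w (leq_trans Kk0 (leq_addr _ _)); apply.
apply: contrapT => ns; apply: nw; exists (k0 + i)%N => //.
by rewrite (leq_trans (leq_maxr K k0'))// leq_addr.
Qed.

End lower_lil.

(** * Choice of blocks and constants for the lower half *)

Section lower_lil_theorem.
Context (d : measure_display) (Omega : measurableType d) (R : realType).
Variable mu : probability Omega R.

Lemma block_sumD (Y : nat -> Omega -> R) a n i w :
  block_sum Y a (n + i) w = block_sum Y a n w + block_sum Y (a + n) i w.
Proof.
rewrite /block_sum big_split_ord /=; congr (_ + _).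
by apply: eq_bigr => j _; rewrite addnA.
Qed.

Lemma block_varD (Y : nat -> Omega -> R) a n i w :
  block_var Y a (n + i) w = block_var Y a n w + block_var Y (a + n) i w.
Proof.
rewrite /block_var big_split_ord /=; congr (_ + _).
by apply: eq_bigr => j _; rewrite addnA.
Qed.

Lemma block_sumN (Y : nat -> Omega -> R) a n w :
  block_sum (fun j w => - Y j w) a n w = - block_sum Y a n w.
Proof. exact: sumrN. Qed.

Lemma unit_varianceN (Y : nat -> Omega -> R) :
  unit_variance mu Y -> unit_variance mu (fun j w => - Y j w).
Proof.
rewrite /unit_variance (_ : block_var (fun j w => - Y j w) = block_var Y)//.
apply/funext => a; apply/funext => n; apply/funext => w.
by apply: eq_bigr => i _; rewrite sqrrN.
Qed.

Lemma small_stepsN dl (Y : nat -> Omega -> R) :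
  small_steps dl Y -> small_steps dl (fun j w => - Y j w).
Proof.
move=> sY theta th1; have := sY theta th1.
by apply: filterS => k h j w /h; rewrite normrN.
Qed.

Lemma near_shift1 (P : nat -> Prop) :
  (\forall n \near \oo, P n) -> \forall n \near \oo, P n.+1.
Proof. by case=> N _ hN; exists N => // n /= Nn; apply: hN => /=; exact: leqW. Qed.

Lemma lnln_le_geometric (t k n : nat) (eta : R) : (1 < n)%N ->
  (n <= t ^ k.+1)%N -> ln (ln (t%:R : R)) <= eta * ln k.+1%:R ->
  ln (ln n%:R) <= (1 + eta) * ln k.+1%:R.
Proof.
move=> n1 nt h.
have t1 : (1 < t)%N.
  rewrite ltnNge; apply/negP => t1; have := leq_exp2r t 1 (ltn0Sn k).
  by rewrite t1 exp1n => /(leq_trans nt); rewrite leqNgt n1.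
have n0 : 0 < n%:R :> R by rewrite ltr0n; lia.
have t0 : 0 < t%:R :> R by rewrite ltr0n; lia.
have lt0 : 0 < ln (t%:R : R) by rewrite ln_gt0// ltr1n.
have ln0 : 0 < ln (n%:R : R) by rewrite ln_gt0// ltr1n.
have h1 : ln (n%:R : R) <= k.+1%:R * ln t%:R.
  rewrite mulr_natl -lnXn// ler_ln ?posrE ?exprn_gt0//.
  by rewrite -natrX ler_nat.
have h2 : ln (ln (n%:R : R)) <= ln (k.+1%:R * ln t%:R).
  by rewrite ler_ln ?posrE ?mulr_gt0.
apply: (le_trans h2); rewrite lnM ?posrE//; lra.
Qed.

Lemma sqr_1B5_le (eta : R) : 0 < eta <= 16^-1 ->
  (1 - 5 * eta) ^+ 2 <= (1 - eta) / (1 + 4 * eta).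
Proof.
move=> /andP[e0 e1]; rewrite ler_pdivlMr; last by lra.
have -> : (1 - 5 * eta) ^+ 2 * (1 + 4 * eta) =
  1 - eta - 5 * eta - 15 * (eta * eta) + 100 * (eta * eta) * eta by ring.
have := mulr_ge0 (ltW e0) (ltW e0); nra.
Qed.

Lemma lower_arith (eta Z rn rN S B : R) : 0 < eta <= 16^-1 -> 0 <= Z ->
  rn <= (1 + eta) * Z -> rN <= eta * Z -> - S <= (1 + 1) * rN ->
  (1 - 2 * eta) * (1 - 5 * eta) * Z <= B ->
  (1 - 16 * eta) * rn <= S + B.
Proof.
move=> /andP[e0 e1] Z0 hn hN hS hB.
have e16 : 0 <= 1 - 16 * eta by lra.
have h1 := ler_wpM2l e16 hn.
have h2 := mulr_ge0 (mulr_ge0 (ltW e0) (ltW e0)) Z0.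
have h3 := mulr_ge0 (ltW e0) Z0.
lra.
Qed.

(** The blocks grow by a factor [t] so large that the sum collected before a block is negligible; as
    it may be negative, it is bounded below by the upper half for [- Y] with tolerance 1. All losses
    together stay within [16 eta], hence [eta = e / 16]. *)
Theorem lower_lil (G : nat -> set (set Omega)) (Y : nat -> Omega -> R) (e dl : R) :
  0 < e <= 1 -> 0 <= dl <= (e / 16) ^+ 2 / 160 -> bounded_mds mu G Y ->
  small_steps dl Y -> unit_variance mu Y ->
  {ae mu, forall w, forall n0, exists2 n, (n0 <= n)%N &
    (1 - e) * Num.sqrt (2 * (n%:R * ln (ln n%:R))) <= block_sum Y 0 n w}.
Proof.
move=> /andP[e0 e1] /andP[dl0 dle] mds sY uY.
pose eta := e / 16; rewrite -/eta in dle.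
have eE : e = 16 * eta by rewrite /eta; field.
have eta0 : 0 < eta by rewrite /eta; lra.
have eta1 : eta <= 16^-1 by rewrite /eta; lra.
(* At least [2 / eta^2]: the iterated logarithm scale at the start of a block is then at most [eta]
   times the one at its end. *)
pose t := (Num.truncn (2 / eta ^+ 2)).+2.
have tE : 2 / eta ^+ 2 <= t%:R.
  by apply: le_trans (ltW (truncnS_gt _)) _; rewrite ler_nat.
have t0 : 0 < t%:R :> R by rewrite ltr0n.
have t1 : 1 < t%:R :> R by rewrite ltr1n.
have lt0 : 0 < ln (t%:R : R) by rewrite ln_gt0.
have tetaE : 2 <= t%:R * eta ^+ 2 by rewrite -ler_pdivrMr ?exprn_gt0.
pose N k := (t ^ k)%N.
(* Block [k] ends at [t ^ k.+1], which is why logarithms are taken at [k.+1] throughout. *)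
pose u k : R := t%:R ^+ k.+1.
have NE k : (N k.+1)%:R = u k by rewrite /N natrX.
have u0 k : 0 < u k by rewrite exprn_gt0.
(* Slightly below the growth [u k - u k / t] of the quadratic variation over the block, so that the
   target is reached in all late blocks. *)
pose v k : R := (1 - eta) * u k.
have v0 k : 0 < v k by rewrite mulr_gt0//; lra.
(* Obtained by solving the equation of [A_ln] for [lam k ^+ 2 * v k]. *)
pose A k : R := 2 * ln k.+1%:R / (1 + 4 * eta).
have l0 k : 0 <= ln k.+1%:R :> R by rewrite ln_ge0// ler1n.
have A0 k : 0 <= A k by rewrite divr_ge0 ?mulr_ge0//; lra.
pose lam k : R := Num.sqrt (A k / v k).
have Av0 k : 0 <= A k / v k by apply: divr_ge0 (A0 k) (ltW (v0 k)).
have lamE k : lam k ^+ 2 * v k = A k.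
  by rewrite /lam (sqr_sqrtr (Av0 k)) divfK// gt_eqF.
pose D := eta ^+ 2 / 40.
have N_mono k : (N k <= N k.+1)%N by rewrite /N leq_exp2l.
have : \forall k \near \oo, 2 / eta ^+ 2 <= ln (k.+1%:R : R) /\
    forall j w, j%:R <= u k -> `|Y j w| <= dl * Num.sqrt (u k / ln k.+1%:R).
  have h1 := near_shift1 (near_nat_ln_ge (2 / eta ^+ 2)).
  have h2 := near_shift1 (sY _ t1).
  by apply: filterS2 h1 h2 => k.
case=> K _ hK.
have lK k : (K <= k)%N -> 2 <= ln (k.+1%:R : R) * eta ^+ 2.
  by move=> /hK[h _]; rewrite -ler_pdivrMr ?exprn_gt0.
have AK k : (K <= k)%N -> 2 <= A k * eta ^+ 2.
  move=> /lK h; rewrite /A mulrAC ler_pdivlMr; last by lra.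
  rewrite -mulrA; nra.
have eb : 0 < eta <= 2^-1 by rewrite eta0 /=; lra.
have Db : 0 <= D <= eta ^+ 2 / 40 by rewrite /D lexx andbT divr_ge0 ?sqr_ge0.
have A_ge1 k : (K <= k)%N -> 1 <= lam k ^+ 2 * v k.
  move=> /AK h; rewrite lamE; nra.
have A_ln k : (K <= k)%N -> lam k ^+ 2 * v k * (2^-1 + 2 * eta) = ln k.+1%:R.
  by move=> _; rewrite lamE /A; field; lra.
have A_large k : (K <= k)%N -> expR (- (lam k ^+ 2 * v k * eta ^+ 2)) <= 4^-1.
  move=> /AK h; rewrite lamE expRN lef_pV2 ?posrE ?expR_gt0//.
  apply: (@le_trans _ _ (expR 2)); last by rewrite ler_expR.
  have -> : 2 = 1 + 1 :> R by ring.
  rewrite expRD; have := @expR_ge1Dx R 1; nra.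
have steps k j w : (K <= k)%N -> (j < N k.+1)%N -> `|lam k * (1 + eta) * Y j w| <= D.
  move=> Kk jN; have [_ h] := hK k Kk.
  have l1 : 0 < ln k.+1%:R :> R.
    rewrite lt_neqAle l0 andbT eq_sym; apply/eqP => l00.
    by have := lK k Kk; rewrite l00 mul0r; lra.
  have {}h := h j w; rewrite -NE ler_nat in h.
  have {}h := h (ltnW jN); rewrite NE in h.
  rewrite normrM ger0_norm; last by rewrite mulr_ge0 ?sqrtr_ge0//; lra.
  apply: le_trans (ler_wpM2l _ h) _; first by rewrite mulr_ge0 ?sqrtr_ge0//; lra.
  rewrite [leLHS](_ : _ = (1 + eta) * dl * (lam k * Num.sqrt (u k / ln k.+1%:R))); last by ring.
  rewrite /lam -(sqrtrM _ (Av0 k)).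
  have -> : A k / v k * (u k / ln k.+1%:R) = 2 / ((1 + 4 * eta) * (1 - eta)).
    rewrite /A /v; field; rewrite !gt_eqF//=; lra.
  have h2 : Num.sqrt (2 / ((1 + 4 * eta) * (1 - eta))) <= 2.
    rewrite -[leRHS]ger0_norm// -sqrtr_sqr; apply: ler_wsqrtr.
    rewrite ler_pdivrMr; nra.
  apply: le_trans (ler_wpM2l _ h2) _; first by rewrite mulr_ge0//; lra.
  rewrite /D; nra.
have lam0 k : (K <= k)%N -> 0 <= lam k by move=> _; exact: sqrtr_ge0.
have := not_always_stuck mds N_mono eb Db (fun k _ => v0 k) lam0 A_ge1 A_ln A_large steps.
have Nup : {ae mu, forall w, \forall n \near \oo,
    - block_sum Y 0 n w <= (1 + 1) * Num.sqrt (2 * (n%:R * ln (ln n%:R)))}.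
  have e11 : 0 < (1 : R) <= 1 by rewrite ltr01 lexx.
  have dl1 : 0 <= dl <= 1 / 32 by rewrite dl0 /=; nra.
  have := upper_lil e11 dl1 (mdsN mds) (small_stepsN sY) (unit_varianceN uY).
  by apply: filterS => w; apply: filterS => n; rewrite block_sumN.
apply: filterS3 Nup uY => w Nup uY st n0.
have Ncvg m : \forall k \near \oo, (m <= N k)%N.
  near=> k.
  have mk : (m <= k)%N by near: k; exact: nbhs_infty_ge.
  by apply: (leq_trans mk); rewrite /N; apply: ltnW; exact: ltn_expl.
have Nvar : \forall k \near \oo, v k <= block_var Y (N k) (N k.+1 - N k) w.
  have e20 : 0 < eta / 2 by lra.
  move/cvgrPdist_le : uY => /(_ _ e20) [M _ hM].
  near=> k.
  have N0 i : 0 < (N i)%:R :> R by rewrite /N natrX exprn_gt0.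
  have bd i : (M <= N i)%N -> (1 - eta / 2) * (N i)%:R <= block_var Y 0 (N i) w /\
      block_var Y 0 (N i) w <= (1 + eta / 2) * (N i)%:R.
    move=> /hM; rewrite /= ler_distl => /andP[h1 h2]; split.
      by rewrite -ler_pdivlMr//; lra.
    by rewrite -ler_pdivrMr//; lra.
  have MN : (M <= N k)%N by near: k; exact: Ncvg.
  have [_ h1] := bd k MN.
  have [h2 _] := bd k.+1 (leq_trans MN (N_mono k)).
  have := block_varD Y 0 (N k) (N k.+1 - N k) w; rewrite subnKC// add0n => h3.
  have h4 : (N k)%:R * t%:R = u k by rewrite -NE /N expnSr natrM.
  have N0k := N0 k; rewrite NE in h2.
  have h5 : 2 * (N k)%:R <= u k * (eta / 2).
    rewrite -h4 -mulrA mulrC ler_wpM2l ?(ltW N0k)//.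
    have : t%:R * eta ^+ 2 <= t%:R * (eta / 16).
      by rewrite ler_wpM2l ?(ltW t0)//; nra.
    lra.
  rewrite /v; nra.
have all_large : \forall k \near \oo,
    [/\ v k <= block_var Y (N k) (N k.+1 - N k) w,
      - block_sum Y 0 (N k) w <= (1 + 1) * Num.sqrt (2 * ((N k)%:R * ln (ln (N k)%:R))),
      (maxn n0 2 <= N k)%N, ln (ln (t%:R : R)) <= eta * ln k.+1%:R & (K <= k)%N].
  near=> k; split.
  - by near: k.
  - near: k; case: Nup => M _ hM.
    by have := Ncvg M; apply: filterS => k; exact: hM.
  - by near: k; exact: Ncvg.
  - rewrite -ler_pdivrMl//; near: k.
    exact: (near_shift1 (near_nat_ln_ge (eta^-1 * ln (ln t%:R)))).
  - by near: k; exact: nbhs_infty_ge.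
case: all_large => k0 _ hk0.
(* This block beyond [k0] is not stuck although its quadratic variation reaches the target, so one
   of its partial sums is large. *)
have [k k0k nst] := st k0.
have [hvar hlow n0N lnlnt Kk] := hk0 k k0k.
have [i iN hi] : exists2 i, (i <= N k.+1 - N k)%N &
    (1 - 2 * eta) * (lam k ^+ 2 * v k) < lam k * block_sum Y (N k) i w.
  apply: contrapT => ni; apply: nst; split => // i iN.
  by rewrite leNgt; apply/negP => hi; apply: ni; exists i.
pose n := (N k + i)%N; exists n.
  by rewrite /n (leq_trans _ (leq_addr _ _))// (leq_trans _ n0N)// leq_maxl.
have N1 : (1 < N k)%N by rewrite (leq_trans _ n0N)// leq_maxr.
have nN : (n <= N k.+1)%N by rewrite /n -(subnKC (N_mono k)) leq_add2l.
pose l : R := ln k.+1%:R.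
have l1 : 0 < l.
  rewrite lt_neqAle l0 andbT eq_sym; apply/eqP => l00.
  by have := lK k Kk; rewrite -/l l00 mul0r; lra.
have Lk : ln (ln (N k)%:R) <= (1 + eta) * l.
  by apply: (@lnln_le_geometric t) => //; exact: N_mono.
have Ln : ln (ln n%:R) <= (1 + eta) * l.
  by apply: (@lnln_le_geometric t) => //; exact: leq_trans N1 (leq_addr _ _).
(* The scale at the end of the block; the scales at [N k] and [n] and the block sum are all compared
   with it. *)
pose Z : R := Num.sqrt (2 * u k * l).
have Z0 : 0 <= Z by exact: sqrtr_ge0.
have Z2 : Z ^+ 2 = 2 * u k * l by rewrite sqr_sqrtr// mulr_ge0 ?mulr_ge0 ?ltW.
have le_Z (x c : R) : 0 <= c -> x <= c ^+ 2 * (2 * u k * l) -> Num.sqrt x <= c * Z.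
  move=> c0 h; rewrite -[X in X * _](ger0_norm c0) -sqrtr_sqr -sqrtrM ?sqr_ge0//.
  exact: ler_wsqrtr.
have bn : Num.sqrt (2 * (n%:R * ln (ln n%:R))) <= (1 + eta) * Z.
  apply: le_Z; first by lra.
  have h1 : n%:R * ln (ln n%:R) <= u k * ((1 + eta) * l).
    apply: (@le_trans _ _ (n%:R * ((1 + eta) * l))); first by rewrite ler_wpM2l.
    rewrite ler_wpM2r//; last by rewrite -NE ler_nat.
    by rewrite mulr_ge0 ?(ltW l1)//; lra.
  have h2 : 0 <= u k * l by rewrite mulr_ge0 ?ltW.
  nra.
have bN : Num.sqrt (2 * ((N k)%:R * ln (ln (N k)%:R))) <= eta * Z.
  apply: le_Z; first by lra.
  have h1 : (N k)%:R * ln (ln (N k)%:R) <= (N k)%:R * ((1 + eta) * l).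
    by rewrite ler_wpM2l.
  have h4 : u k = (N k)%:R * t%:R by rewrite -NE /N expnSr natrM.
  have h5 : 0 <= (N k)%:R * l by apply: mulr_ge0 (ltW l1).
  have h6 := ler_wpM2l h5 tetaE.
  rewrite h4; nra.
have bb : (1 - 2 * eta) * (1 - 5 * eta) * Z <= block_sum Y (N k) i w.
  have A00 : 0 < A k by have := A_ge1 k Kk; rewrite lamE; lra.
  have lam00 : 0 < lam k by rewrite sqrtr_gt0 divr_gt0.
  have h1 : (1 - 2 * eta) * (lam k * v k) <= block_sum Y (N k) i w.
    rewrite -(ler_pM2l lam00); apply: le_trans (ltW hi).
    rewrite [leLHS](_ : _ = (1 - 2 * eta) * (lam k ^+ 2 * v k))//; ring.
  apply: le_trans h1; rewrite -mulrA; apply: ler_wpM2l; first by lra.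
  have lv0 : 0 <= lam k * v k by rewrite mulr_ge0 ?ltW.
  have z0 : 0 <= (1 - 5 * eta) * Z by apply: mulr_ge0 _ Z0; lra.
  rewrite -(@ler_pXn2r _ 2) ?nnegrE//.
  rewrite exprMn Z2.
  (* [lam k * v k] is the root of [A k * v k], that is, [Z] times the root of
     [(1 - eta) / (1 + 4 * eta)], which is at least [1 - 5 * eta]. *)
  have -> : (lam k * v k) ^+ 2 = (1 - eta) / (1 + 4 * eta) * (2 * u k * l).
    have -> : (lam k * v k) ^+ 2 = lam k ^+ 2 * v k * v k by ring.
    by rewrite lamE /A /v /l; field; lra.
  apply: ler_wpM2r; first by rewrite mulr_ge0 ?mulr_ge0 ?ltW.
  by apply: sqr_1B5_le; rewrite eta0.
have := block_sumD Y 0 (N k) i w; rewrite add0n -/n => ->.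
rewrite eE; apply: (lower_arith _ Z0 bn bN hlow bb); rewrite eta0.
Unshelve. all: by end_near. Qed.

End lower_lil_theorem.

(** * Bounded conditional expectations *)

Section conditional_expectation.
Context (d : measure_display) (Omega : measurableType d) (R : realType).
Variable mu : probability Omega R.

(** The identity, seen as a random variable into the same space equipped with [G], has as
    distribution [P] the restriction of [mu] to [G]. The conditional expectation is the
    Radon-Nikodym derivative, with respect to [P], of the charge of density [Z] restricted to
    [G]. *)
Lemma cond_exp_exists (G : set (set Omega)) (Z : Omega -> R) :
  sigma_algebra setT G -> G `<=` measurable ->
  mu.-integrable setT (EFin \o Z) ->
  exists e : Omega -> R, [/\ measurable_wrt G e,
    mu.-integrable setT (EFin \o e) & forall A, G A ->
    (\int[mu]_(w in A) (e w)%:E = \int[mu]_(w in A) (Z w)%:E)%E].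
Proof.
move=> sG Gm Zi.
pose OG : measurableType _ := g_sigma_algebraType G.
have mG (A : set OG) : measurable A -> measurable (A : set Omega).
  by rewrite measurable_g_measurableTypeE// => /Gm.
pose pi : Omega -> OG := idfun.
have mpi : measurable_fun setT pi by move=> _ A mA; rewrite setTI; exact: mG.
pose X : {mfun Omega >-> OG} := HB.pack pi (isMeasurableFun.Build _ _ _ _ pi mpi).
pose P : probability OG R := distribution mu X.
pose nu : {charge set Omega -> \bar R} := induced_charge Zi.
pose nu' : set OG -> \bar R := nu.
have nu0 : nu' set0 = 0%E by exact: charge0.
have nuf (A : set OG) : measurable A -> nu' A \is a fin_num.
  by move=> /mG mA; exact: fin_num_measure.
have nus : semi_sigma_additive nu'.
  move=> F mF tF mUF; apply: charge_semi_sigma_additive => //.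
  - by move=> i; exact: mG.
  - exact: mG.
pose nuG : {charge set OG -> \bar R} := HB.pack nu' (isCharge.Build _ _ _ nu' nu0 nuf nus).
have nuP : nuG `<< P.
  apply/null_content_dominatesP => A mA PA0.
  apply: null_set_integral => //; first exact: mG.
  by apply: measurable_funTS; exact: measurable_int Zi.
pose f := Radon_Nikodym nuG P.
have ffin w : f w \is a fin_num by exact: Radon_Nikodym_fin_num.
have fi : P.-integrable setT f by exact: Radon_Nikodym_integrable.
have fE A : measurable A -> nuG A = (\int[P]_(w in A) f w)%E.
  by move=> mA; exact: Radon_Nikodym_integral.
have mf : measurable_fun setT f by exact: measurable_int fi.
have mf' : measurable_fun setT (f : Omega -> \bar R) by exact: measurableT_comp mf mpi.
pose e w : R := fine (f w).
have eE : EFin \o e = f by apply/funext => w /=; rewrite fineK.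
have fiO : mu.-integrable setT (f : Omega -> \bar R).
  apply/integrableP; split => //.
  move/integrableP : fi => [_]; rewrite ge0_integral_pushforward//.
  exact: measurableT_comp.
exists e; split.
- by apply/(measurable_wrtP _ sG)/measurable_EFinP; rewrite eE.
- by rewrite eE.
- move=> A GA; have mA : measurable (A : set OG) by rewrite measurable_g_measurableTypeE.
  transitivity (nuG A); last by [].
  rewrite fE// (@integral_pushforward _ _ _ _ _ _ mpi)//; last first.
    by apply: (integrableS measurableT) => //; exact: mG.
  by apply: eq_integral => w _; rewrite /= fineK.
Qed.

Lemma Rintegral_indic_mul (A : set Omega) (D : Omega -> R) :
  \int[mu]_w (\1_A w * D w) = \int[mu]_(w in A) D w.
Proof.
rewrite [RHS]Rintegral_mkcond; apply: eq_Rintegral => w _.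
by rewrite patchE indicE; case: (w \in A); rewrite ?mul1r ?mul0r.
Qed.

Lemma Rintegral_le_norm (D : Omega -> R) (c : R) : measurable_fun setT D ->
  (forall w, `|D w| <= c) -> `|\int[mu]_w D w| <= c.
Proof.
move=> mD Dc.
have Di : mu.-integrable setT (EFin \o D).
  apply: measurable_bounded_integrable => //.
    by rewrite -ge0_fin_numE//; exact: fin_num_measure.
  exists c; split; first exact: num_real.
  by move=> x cx w _; exact: le_trans (Dc w) (ltW cx).
apply: le_trans (le_normr_Rintegral _ Di) _ => //.
apply: (@le_trans _ _ (\int[mu]_w (cst c w))).
  apply: le_Rintegral => //; first exact: integrable_norm.
  exact: finite_measure_integrable_cst.
rewrite Rintegral_cst//=; have -> : mu setT = 1%E := probability_setT mu.
by rewrite mulr1.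
Qed.

(* Approximate h uniformly by the staircase truncn (n (h + M)) / n. *)
Lemma centered_bounded (G : set (set Omega)) (D h : Omega -> R) (c : R) :
  sigma_algebra setT G -> G `<=` measurable -> measurable_fun setT D ->
  (forall w, `|D w| <= c) ->
  (forall A, G A -> \int[mu]_(w in A) D w = 0) ->
  bounded_wrt G h -> \int[mu]_w (h w * D w) = 0.
Proof.
move=> sG Gm mD Dc DG bh.
have bD : bounded_wrt measurable D.
  by split; [move=> B mB; rewrite -[X in measurable X]setTI; exact: mD|exists c].
have sm : sigma_algebra setT (@measurable _ Omega).
  by split; [exact: measurable0|move=> A mA; rewrite setTD; exact: measurableC
            |exact: bigcupT_measurable].
have bGm (f : Omega -> R) : bounded_wrt G f -> bounded_wrt measurable f by exact: sub_bounded_wrt.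
have int f : bounded_wrt measurable f -> mu.-integrable setT (EFin \o f).
  exact: bounded_wrt_integrable.
have c0 : 0 <= c by apply: le_trans (Dc point); exact: normr_ge0.
case: (bh) => mh [M hM].
have M0 : 0 <= M by apply: le_trans (hM point); exact: normr_ge0.
have key (n : nat) : `|\int[mu]_w (h w * D w)| <= n.+1%:R^-1 * c.
  pose N : R := n.+1%:R; have N0 : 0 < N by rewrite ltr0n.
  pose y w := N * (h w + M).
  have y0 w : 0 <= y w.
    rewrite mulr_ge0 ?(ltW N0)//; have := hM w; rewrite ler_norml => /andP[]; lra.
  pose K := Num.truncn (N * (M + M)).
  have yK w : (Num.truncn (y w) <= K)%N.
    apply: le_truncn; rewrite ler_wpM2l ?(ltW N0)// lerD2r.
    exact: le_trans (ler_norm _) (hM w).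
  pose A i := [set w | i.+1%:R / N - M <= h w].
  have GA i : G (A i) by exact: wrt_preimage_ge.
  (* Written as a sum of indicators of level sets in [G], the staircase integrates to 0 against
     [D]. *)
  pose st w := \sum_(i < K) N^-1 * \1_(A i) w.
  have stE w : st w = N^-1 * (Num.truncn (y w))%:R.
    rewrite /st -mulr_sumr; congr (_ * _).
    have Aw i : \1_(A i) w = (i < Num.truncn (y w))%N%:R :> R.
      rewrite indicE; congr (_%:R); congr nat_of_bool.
      rewrite truncn_ge_nat//; apply/idP/idP; rewrite in_setE /A /= /y.
        by rewrite lerBlDr ler_pdivrMr// mulrC.
      by rewrite lerBlDr ler_pdivrMr// mulrC.
    under eq_bigr do rewrite Aw.
    rewrite -natr_sum; congr (_%:R).
    rewrite (eq_bigr (fun i : 'I_K => if (i < Num.truncn (y w))%N then 1%N else 0%N)).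
      by rewrite -big_mkcond /= -(big_ord_widen _ (fun=> 1%N) (yK w)) sum1_card card_ord.
    by move=> i _; case: (_ < _)%N.
  have bst : bounded_wrt G st.
    rewrite (_ : st = fun w => N^-1 * (Num.truncn (y w))%:R); last exact/funext.
    split; last first.
      exists (N^-1 * K%:R) => w; rewrite ger0_norm ?mulr_ge0 ?invr_ge0 ?(ltW N0)//.
      by rewrite ler_wpM2l ?invr_ge0 ?(ltW N0)// ler_nat.
    rewrite -(funext stE).
    apply: (measurable_wrt_sum (F := fun i w => N^-1 * \1_(A i) w)) => // i _.
    by apply: measurable_wrtM; [|exact: measurable_wrt_cst|exact: measurable_wrt_indic].
  have Ist : \int[mu]_w (st w * D w) = 0.
    rewrite /st; elim: (K) => [|k IH].
      under eq_Rintegral do rewrite big_ord0 mul0r.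
      by rewrite Rintegral_cst// mul0r.
    have bI i : bounded_wrt G (fun w => N^-1 * \1_(A i) w).
      by apply: bounded_wrtZ => //; exact: bounded_wrt_indic.
    have bI2 i := bounded_wrtM sm (bGm _ (bI i)) bD.
    rewrite (_ : (fun w => _) = (fun w => (\sum_(i < k) N^-1 * \1_(A i) w) * D w) \+
      (fun w => N^-1 * \1_(A k) w * D w)); last first.
      by apply/funext => w; rewrite big_ord_recr /= mulrDl.
    rewrite RintegralD//=; last 2 first.
    - rewrite (_ : (fun w => _) = fun w => \sum_(i < k) N^-1 * \1_(A i) w * D w); last first.
        by apply/funext => w; rewrite mulr_suml.
      rewrite (_ : EFin \o _ = fun w => (\sum_(i < k) (N^-1 * \1_(A i) w * D w)%:E)%E); last first.
        by apply/funext => w; rewrite /= sumEFin.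
      apply: integrable_sum => //= i _; exact: int (bI2 i).
    - exact: int (bI2 k).
    rewrite IH add0r.
    under eq_Rintegral do rewrite -mulrA.
    rewrite RintegralZl//; last first.
      by apply: int; apply: bounded_wrtM => //; apply: bGm; exact: bounded_wrt_indic.
    by rewrite Rintegral_indic_mul DG// mulr0.
  have bsD := bounded_wrtM sm (bGm _ bst) bD.
  have bhD := bounded_wrtM sm (bGm _ bh) bD.
  have bMD : bounded_wrt measurable (fun w => M * D w) by exact: bounded_wrtZ.
  have -> : \int[mu]_w (h w * D w) = \int[mu]_w ((h w + M - st w) * D w).
    rewrite [RHS](_ : _ = \int[mu]_w ((h w * D w + M * D w) - st w * D w)); last first.
      by apply: eq_Rintegral => w _; ring.
    rewrite RintegralB//; last 2 first.
    - by apply: (int (fun w => h w * D w + M * D w)); exact: bounded_wrtD.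
    - exact: int bsD.
    rewrite Ist subr0 RintegralD//; last 2 first.
    - exact: int bhD.
    - exact: int bMD.
    rewrite RintegralZl//; last exact: int.
    by rewrite DG ?mulr0 ?addr0//; exact: wrt_setT.
  apply: Rintegral_le_norm.
    apply: measurable_funM => //; apply: measurable_funB.
      apply: measurable_funD => //.
      by move=> _ B mB; rewrite setTI; exact/Gm/mh.
    by case: bst => mst _ _ B mB; rewrite setTI; exact/Gm/mst.
  move=> w; rewrite normrM; apply: ler_pM => //.
  have -> : h w + M - st w = N^-1 * (y w - (Num.truncn (y w))%:R).
    by rewrite stE /y mulrBr mulKf// gt_eqF.
  have t1 : (Num.truncn (y w))%:R <= y w by rewrite truncn_le.
  have t2 := truncnS_gt (y w); rewrite -natr1 in t2.
  rewrite ger0_norm; last by rewrite mulr_ge0 ?invr_ge0 ?(ltW N0)//; lra.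
  by rewrite ler_piMr ?invr_ge0 ?(ltW N0)//; lra.
apply/eqP; rewrite -normr_le0 leNgt; apply/negP => I0.
have [n _ /(_ n (leqnn n)) /= hn] := near_infty_natSinv_lt (PosNum (divr_gt0 I0 (ltr_pwDl ltr01 c0))).
have := key n; apply/negP; rewrite -ltNge.
apply: (@le_lt_trans _ _ (n.+1%:R^-1 * (1 + c))).
  by rewrite ler_wpM2l ?invr_ge0// lerDr.
by rewrite -ltr_pdivlMr// ltr_pwDl.
Qed.

(** The event [c < e] lies in [G]; over it [e - c] is positive, yet it has the same integral as
    [Z - c], which is nonpositive. *)
Lemma cond_exp_le (G : set (set Omega)) (Z e : Omega -> R) (c : R) :
  sigma_algebra setT G -> G `<=` measurable ->
  mu.-integrable setT (EFin \o Z) -> mu.-integrable setT (EFin \o e) ->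
  measurable_wrt G e ->
  (forall A, G A ->
    (\int[mu]_(w in A) (e w)%:E = \int[mu]_(w in A) (Z w)%:E)%E) ->
  (forall w, Z w <= c) -> mu [set w | c < e w] = 0%E.
Proof.
move=> sG Gm Zi ei me eZ Zc; pose A := [set w | c < e w].
have GA : G A by exact: wrt_preimage_gt.
have mA := Gm _ GA.
have ZiA : mu.-integrable A (EFin \o Z) by exact: integrableS Zi.
have eiA : mu.-integrable A (EFin \o e) by exact: integrableS ei.
have ciA : mu.-integrable A (EFin \o cst c).
  exact: finite_measure_integrable_cst.
have ecA : mu.-integrable A (EFin \o (e \- cst c)).
  by rewrite (_ : EFin \o _ = (EFin \o e) \- (EFin \o cst c))%E//; exact: integrableB.
have I0 : (\int[mu]_(w in A) `|((e \- cst c) w)%:E| = 0)%E.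
  transitivity (\int[mu]_(w in A) ((e \- cst c) w)%:E)%E.
    apply: eq_integral => w; rewrite inE /= => Aw.
    by rewrite ger0_norm// subr_ge0 ltW.
  apply/eqP; rewrite eq_le; apply/andP; split; last first.
    by apply: integral_ge0 => w Aw; rewrite lee_fin subr_ge0 ltW.
  under eq_integral do rewrite EFinB.
  rewrite integralB//= eZ// sube_le0.
  by apply: le_integral => // w _; rewrite lee_fin Zc.
have /(ae_eq_integral_abs _ mA) := I0.
move=> /(_ (measurable_int _ ecA))[N [mN N0 AN]].
apply: subset_measure0 mA mN _ N0; apply: subset_trans AN => w Aw /=.
move=> /(_ Aw)[/eqP]; rewrite subr_eq0 => /eqP h.
by move: Aw; rewrite /A /= h ltxx.
Qed.

(** The exponential estimates need steps bounded at every point, so the version is set to 0 where it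
    leaves the interval from [- c] to [c], a null event of [G]. *)
Lemma cond_exp_bounded (G : set (set Omega)) (Z : Omega -> R) (c : R) :
  sigma_algebra setT G -> G `<=` measurable ->
  measurable_fun setT Z -> (forall w, `|Z w| <= c) ->
  exists e : Omega -> R, [/\ measurable_wrt G e, forall w, `|e w| <= c &
    forall h, bounded_wrt G h -> \int[mu]_w (h w * (Z w - e w)) = 0].
Proof.
move=> sG Gm mZ Zc.
have c0 : 0 <= c by apply: le_trans (Zc point); exact: normr_ge0.
have bint (f : Omega -> R) (C : R) : measurable_fun setT f -> (forall w, `|f w| <= C) ->
    mu.-integrable setT (EFin \o f).
  move=> mf fC; apply: measurable_bounded_integrable => //.
    by rewrite -ge0_fin_numE//; exact: fin_num_measure.
  exists C; split; first exact: num_real.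
  by move=> x cx w _; exact: le_trans (fC w) (ltW cx).
have Zi := bint _ _ mZ Zc.
have [e [me ei eZ]] := cond_exp_exists sG Gm Zi.
have up0 : mu [set w | c < e w] = 0%E.
  apply: (cond_exp_le sG Gm Zi ei me eZ) => w; exact: le_trans (ler_norm _) (Zc w).
have mNe : measurable_wrt G (\- e).
  rewrite (_ : (\- e) = cst (-1) \* e); last by apply/funext => w /=; ring.
  by apply: measurable_wrtM => //; exact: measurable_wrt_cst.
have lo0 : mu [set w | c < - e w] = 0%E.
  have NZi : mu.-integrable setT (EFin \o (\- Z)).
    by apply: (bint (\- Z) c) => [|w]; [exact: measurable_funN|rewrite /= normrN].
  have Nei : mu.-integrable setT (EFin \o (\- e)).
    by rewrite (_ : EFin \o _ = -%E \o (EFin \o e)) //; exact: integrableN.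
  apply: (@cond_exp_le G (\- Z) (\- e) c sG Gm NZi Nei mNe).
  - move=> A GA; have mA := Gm _ GA.
    have NE (f : Omega -> R) : mu.-integrable setT (EFin \o f) ->
        (\int[mu]_(w in A) ((\- f) w)%:E = (-1)%:E * \int[mu]_(w in A) (f w)%:E)%E.
      move=> fi; rewrite -integralZl//; last exact: integrableS fi.
      by apply: eq_integral => w _; rewrite -EFinM mulN1r.
    by rewrite !NE// eZ.
  - by move=> w; apply: le_trans (ler_norm _) _; rewrite /= normrN.
pose B := [set w | - c <= e w] `&` [set w | e w <= c].
have GB : G B by apply: wrt_setI => //; [exact: wrt_preimage_ge|exact: wrt_preimage_le].
pose e' w := e w * \1_B w.
have e'c w : `|e' w| <= c.
  rewrite /e' indicE; case: (boolP (w \in B)); last by rewrite mulr0 normr0.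
  by rewrite inE => -[h1 h2]; rewrite mulr1 ler_norml; apply/andP.
have me' : measurable_wrt G e'.
  by apply: measurable_wrtM => //; exact: measurable_wrt_indic.
have mm (f : Omega -> R) : measurable_wrt G f -> measurable_fun setT f.
  by move=> mf _ C mC; rewrite setTI; exact/Gm/mf.
exists e'; split => // h bh.
apply: (@centered_bounded G (Z \- e') h (c + c)) => //.
- by apply: measurable_funB => //; exact: mm.
- by move=> w; apply: le_trans (ler_normB _ _) _; exact: lerD.
move=> A GA; have mA := Gm _ GA.
have e'i := bint _ _ (mm _ me') e'c.
rewrite RintegralB//; [|exact: integrableS Zi|exact: integrableS e'i].
rewrite /Rintegral -eZ//.
rewrite (@ae_eq_integral _ _ _ mu A (fun w => (e' w)%:E) (fun w => (e w)%:E)) ?subrr//.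
- by apply: measurable_funTS; exact: measurable_int ei.
- by apply: measurable_funTS; exact: measurable_int e'i.
have mup : measurable [set w | c < e w] by apply: Gm; exact: wrt_preimage_gt.
have mlo : measurable [set w | c < - e w] by apply: Gm; exact: (wrt_preimage_gt _ mNe).
exists ([set w | c < e w] `|` [set w | c < - e w]); split.
- exact: measurableU.
- by rewrite null_set_setU.
- move=> w /= ne; apply: contrapT => /not_orP[/negP + /negP].
  rewrite -!leNgt => h1 h2; apply: ne => _.
  by rewrite /e' indicE mem_set ?mulr1//; split => //=; rewrite lerNl.
Qed.

End conditional_expectation.

(** * Truncation of martingale differences *)

Section truncation.
Context (d : measure_display) (Omega : measurableType d) (R : realType).
Variable mu : probability Omega R.

Definition trunc_below (c : R) (X : Omega -> R) (w : Omega) : R :=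
  X w * \1_[set w | `|X w| <= c] w.

Definition trunc_above (c : R) (X : Omega -> R) (w : Omega) : R :=
  X w * \1_[set w | c < `|X w|] w.

Lemma trunc_belowE c X w : trunc_below c X w = if `|X w| <= c then X w else 0.
Proof.
rewrite /trunc_below indicE; case: ifPn => h.
  by rewrite mem_set ?mulr1.
by rewrite memNset ?mulr0//=; apply/negP.
Qed.

Lemma trunc_aboveE c X w : trunc_above c X w = if c < `|X w| then X w else 0.
Proof.
rewrite /trunc_above indicE; case: ifPn => h.
  by rewrite mem_set ?mulr1.
by rewrite memNset ?mulr0//=; apply/negP.
Qed.

Lemma trunc_belowD c X w : trunc_below c X w + trunc_above c X w = X w.
Proof. by rewrite trunc_belowE trunc_aboveE; case: leP; rewrite ?addr0 ?add0r. Qed.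

Lemma trunc_below_le c X w : 0 <= c -> `|trunc_below c X w| <= c.
Proof. by move=> c0; rewrite trunc_belowE; case: ifP => //; rewrite normr0. Qed.

Lemma trunc_above_le_norm c X w : `|trunc_above c X w| <= `|X w|.
Proof. by rewrite trunc_aboveE; case: ifP => //; rewrite normr0. Qed.

Lemma measurable_wrt_norm (G : set (set Omega)) (X : Omega -> R) :
  sigma_algebra setT G -> measurable_wrt G X -> measurable_wrt G (fun w => `|X w|).
Proof.
move=> sG /(measurable_wrtP _ sG) mX; apply/(measurable_wrtP _ sG).
exact: measurableT_comp.
Qed.

Lemma measurable_wrt_trunc_below G c X : sigma_algebra setT G ->
  measurable_wrt G X -> measurable_wrt G (trunc_below c X).
Proof.
move=> sG mX; apply: measurable_wrtM => //; apply: measurable_wrt_indic => //.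
exact: (wrt_preimage_le _ (measurable_wrt_norm sG mX)).
Qed.

Lemma measurable_wrt_trunc_above G c X : sigma_algebra setT G ->
  measurable_wrt G X -> measurable_wrt G (trunc_above c X).
Proof.
move=> sG mX; apply: measurable_wrtM => //; apply: measurable_wrt_indic => //.
exact: (wrt_preimage_gt _ (measurable_wrt_norm sG mX)).
Qed.

Lemma wrt_measurable_fun (G : set (set Omega)) (X : Omega -> R) :
  G `<=` measurable -> measurable_wrt G X -> measurable_fun setT X.
Proof. by move=> Gm mX _ B mB; rewrite setTI; exact/Gm/mX. Qed.

(* Testing e against its own sign, the centering of X moves the mass of the
   small part of X to its large part. *)
Lemma truncated_cond_exp (G : set (set Omega)) (X : Omega -> R) (c : R) :
  sigma_algebra setT G -> G `<=` measurable -> 0 <= c ->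
  mu.-integrable setT (EFin \o X) ->
  (forall A, G A -> \int[mu]_(w in A) X w = 0) ->
  exists e : Omega -> R, [/\ measurable_wrt G e, forall w, `|e w| <= c,
    forall h, bounded_wrt G h -> \int[mu]_w (h w * (trunc_below c X w - e w)) = 0 &
    \int[mu]_w `|e w| <= \int[mu]_w `|trunc_above c X w| ].
Proof.
move=> sG Gm c0 Xi XG.
have mX : measurable_fun setT X by apply/measurable_EFinP; exact: measurable_int Xi.
have sm : sigma_algebra setT (@measurable _ Omega).
  by split; [exact: measurable0|move=> A mA; rewrite setTD; exact: measurableC
            |exact: bigcupT_measurable].
have mXm : measurable_wrt measurable X.
  by move=> B mB; rewrite -[X in measurable X]setTI; exact: mX.
have mb : measurable_fun setT (trunc_below c X).
  by apply: (@wrt_measurable_fun measurable) => //; exact: measurable_wrt_trunc_below.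
have ma : measurable_fun setT (trunc_above c X).
  by apply: (@wrt_measurable_fun measurable) => //; exact: measurable_wrt_trunc_above.
have [e [me ec he]] := cond_exp_bounded mu sG Gm mb (fun w => trunc_below_le X w c0).
exists e; split => //.
pose A := [set w | 0 <= e w].
have GA : G A by exact: wrt_preimage_ge.
pose h w : R := 2 * \1_A w - 1.
have bh : bounded_wrt G h.
  by apply: bounded_wrtD => //; [apply: bounded_wrtZ => //; exact: bounded_wrt_indic
    |exact: (bounded_wrt_cst (-1))].
have h1 w : `|h w| <= 1.
  by rewrite /h indicE ler_norml; case: (w \in A); rewrite ?mulr1 ?mulr0; apply/andP; split; lra.
have hE w : h w * e w = `|e w|.
  rewrite /h indicE; case: (boolP (w \in A)).
    by rewrite inE /A /= => e0; rewrite ger0_norm//; ring.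
  rewrite notin_setE /A /= => /negP; rewrite -ltNge => e0.
  by rewrite ltr0_norm//; ring.
have bint (f : Omega -> R) (C : R) : measurable_fun setT f ->
    (forall w, `|f w| <= C) -> mu.-integrable setT (EFin \o f).
  move=> mf fC; apply: (@bounded_wrt_integrable _ _ _ mu measurable) => //.
  split; last by exists C.
  by move=> B mB; rewrite -[X in measurable X]setTI; exact: mf.
have mh := wrt_measurable_fun Gm bh.1.
have me' := wrt_measurable_fun Gm me.
have ai : mu.-integrable setT (EFin \o trunc_above c X).
  apply: le_integrable Xi => //; first exact/measurable_EFinP.
  by move=> w _; rewrite lee_fin; exact: trunc_above_le_norm.
have hai : mu.-integrable setT (EFin \o (fun w => h w * trunc_above c X w)).
  apply: le_integrable ai => //.
    by apply/measurable_EFinP; exact: measurable_funM.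
  by move=> w _; rewrite lee_fin normrM ler_piMl.
have hbi : mu.-integrable setT (EFin \o (fun w => h w * trunc_below c X w)).
  apply: (bint _ c); first exact: measurable_funM.
  move=> w; rewrite normrM -[leRHS]mul1r; apply: ler_pM => //.
  exact: trunc_below_le.
have hei : mu.-integrable setT (EFin \o (fun w => h w * e w)).
  apply: (bint _ c); first exact: measurable_funM.
  by move=> w; rewrite normrM -[leRHS]mul1r; apply: ler_pM.
have hX : \int[mu]_w (h w * X w) = 0.
  rewrite (_ : (fun w => _) = (fun w => 2 * (\1_A w * X w)) \- X); last first.
    by apply/funext => w; rewrite /h /=; ring.
  have i1 : mu.-integrable setT (EFin \o (fun w => \1_A w * X w)).
    apply: le_integrable Xi => //.
      apply/measurable_EFinP; apply: measurable_funM => //.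
      exact: measurable_indic (Gm _ GA).
    move=> w _; rewrite lee_fin normrM indicE.
    by case: (w \in A); rewrite ?normr1 ?mul1r// normr0 mul0r.
  have i2 : mu.-integrable setT (EFin \o (fun w => 2 * (\1_A w * X w))).
    exact: (integrableZl measurableT 2 i1).
  rewrite RintegralB// RintegralZl// Rintegral_indic_mul XG// XG ?mulr0 ?subrr//.
  exact: wrt_setT.
have heb : \int[mu]_w (h w * e w) = \int[mu]_w (h w * trunc_below c X w).
  have := he h bh; under eq_Rintegral do rewrite mulrBr.
  by rewrite RintegralB// => /eqP; rewrite subr_eq0 => /eqP.
have hba : \int[mu]_w (h w * trunc_below c X w) = - \int[mu]_w (h w * trunc_above c X w).
  apply/eqP; rewrite -addr_eq0 -RintegralD//; apply/eqP.
  by rewrite -[RHS]hX; apply: eq_Rintegral => w _ /=; rewrite -mulrDr trunc_belowD.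
under eq_Rintegral do rewrite -hE.
rewrite heb hba; apply: le_trans (ler_norm _) _; rewrite normrN.
apply: le_trans (le_normr_Rintegral _ hai) _ => //.
apply: le_Rintegral => //; [exact: integrable_norm|exact: integrable_norm|].
by move=> w _; rewrite normrM ler_piMl.
Qed.

(** The past of [X j] is [F j.-1], which gets index [j] in the new filtration. At [j = 0] there is
    no earlier past to center with, so [e 0] is the truncated variable itself and the first step
    becomes 0; this is why the mean bound starts at [j = 1]. *)
Lemma truncated_mds (X : nat -> Omega -> R) (c : nat -> R) :
  martingale_differences mu X -> (forall j, 0 <= c j) ->
  exists G e, [/\ bounded_mds mu G (fun j w => trunc_below (c j) (X j) w - e j w),
    forall j, measurable_fun setT (e j), forall j w, `|e j w| <= c j &
    forall j, (0 < j)%N ->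
      \int[mu]_w `|e j w| <= \int[mu]_w `|trunc_above (c j) (X j) w| ].
Proof.
move=> [F [Ff Xi XF XC]] c0; case: (Ff) => sF monoF.
have /choice[e he] : forall j, exists e : Omega -> R,
    [/\ measurable_wrt (F j.-1) e \/ j = 0%N, measurable_wrt (F j) e, forall w, `|e w| <= c j,
    forall h, bounded_wrt (F j.-1) h -> \int[mu]_w (h w * (trunc_below (c j) (X j) w - e w)) = 0 &
    (0 < j)%N -> \int[mu]_w `|e w| <= \int[mu]_w `|trunc_above (c j) (X j) w| ].
  case=> [|j].
    exists (trunc_below (c 0%N) (X 0%N)); split => //.
    - by right.
    - by apply: measurable_wrt_trunc_below => //; case: (sF 0%N).
    - by move=> w; exact: trunc_below_le.
    - move=> h _; under eq_Rintegral do rewrite subrr mulr0.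
      by rewrite Rintegral_cst// mul0r.
  have [sG Gm] := sF j.
  have XG A : F j A -> \int[mu]_(w in A) X j.+1 w = 0.
    move=> FA; have [_ _ /(_ A FA)] := XC j.
    by rewrite integral0 /Rintegral => <-.
  have [e [me ec eh eL]] := truncated_cond_exp sG Gm (c0 j.+1) (Xi j.+1) XG.
  exists e; split => //; first by left.
  by apply: sub_measurable_wrt me; exact: monoF.
exists (fun j => F j.-1), e; split.
- split.
  + split=> [i|i j ij]; first exact: sF.
    by apply: monoF; lia.
  + move=> j /=; have [_ mej ec _ _] := he j; have [sFj _] := sF j.
    split.
      rewrite (_ : (fun w => _) = trunc_below (c j) (X j) \+ (cst (-1) \* e j)).
        apply: measurable_wrtD => //; first exact: measurable_wrt_trunc_below.
        by apply: measurable_wrtM => //; exact: measurable_wrt_cst.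
      by apply/funext => w /=; ring.
    exists (c j + c j) => w; apply: le_trans (ler_normB _ _) _.
    by apply: lerD => //; exact: trunc_below_le.
  + by move=> j h bh; have [_ _ _ + _] := he j; exact.
- move=> j; have [_ mej _ _ _] := he j; have [_ Fm] := sF j.
  exact: wrt_measurable_fun mej.
- by move=> j w; have [_ _ + _ _] := he j; exact.
- by move=> j j0; have [_ _ _ _] := he j; exact.
Qed.

End truncation.

(** * The critical truncation level and Kronecker's lemma *)

Section truncation_level.
Context (R : realType).

(* [level n] is the critical truncation level, of order sqrt (n / ln (ln n)),
   and [weight n] is of the order sqrt (n * ln (ln n)) of the law of the
   iterated logarithm; both are meant to be monotone from n = 0 on. *)
Definition loglog (n : nat) : R := 2 + ln (1 + ln (1 + n%:R)).
Definition level (n : nat) : R := Num.sqrt (n%:R / loglog n).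
Definition weight (n : nat) : R := Num.sqrt (n%:R * loglog n).

Let lnSn_ge0 (n : nat) : 0 <= ln (1 + n%:R) :> R.
Proof. by rewrite ln_ge0// lerDl. Qed.

Lemma loglog_ge2 n : 2 <= loglog n.
Proof. by rewrite /loglog lerDl ln_ge0// lerDl. Qed.

Let loglog_gt0 n : 0 < loglog n.
Proof. by apply: lt_le_trans (loglog_ge2 n). Qed.

Lemma ln_sub_le (a b : R) : 0 <= a -> a <= b -> ln (1 + b) - ln (1 + a) <= (b - a) / (1 + a).
Proof.
move=> a0 ab; have a1 : 0 < 1 + a by lra.
have b1 : 0 < 1 + b by lra.
rewrite -ln_div ?posrE//.
have -> : (1 + b) / (1 + a) = 1 + (b - a) / (1 + a) by field; lra.
apply: le_ln1Dx; apply: (@lt_le_trans _ _ 0); first by lra.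
by rewrite divr_ge0 ?subr_ge0// ltW.
Qed.

Lemma loglogS n : loglog n <= loglog n.+1 <= loglog n + (1 + n%:R)^-1.
Proof.
have n0 : 0 <= n%:R :> R by [].
have h : ln (1 + n%:R) <= ln (1 + n.+1%:R) :> R.
  by rewrite ler_ln ?posrE ?ltr_pwDl// lerD2l ler_nat.
have h1 := ln_sub_le (lnSn_ge0 n) h.
have nS : n%:R <= n.+1%:R :> R by rewrite ler_nat.
have h2 := ln_sub_le n0 nS.
apply/andP; split.
  rewrite /loglog lerD2l ler_ln ?posrE ?ltr_pwDl//.
  by rewrite lerD2l.
suff h3 : ln (1 + ln (1 + n.+1%:R)) - ln (1 + ln (1 + n%:R)) <= (1 + n%:R)^-1 :> R.
  rewrite /loglog; move: (1 + n%:R)^-1 h3 => x; lra.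
apply: (le_trans h1).
rewrite ler_pdivrMr ?ltr_pwDl//; apply: (le_trans h2).
rewrite -natr1 addrAC subrr add0r mul1r ler_peMr ?invr_ge0 ?addr_ge0//.
by rewrite lerDl.
Qed.

Lemma le_loglog : {homo loglog : m n / (m <= n)%N >-> m <= n}.
Proof. by apply: homo_leq => // [x y z|n]; [exact: le_trans|case/andP: (loglogS n)]. Qed.

Lemma level_weight n : level n * weight n = n%:R.
Proof.
rewrite /level /weight -sqrtrM ?divr_ge0 ?(ltW (loglog_gt0 _))//.
have -> : n%:R / loglog n * (n%:R * loglog n) = n%:R ^+ 2.
  by field; rewrite gt_eqF.
by rewrite sqrtr_sqr ger0_norm.
Qed.

Lemma level_ge0 n : 0 <= level n. Proof. exact: sqrtr_ge0. Qed.
Lemma weight_ge0 n : 0 <= weight n. Proof. exact: sqrtr_ge0. Qed.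

Lemma weight_gt0 n : (0 < n)%N -> 0 < weight n.
Proof. by move=> n0; rewrite sqrtr_gt0 mulr_gt0// ltr0n. Qed.

Lemma weightE n : weight n = level n * loglog n.
Proof.
have L0 := ltW (loglog_gt0 n).
rewrite -[X in _ * X](ger0_norm L0) -sqrtr_sqr -sqrtrM ?divr_ge0//.
by congr Num.sqrt; field; rewrite gt_eqF.
Qed.

Lemma le_weight : {homo weight : m n / (m <= n)%N >-> m <= n}.
Proof.
move=> m n mn; apply: ler_wsqrtr; apply: ler_pM => //; first exact: ltW.
  by rewrite ler_nat.
exact: le_loglog.
Qed.

(** A discrete derivative: [level ^+ 2] grows by about [1 / loglog], so [level] grows by about
    [1 / (2 weight)]. Half of this is given up for the slow growth of [loglog]. *)
Lemma level_incr n : (4 * weight n.+1)^-1 <= level n.+1 - level n.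
Proof.
have [L2 L2'] := (loglog_ge2 n, loglog_ge2 n.+1).
have L0 := loglog_gt0 n; have L0' := loglog_gt0 n.+1.
have sq k : level k ^+ 2 = k%:R / loglog k.
  by rewrite sqr_sqrtr// divr_ge0// ltW.
have key : (2 * loglog n.+1)^-1 <= level n.+1 ^+ 2 - level n ^+ 2.
  rewrite !sq -subr_ge0.
  have -> : n.+1%:R / loglog n.+1 - n%:R / loglog n - (2 * loglog n.+1)^-1 =
     ((n%:R + 2^-1) * loglog n - n%:R * loglog n.+1) / (loglog n * loglog n.+1).
    by rewrite -natr1; field; rewrite !gt_eqF.
  apply: divr_ge0; last by rewrite mulr_ge0 ?ltW.
  have /andP[_ h] := loglogS n.
  have h1 : n%:R * loglog n.+1 <= n%:R * (loglog n + (1 + n%:R)^-1).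
    by rewrite ler_wpM2l.
  have h2 : n%:R * (1 + n%:R)^-1 <= 1 :> R.
    by rewrite ler_pdivrMr ?ltr_pwDl// mul1r lerDr.
  lra.
have l0 := level_ge0 n; have l0' := level_ge0 n.+1.
have key0 : 0 < (2 * loglog n.+1)^-1 by rewrite invr_gt0 mulr_gt0.
have mono : level n <= level n.+1.
  rewrite -(@ler_pXn2r _ 2) ?nnegrE//; lra.
have lp : 0 < level n.+1.
  rewrite lt_neqAle l0' andbT; apply/eqP => E; move: key mono.
  rewrite -E => key mono; nra.
rewrite weightE.
have -> : (4 * (level n.+1 * loglog n.+1))^-1 =
    (2 * loglog n.+1)^-1 / (2 * level n.+1).
  by field; rewrite !gt_eqF.
rewrite ler_pdivrMr ?mulr_gt0//; apply: (le_trans key); nra.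
Qed.

Lemma le_level : {homo level : m n / (m <= n)%N >-> m <= n}.
Proof.
apply: homo_leq => // [x y z|n]; first exact: le_trans.
rewrite -subr_ge0; apply: le_trans (level_incr n).
by rewrite invr_ge0 mulr_ge0 ?weight_ge0.
Qed.

(** The terms telescope through [level_incr], and the sum stops when [level] passes [x / dl]. Taken
    at [x = |m|] and multiplied by [|m|], this bounds the weighted sum of the large parts by a
    multiple of [m ^+ 2]. *)
Lemma sum_inv_weight (x dl : R) (N : nat) : 0 < dl -> 0 <= x ->
  \sum_(j < N) (dl * level j.+1 < x)%R%:R / weight j.+1 <= 4 * x / dl.
Proof.
move=> dl0 x0.
suff : \sum_(j < N) (dl * level j.+1 < x)%R%:R / weight j.+1 <=
    4 * Num.min (level N) (x / dl).
  by move/le_trans; apply; rewrite -mulrA ler_wpM2l// ge_min lexx orbT.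
elim: N => [|N IH].
  by rewrite big_ord0 mulr_ge0// le_min level_ge0 divr_ge0// ltW.
rewrite big_ord_recr /=; have [h|h] := ltP (dl * level N.+1) x.
  have h' : level N.+1 <= x / dl by rewrite ler_pdivlMr// mulrC ltW.
  rewrite min_l// mul1r.
  have h1 : \sum_(j < N) (dl * level j.+1 < x)%R%:R / weight j.+1 <= 4 * level N.
    by apply: le_trans IH _; rewrite ler_wpM2l// ge_min lexx.
  have h2 := level_incr N; rewrite invfM in h2.
  have h3 : (weight N.+1)^-1 <= 4 * (level N.+1 - level N) by lra.
  lra.
rewrite mul0r addr0; apply: le_trans IH _; rewrite ler_wpM2l//.
by rewrite le_min !ge_min (le_level (leqnSn N)) lexx orbT.
Qed.

Lemma near_level_ge (K : R) : \forall n \near \oo, K <= level n.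
Proof.
near=> n.
have n1 : 1 <= n%:R :> R by near: n; exact: nbhs_infty_ger.
have nK : (4 * K ^+ 2) ^+ 2 <= n%:R by near: n; exact: nbhs_infty_ger.
pose s : R := Num.sqrt n%:R.
have s1 : 1 <= s by rewrite -[1]sqrtr1; exact: ler_wsqrtr.
have s2 : s ^+ 2 = n%:R by rewrite sqr_sqrtr.
have sK : 4 * K ^+ 2 <= s.
  have K0 : 0 <= 4 * K ^+ 2 by rewrite mulr_ge0 ?sqr_ge0.
  have s0 : 0 <= s by exact: sqrtr_ge0.
  by rewrite -(@ler_pXn2r _ 2) ?nnegrE// s2.
have LU : loglog n <= 4 * s.
  have h1 : ln (1 + ln (1 + n%:R)) <= ln (1 + n%:R) :> R.
    by apply: le_ln1Dx; apply: lt_le_trans (lnSn_ge0 n); rewrite ltrN10.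
  have h2 : ln (1 + n%:R) <= 2 * s - 2 + 2 :> R.
    have -> : 1 + n%:R = 1 + s ^+ 2 by rewrite s2.
    apply: (@le_trans _ _ (ln ((1 + s) ^+ 2))).
      by rewrite ler_ln ?posrE ?exprn_gt0 ?ltr_pwDl ?sqr_ge0//; nra.
    rewrite lnXn; last by lra.
    have : ln (1 + s) <= s by apply: le_ln1Dx; lra.
    by rewrite mulr2n; lra.
  rewrite /loglog; lra.
apply: (@le_trans _ _ `|K|); first exact: ler_norm.
rewrite -sqrtr_sqr; apply: ler_wsqrtr.
rewrite ler_pdivlMr//.
have h := ler_wpM2l (sqr_ge0 K) LU.
rewrite -s2; nra.
Unshelve. all: by end_near. Qed.

Lemma near_weight_le : \forall n \near \oo,
  weight n <= 2 * Num.sqrt (n%:R * ln (ln n%:R)).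
Proof.
near=> n.
have n2 : 2 <= n%:R :> R by near: n; exact: nbhs_infty_ger.
have l1 : 1 <= ln n%:R :> R by near: n; exact: near_nat_ln_ge.
have ll : 2 <= ln (ln n%:R) :> R by near: n; exact: near_nat_lnln_ge.
have h1 : ln (1 + n%:R) <= 2 * ln n%:R :> R.
  apply: (@le_trans _ _ (ln (n%:R ^+ 2))).
    by rewrite ler_ln ?posrE ?exprn_gt0//; nra.
  by rewrite lnXn; [rewrite mulr2n; lra|lra].
have h2 : ln (1 + ln (1 + n%:R)) <= 2 + ln (ln n%:R) :> R.
  have e2 : 3 <= expR 2 :> R by have := @expR_ge1Dx R 2; lra.
  have e0 := expR_gt0 (2 : R).
  apply: (@le_trans _ _ (ln (expR 2 * ln n%:R))).
    rewrite ler_ln ?posrE ?ltr_pwDl//; first by nra.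
    by rewrite mulr_gt0//; lra.
  by rewrite lnM ?posrE ?expRK//; lra.
rewrite -[2 in leRHS]ger0_norm// -sqrtr_sqr -sqrtrM ?sqr_ge0//.
apply: ler_wsqrtr.
rewrite (_ : 2 ^+ 2 * _ = n%:R * (4 * ln (ln n%:R))); last by ring.
by rewrite ler_wpM2l// /loglog; lra.
Unshelve. all: by end_near. Qed.

(** [ln k] is at most twice [loglog] at [theta ^+ k], the constant [ln (ln theta)] being absorbed
    for large [k]; this puts the truncation level in the form of [small_steps]. *)
Lemma near_level_le (theta : R) : 1 < theta -> \forall k \near \oo, forall j : nat,
  j%:R <= theta ^+ k -> level j <= 2 * Num.sqrt (theta ^+ k / ln k%:R).
Proof.
move=> th1; have th0 : 0 < theta by lra.
have lth : 0 < ln theta by rewrite ln_gt0.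
near=> k; move=> j jk.
have lk1 : 1 <= ln k%:R :> R by near: k; exact: near_nat_ln_ge.
have lk2 : - 2 * ln (ln theta) <= ln k%:R by near: k; exact: near_nat_ln_ge.
have k0 : (0 < k)%N by near: k; exact: nbhs_infty_gt.
have u0 : 0 < theta ^+ k by rewrite exprn_gt0.
pose N := Num.truncn (theta ^+ k).
have jN : (j <= N)%N by rewrite truncn_ge_nat ?(ltW u0).
apply: le_trans (le_level jN) _.
have Nu : N%:R <= theta ^+ k by rewrite truncn_le ltW.
have uN : theta ^+ k < 1 + N%:R by rewrite addrC natr1 truncnS_gt.
have h1 : k%:R * ln theta <= ln (1 + N%:R).
  rewrite mulr_natl -lnXn// ler_ln ?posrE ?(lt_trans u0 uN)//; exact: ltW.
have k0' : 0 < k%:R :> R by rewrite ltr0n.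
have h2 : ln k%:R + ln (ln theta) <= ln (1 + ln (1 + N%:R)).
  rewrite -lnM ?posrE//.
  by rewrite ler_ln ?posrE ?mulr_gt0 ?ltr_pwDl//; lra.
have h3 : ln k%:R <= 2 * loglog N by rewrite /loglog; lra.
rewrite -[2 in leRHS]ger0_norm// -sqrtr_sqr -sqrtrM ?sqr_ge0//.
apply: ler_wsqrtr; rewrite ler_pdivrMr//.
have lk0 : 0 < ln k%:R :> R by lra.
rewrite (_ : 2 ^+ 2 * _ * _ = theta ^+ k * (4 * loglog N / ln k%:R)); last by ring.
apply: (le_trans Nu); rewrite ler_peMr ?(ltW u0)// ler_pdivlMr//.
have := loglog_gt0 N; lra.
Unshelve. all: by end_near. Qed.

(** Kronecker's lemma: beyond [N] the series contributes at most [e / 2], which the monotonicity of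
    [weight] turns into a bound on the unweighted sum; the first terms are absorbed since [weight]
    tends to infinity. The series starts at index 1 because [weight 0 = 0]. *)
Lemma kronecker_weight (r : nat -> R) (M : R) : (forall j, 0 <= r j) ->
  (forall n, \sum_(j < n) r j.+1 / weight j.+1 <= M) ->
  forall e, 0 < e -> \forall n \near \oo, \sum_(j < n) r j <= e * weight n.
Proof.
move=> r0 rM e e0.
pose s n := \sum_(j < n) r j.+1 / weight j.+1.
have term0 j : 0 <= r j.+1 / weight j.+1 by rewrite divr_ge0 ?weight_ge0.
have smono : {homo s : m n / (m <= n)%N >-> m <= n}.
  apply: homo_leq => // [x y z|n]; first exact: le_trans.
  by rewrite /s big_ord_recr /= lerDl.
have e2 : 0 < e / 2 by lra.
have [N hN] : exists N, forall n, s n <= s N + e / 2.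
  have hs : has_sup (range s).
    split; first by exists (s 0%N); exists 0%N.
    by exists M => _ [n _ <-]; exact: rM.
  have [_ [N _ <-] hN] := sup_adherent e2 hs.
  exists N => n; have : s n <= sup (range s) by apply: ub_le_sup; [case: hs|exists n].
  lra.
pose C := \sum_(j < N.+1) r j.
have bound n : (N <= n)%N -> \sum_(j < n.+1) r j <= C + (s n - s N) * weight n.
  elim: n => [|n IH] Nn.
    have -> : N = 0%N by lia.
    by rewrite subrr mul0r addr0 /C (_ : N = 0%N)//; lia.
  move: Nn; rewrite leq_eqVlt => /predU1P[<-|Nn]; first by rewrite subrr mul0r addr0.
  rewrite big_ord_recr /=; have {}IH := IH Nn.
  have w0 := weight_gt0 (ltn0Sn n).
  have h1 : (s n - s N) * weight n <= (s n - s N) * weight n.+1.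
    by rewrite ler_wpM2l ?subr_ge0 ?smono//; exact: le_weight.
  have h2 : (s n.+1 - s N) * weight n.+1 = (s n - s N) * weight n.+1 + r n.+1.
    rewrite /s big_ord_recr /=; field; rewrite gt_eqF//.
  rewrite h2; lra.
have near_w : \forall n \near \oo, C <= e / 2 * weight n.
  have c := near_level_ge (2 / e * C); near=> n.
  have h : 2 / e * C <= level n by near: n.
  have wl : level n <= weight n.
    by rewrite weightE ler_peMr ?level_ge0//; have := loglog_ge2 n; lra.
  rewrite -ler_pdivrMl// invf_div; exact: le_trans wl.
near=> n.
have Nn : (N <= n)%N by near: n; exact: nbhs_infty_ge.
have hb := bound n Nn.
have hC : C <= e / 2 * weight n by near: n.
have hs : (s n - s N) * weight n <= e / 2 * weight n.
  by rewrite ler_wpM2r ?weight_ge0//; have := hN n; lra.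
apply: (@le_trans _ _ (\sum_(j < n.+1) r j)); last by lra.
by rewrite big_ord_recr /= lerDl.
Unshelve. all: by end_near. Qed.

End truncation_level.

(** * Quadratic variation of the truncated differences *)

Section truncated_variance.
Context (R : realType).

(** A deterministic statement along one orbit. As the levels tend to infinity, [z j ^+ 2] eventually
    lies between the square of [x j] clipped at a fixed [K] and [x j ^+ 2], whose averages tend to
    [s K] and [s2]. The centering changes the sum by at most [3 * dl * level n] times the sum of the
    [|e j|]; the latter is negligible against [weight n], and [level n * weight n = n]. *)
Lemma truncated_variance (x z e : nat -> R) (s : nat -> R) (dl s2 : R) : 0 < dl ->
  (forall j, z j = if `|x j| <= dl * level R j then x j else 0) ->
  (forall j, `|e j| <= dl * level R j) ->
  (forall c, 0 < c -> \forall n \near \oo, \sum_(j < n) `|e j| <= c * weight R n) ->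
  ((\sum_(j < n) x j ^+ 2) / n%:R @[n --> \oo] --> s2) ->
  (forall K : nat, (\sum_(j < n) (if `|x j| <= K%:R then x j else 0) ^+ 2) / n%:R
    @[n --> \oo] --> s K) ->
  (s n @[n --> \oo] --> s2) ->
  (\sum_(j < n) (z j - e j) ^+ 2) / n%:R @[n --> \oo] --> s2.
Proof.
move=> dl0 zE ec eW x2 xK sK.
have lz j : `|z j| <= dl * level R j.
  by rewrite zE; case: ifP => // _; rewrite normr0 mulr_ge0 ?level_ge0// ltW.
apply/cvgrPdist_le => eps eps0.
pose c := eps / (12 * dl).
have c0 : 0 < c by rewrite divr_gt0// mulr_gt0.
have eps4 : 0 < eps / 4 by lra.
have [K hK] : exists K : nat, s2 - eps / 4 <= s K.
  move/cvgrPdist_le : sK => /(_ _ eps4)[K _ hK]; exists K.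
  by have := hK K (leqnn K); rewrite /= ler_distl => /andP[]; lra.
have [J _ hJ] := near_level_ge (K%:R / dl).
have zK j : (J <= j)%N -> (if `|x j| <= K%:R then x j else 0) ^+ 2 <= z j ^+ 2.
  move=> Jj; rewrite zE; case: ifP => [h|_]; last by rewrite expr0n /= sqr_ge0.
  by rewrite ifT// (le_trans h)// mulrC -ler_pdivrMr//; exact: hJ.
near=> n.
have n0 : 0 < n%:R :> R by rewrite ltr0n; near: n; exact: nbhs_infty_gt.
pose Sx := \sum_(j < n) x j ^+ 2; pose Sz := \sum_(j < n) z j ^+ 2.
pose SK := \sum_(j < n) (if `|x j| <= K%:R then x j else 0) ^+ 2.
pose Y := \sum_(j < n) (z j - e j) ^+ 2.
have hx : Sx <= (s2 + eps / 4) * n%:R.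
  rewrite /Sx -ler_pdivrMr//; near: n.
  move/cvgrPdist_le : x2 => /(_ _ eps4); apply: filterS => n.
  by rewrite ler_distl => /andP[]; lra.
have hSK : (s K - eps / 4) * n%:R <= SK.
  rewrite /SK -ler_pdivlMr//; near: n.
  move/cvgrPdist_le : (xK K) => /(_ _ eps4); apply: filterS => n.
  by rewrite ler_distl => /andP[]; lra.
have hJK : J%:R * K%:R ^+ 2 <= eps / 4 * n%:R.
  by rewrite -ler_pdivrMl//; near: n; exact: nbhs_infty_ger.
have zx : Sz <= Sx.
  apply: ler_sum => j _; rewrite zE; case: ifP => // _.
  by rewrite expr0n /= sqr_ge0.
have Kz : SK <= Sz + J%:R * K%:R ^+ 2.
  have -> : J%:R * K%:R ^+ 2 = \sum_(j < J) K%:R ^+ 2 :> R.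
    by rewrite sumr_const card_ord mulr_natl.
  have Jn : (J <= n)%N by near: n; exact: nbhs_infty_ge.
  rewrite /SK /Sz -(subnKC Jn) !big_split_ord /= [X in _ <= X]addrAC.
  apply: lerD; last by apply: ler_sum => j _; exact: (zK (J + j)%N (leq_addr _ _)).
  rewrite -big_split /=; apply: ler_sum => j _.
  case: ifP => [h|_].
    rewrite -[leLHS]add0r; apply: lerD; first exact: sqr_ge0.
    by rewrite -[x _ ^+ 2]real_normK ?num_real// lerXn2r ?nnegrE.
  by rewrite expr0n /= addr_ge0 ?sqr_ge0.
have hY : `|Y - Sz| <= eps / 4 * n%:R.
  rewrite /Y /Sz -sumrB; apply: le_trans (ler_norm_sum _ _ _) _.
  apply: (@le_trans _ _ (\sum_(j < n) 3 * (dl * level R n) * `|e j|)).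
    apply: ler_sum => j _.
    rewrite (_ : _ - _ = - e j * (2 * z j - e j)); last by ring.
    rewrite normrM normrN mulrC; apply: ler_wpM2r => //.
    apply: le_trans (ler_normB _ _) _; rewrite normrM ger0_norm//.
    have lj : dl * level R j <= dl * level R n.
      by rewrite ler_pM2l// le_level// ltnW.
    have h1 := le_trans (lz j) lj; have h2 := le_trans (ec j) lj.
    clear -h1 h2; lra.
  rewrite -mulr_sumr.
  have hW : \sum_(j < n) `|e j| <= c * weight R n by near: n; exact: eW.
  have l0 : 0 <= 3 * (dl * level R n) by rewrite !mulr_ge0 ?level_ge0 ?ltW.
  apply: le_trans (ler_wpM2l l0 hW) _.
  rewrite [leLHS](_ : _ = 3 * dl * c * (level R n * weight R n)); last by ring.
  rewrite level_weight /c (_ : 3 * dl * (eps / (12 * dl)) = eps / 4)//.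
  by field; rewrite gt_eqF.
rewrite ler_distlC -/Y; move: hY; rewrite ler_distl => /andP[hY1 hY2].
have hKn := ler_wpM2r (ltW n0) hK.
apply/andP; split; [rewrite ler_pdivlMr//|rewrite ler_pdivrMr//];
  clear -hx hSK hJK zx Kz hY1 hY2 hKn; lra.
Unshelve. all: by end_near. Qed.

End truncated_variance.

(** * Summability of the truncation errors *)

Section stationary.
Context (d : measure_display) (Omega : measurableType d) (R : realType).
Variables (mu : probability Omega R) (T : Omega -> Omega).
Hypothesis mT : measurable_fun setT T.
Hypothesis T_mp : measure_preserving mu T.
Hypothesis T_erg : ergodic mu T.

Lemma integrable_iter (f : Omega -> R) j : mu.-integrable setT (EFin \o f) ->
  mu.-integrable setT (EFin \o (fun w => f (iter j T w))).
Proof.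
move=> fi; elim: j => [//|j IH].
rewrite (_ : (fun w => _) = (fun w => f (iter j T w)) \o T).
  exact: integrable_mp.
by apply/funext => w /=; rewrite -iterSr.
Qed.

Lemma Rintegral_iter (f : Omega -> R) j : mu.-integrable setT (EFin \o f) ->
  \int[mu]_w f (iter j T w) = \int[mu]_w f w.
Proof.
move=> fi; elim: j => [//|j IH]; rewrite -IH /Rintegral; congr fine.
rewrite -(integral_mp mT T_mp measurableT (integrable_iter j fi)) preimage_setT.
by apply: eq_integral => w _; rewrite iterSr.
Qed.

Lemma trunc_above_iter c (m : Omega -> R) j w :
  trunc_above c (m \o iter j T) w = trunc_above c m (iter j T w).
Proof. by rewrite !trunc_aboveE. Qed.

Variable m : Omega -> R.
Hypothesis mm : measurable_fun setT m.
Hypothesis m2i : mu.-integrable setT (EFin \o (fun w => m w ^+ 2)).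

Lemma integrable_of_sqr : mu.-integrable setT (EFin \o m).
Proof.
have i1 : mu.-integrable setT (EFin \o (fun w => 1 + m w ^+ 2)).
  rewrite (_ : EFin \o _ = (EFin \o cst 1%R) \+ (EFin \o (fun w => m w ^+ 2)%R))%E//.
  by apply: integrableD => //; exact: finite_measure_integrable_cst.
apply: le_integrable i1 => //; first exact/measurable_EFinP.
move=> w _ /=; rewrite lee_fin [leRHS]ger0_norm; last by rewrite addr_ge0// sqr_ge0.
rewrite -(real_normK (num_real (m w))); have := sqr_ge0 (`|m w| - 2^-1); nra.
Qed.

Lemma measurable_trunc_above c : measurable_fun setT (trunc_above c m).
Proof.
apply: (@wrt_measurable_fun _ _ _ measurable) => //.
apply: measurable_wrt_trunc_above.
  by split; [exact: measurable0|move=> A mA; rewrite setTD; exact: measurableC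
            |exact: bigcupT_measurable].
by move=> B mB; rewrite -[X in measurable X]setTI; exact: mm.
Qed.

Lemma integrable_trunc_above c : mu.-integrable setT (EFin \o trunc_above c m).
Proof.
apply: le_integrable integrable_of_sqr => //.
  by apply/measurable_EFinP; exact: measurable_trunc_above.
by move=> w _; rewrite lee_fin; exact: trunc_above_le_norm.
Qed.

Lemma sum_trunc_above (dl : R) (N : nat) : 0 < dl ->
  \sum_(j < N) (\int[mu]_w `|trunc_above (dl * level R j.+1) m w|) / weight R j.+1
  <= 4 / dl * \int[mu]_w (m w ^+ 2).
Proof.
move=> dl0.
have i1 c : mu.-integrable setT (EFin \o (fun w => `|trunc_above c m w|)).
  by apply: integrable_norm; exact: integrable_trunc_above.
have i2 j : mu.-integrable setT (EFin \o
    (fun w => `|trunc_above (dl * level R j.+1) m w| / weight R j.+1)).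
  exact: (integrableZr measurableT _ (i1 _)).
have i3 n : mu.-integrable setT (EFin \o
    (fun w => \sum_(j < n) `|trunc_above (dl * level R j.+1) m w| / weight R j.+1)).
  rewrite (_ : EFin \o _ = fun w =>
    (\sum_(j < n) (`|trunc_above (dl * level R j.+1) m w| / weight R j.+1)%:E)%E).
    by apply: integrable_sum => //= j _; exact: i2.
  by apply/funext => w; rewrite /= sumEFin.
have -> : \sum_(j < N) (\int[mu]_w `|trunc_above (dl * level R j.+1) m w|) / weight R j.+1
    = \int[mu]_w (\sum_(j < N) `|trunc_above (dl * level R j.+1) m w| / weight R j.+1).
  elim: N => [|n IH].
    under eq_Rintegral do rewrite big_ord0.
    by rewrite big_ord0 Rintegral_cst// mul0r.
  rewrite big_ord_recr /= IH -RintegralZr// -RintegralD//.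
  by apply: eq_Rintegral => w _; rewrite big_ord_recr.
rewrite -RintegralZl//; apply: le_Rintegral => //.
  exact: (integrableZl measurableT _ m2i).
move=> w _.
have h := sum_inv_weight N dl0 (normr_ge0 (m w)).
apply: (@le_trans _ _ (`|m w| * (4 * `|m w| / dl))); last first.
  by rewrite -(real_normK (num_real (m w))) [leLHS](_ : _ = 4 / dl * `|m w| ^+ 2)//; ring.
apply: le_trans (ler_wpM2l (normr_ge0 _) h).
rewrite mulr_sumr; apply: ler_sum => j _.
rewrite trunc_aboveE; case: ifP => _; first by rewrite mul1r.
by rewrite normr0 !mul0r mulr0.
Qed.

(** By stationarity of the large parts, the series has expectation at most twice the bound of
    [sum_trunc_above]; a nonnegative series with finite expectation converges almost surely. *)
Lemma ae_sum_bounded (dl : R) (e : nat -> Omega -> R) : 0 < dl ->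
  (forall j, mu.-integrable setT (EFin \o e j)) ->
  (forall j, (0 < j)%N -> \int[mu]_w `|e j w| <=
     \int[mu]_w `|trunc_above (dl * level R j) (m \o iter j T) w|) ->
  {ae mu, forall w, exists M, forall n,
    \sum_(j < n) (`|trunc_above (dl * level R j.+1) (m \o iter j.+1 T) w| + `|e j.+1 w|)
      / weight R j.+1 <= M}.
Proof.
move=> dl0 ei eL.
pose f j w := (`|trunc_above (dl * level R j.+1) (m \o iter j.+1 T) w| + `|e j.+1 w|)
      / weight R j.+1.
have f0 j w : 0 <= f j w by rewrite divr_ge0 ?weight_ge0// addr_ge0.
have ia j : mu.-integrable setT (EFin \o
    (fun w => `|trunc_above (dl * level R j) (m \o iter j T) w|)).
  rewrite (_ : (fun w => _) =
    (fun w => `|trunc_above (dl * level R j) m (iter j T w)|)); last first.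
    by apply/funext => w; rewrite trunc_above_iter.
  apply: (integrable_iter (f := fun w => `|trunc_above (dl * level R j) m w|)).
  by apply: integrable_norm; exact: integrable_trunc_above.
have iuv j : mu.-integrable setT (EFin \o (fun w =>
    `|trunc_above (dl * level R j.+1) (m \o iter j.+1 T) w| + `|e j.+1 w|)).
  exact: (integrableD measurableT (ia j.+1) (integrable_norm (ei j.+1))).
have ifj j : mu.-integrable setT (EFin \o f j).
  exact: (integrableZr measurableT _ (iuv j)).
have mfj j : measurable_fun setT (EFin \o f j) by exact: measurable_int (ifj j).
have If j : \int[mu]_w f j w <=
    2 * ((\int[mu]_w `|trunc_above (dl * level R j.+1) m w|) / weight R j.+1).
  rewrite /f RintegralZr//.
  rewrite mulrA ler_wpM2r ?invr_ge0 ?weight_ge0// RintegralD//; last exact: integrable_norm.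
  have E : \int[mu]_w `|trunc_above (dl * level R j.+1) (m \o iter j.+1 T) w| =
      \int[mu]_w `|trunc_above (dl * level R j.+1) m w|.
    rewrite -(@Rintegral_iter (fun w => `|trunc_above (dl * level R j.+1) m w|) j.+1).
      by apply: eq_Rintegral => w _; rewrite trunc_above_iter.
    by apply: integrable_norm; exact: integrable_trunc_above.
  by have := eL j.+1 isT; rewrite E; lra.
have tot : (\int[mu]_w (\sum_(0 <= j <oo) (f j w)%:E) < +oo)%E.
  rewrite integral_nneseries//; last by move=> n w _; rewrite lee_fin.
  apply: (@le_lt_trans _ _ (2 * (4 / dl * \int[mu]_w (m w ^+ 2)))%:E); last exact: ltry.
  apply: lime_le; first by apply: is_cvg_nneseries => n _ _; apply: integral_ge0 => w _; rewrite lee_fin.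
  apply: nearW => N.
  have -> : (\sum_(0 <= i < N) \int[mu]_x (f i x)%:E =
      (\sum_(i < N) \int[mu]_x f i x)%:E)%E.
    rewrite big_mkord -sumEFin; apply: eq_bigr => j _.
    by rewrite /Rintegral fineK// integrable_fin_num//; exact: ifj.
  rewrite lee_fin; apply: (@le_trans _ _ (\sum_(j < N)
    2 * ((\int[mu]_w `|trunc_above (dl * level R j.+1) m w|) / weight R j.+1))).
    by apply: ler_sum => j _; exact: If.
  by rewrite -mulr_sumr ler_wpM2l// sum_trunc_above.
have mtot : measurable_fun setT (fun w => \sum_(0 <= j <oo) (f j w)%:E)%E.
  apply: (@ge0_emeasurable_sum _ _ _ setT (fun j w => (f j w)%:E) xpredT).
    by move=> j w _ _; rewrite lee_fin.
  by move=> j _; exact: mfj.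
have itot : mu.-integrable setT (fun w => \sum_(0 <= j <oo) (f j w)%:E)%E.
  apply/integrableP; split; first exact: mtot.
  apply: le_lt_trans tot.
  rewrite le_eqVlt; apply/orP; left; apply/eqP.
  apply: eq_integral => w _; rewrite gee0_abs//.
  by apply: nneseries_ge0 => j _ _; rewrite lee_fin.
have := integrable_ae measurableT itot; apply: filterS => w /(_ I) fin.
exists (fine (\sum_(0 <= j <oo) (f j w)%:E)%E) => n.
rewrite -lee_fin fineK// -sumEFin -(big_mkord xpredT (fun j => (f j w)%:E)).
by apply: nneseries_lim_ge => j _ _; rewrite lee_fin.
Qed.

End stationary.

(** * The two halves of the law for square integrable differences *)

Section martingale_lil.
Context (d : measure_display) (Omega : measurableType d) (R : realType).
Variables (mu : probability Omega R) (T : Omega -> Omega).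
Hypothesis mT : measurable_fun setT T.
Hypothesis T_mp : measure_preserving mu T.
Hypothesis T_erg : ergodic mu T.
Variable m : Omega -> R.
Hypothesis mm : measurable_fun setT m.
Hypothesis m2i : mu.-integrable setT (EFin \o (fun w => m w ^+ 2)).

Definition clip (K : nat) (w : Omega) : R := if `|m w| <= K%:R then m w else 0.

Lemma clipE K : clip K = trunc_below K%:R m.
Proof. by apply/funext => w; rewrite trunc_belowE. Qed.

Lemma measurable_clip K : measurable_fun setT (clip K).
Proof.
rewrite clipE; apply: (@wrt_measurable_fun _ _ _ measurable) => //.
apply: measurable_wrt_trunc_below.
  by split; [exact: measurable0|move=> A mA; rewrite setTD; exact: measurableC
            |exact: bigcupT_measurable].
by move=> B mB; rewrite -[X in measurable X]setTI; exact: mm.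
Qed.

Lemma clip_sqr_le K w : clip K w ^+ 2 <= m w ^+ 2.
Proof. by rewrite /clip; case: ifP => // _; rewrite expr0n /= sqr_ge0. Qed.

Lemma integrable_clip_sqr K : mu.-integrable setT (EFin \o (fun w => clip K w ^+ 2)).
Proof.
apply: le_integrable m2i => //.
  by apply/measurable_EFinP; apply: measurable_funX; exact: measurable_clip.
by move=> w _; rewrite lee_fin !ger0_norm ?sqr_ge0// clip_sqr_le.
Qed.

Lemma cvg_integral_clip :
  \int[mu]_w (clip K w ^+ 2) @[K --> \oo] --> \int[mu]_w (m w ^+ 2).
Proof.
have [|||||_ _ cv] := @dominated_convergence _ _ _ mu setT measurableT
  (fun K => EFin \o (fun w => clip K w ^+ 2)) (EFin \o (fun w => m w ^+ 2))
  (EFin \o (fun w => m w ^+ 2)).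
- by move=> K; exact: measurable_int (integrable_clip_sqr K).
- exact: measurable_int m2i.
- apply: aeW => w _; apply: cvg_near_cst; near=> K => /=.
  rewrite /clip ifT//; near: K; exact: nbhs_infty_ger.
- exact: m2i.
- apply: aeW => w K _ /=; rewrite lee_fin ger0_norm ?sqr_ge0//.
  exact: clip_sqr_le.
have EI : (\int[mu]_w (EFin \o (fun w => m w ^+ 2)%R) w = (\int[mu]_w (m w ^+ 2)%R)%:E)%E.
  by rewrite /Rintegral fineK// integrable_fin_num.
by rewrite EI in cv; move/fine_cvgP : cv => [_].
Unshelve. all: by end_near. Qed.

Lemma two_sided_arith (s e S B q : R) : 0 <= s -> `|S - s * B| <= e * q ->
  B <= (1 + e) * q -> - B <= (1 + e) * q -> `|S| <= (s * (1 + e) + e) * q.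
Proof.
move=> s0; rewrite !ler_norml => /andP[h1 h2] hB hB'.
have h3 := ler_wpM2l s0 hB; have h4 := ler_wpM2l s0 hB'.
by apply/andP; split; lra.
Qed.

(** The differences are truncated, centered and divided by [s] to reach unit variance. The tolerance
    enters relative to [s] through the two halves of the law, and additively through the truncation
    error. *)
Theorem martingale_lil (e : R) : 0 < e <= 1 ->
  martingale_differences mu (fun i => m \o iter i T) ->
  0 < \int[mu]_w (m w ^+ 2) ->
  let s := Num.sqrt (\int[mu]_w (m w ^+ 2)) in
  let q n : R := Num.sqrt (2 * (n%:R * ln (ln n%:R))) in
  {ae mu, forall w, [/\
    \forall n \near \oo, `|birkhoff_sum T m n w| <= (s * (1 + e) + e) * q n,
    forall n0, exists2 n, (n0 <= n)%N & (s * (1 - e) - e) * q n <= birkhoff_sum T m n w &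
    forall n0, exists2 n, (n0 <= n)%N & (s * (1 - e) - e) * q n <= - birkhoff_sum T m n w]}.
Proof.
move=> /andP[e0 e1] mdm s20 s q.
have s0 : 0 < s by rewrite sqrtr_gt0.
have sE : s ^+ 2 = \int[mu]_w (m w ^+ 2) by rewrite sqr_sqrtr// ltW.
(* A truncated and centered difference is at most [2 * dl * level], and [level] at most twice its
   geometric form; division by [s] leaves [4 * dl / s = (e / 16) ^+ 2 / 160], the step size allowed
   in [lower_lil]. *)
pose dl := s * (e / 16) ^+ 2 / 640.
have e16 : 0 < (e / 16) ^+ 2 by rewrite exprn_gt0// divr_gt0.
have dl0 : 0 < dl by apply: divr_gt0; [exact: mulr_gt0|rewrite ltr0n].
pose c j := dl * level R j.
have c0 j : 0 <= c j by rewrite mulr_ge0 ?level_ge0// ltW.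
have [G [ee [mds mee eec eL]]] := truncated_mds mdm c0.
pose X j w := m (iter j T w).
pose Z j w := trunc_below (c j) (m \o iter j T) w.
have ZE j w : Z j w = if `|X j w| <= dl * level R j then X j w else 0.
  by rewrite /Z trunc_belowE.
have eei j : mu.-integrable setT (EFin \o ee j).
  apply: measurable_bounded_integrable => //.
    by rewrite -ge0_fin_numE//; exact: fin_num_measure.
  exists (c j); split; first exact: num_real.
  by move=> x cx w _; exact: le_trans (eec j w) (ltW cx).
have bd := ae_sum_bounded mT T_mp mm m2i dl0 eei eL.
pose r w j := `|trunc_above (c j) (m \o iter j T) w| + `|ee j w|.
have r0 w j : 0 <= r w j by rewrite addr_ge0.
have kr : {ae mu, forall w, forall a, 0 < a ->
    \forall n \near \oo, \sum_(j < n) r w j <= a * weight R n}.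
  apply: filterS bd => w [M hM] a a0; exact: (kronecker_weight (r0 w) hM a0).
have birk2 := birkhoff_ergodic mT T_mp T_erg m2i.
have /ae_foralln birkK := fun K => birkhoff_ergodic mT T_mp T_erg (integrable_clip_sqr K).
pose Y j w := s^-1 * (Z j w - ee j w).
have mdsY : bounded_mds mu G Y by exact: mdsZ.
have uY : unit_variance mu Y.
  apply: filterS3 kr birk2 birkK => w kr birk2 birkK.
  have eW a : 0 < a -> \forall n \near \oo, \sum_(j < n) `|ee j w| <= a * weight R n.
    move=> a0; apply: filterS (kr a a0) => n; apply: le_trans.
    by apply: ler_sum => j _; rewrite lerDr.
  have := truncated_variance dl0 (ZE^~ w) (eec^~ w) eW birk2 birkK cvg_integral_clip.
  move=> /(cvgMr_tmp (b := s ^- 2)).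
  rewrite -sE divff ?gt_eqF ?exprn_gt0//.
  rewrite (_ : (fun n => _) = (fun n => block_var Y 0 n w / n%:R))//.
  apply/funext => n; rewrite mulrAC; congr (_ / _).
  rewrite /block_var mulr_suml; apply: eq_bigr => j _.
  by rewrite /Y add0n exprMn mulrC exprVn.
have sY : small_steps ((e / 16) ^+ 2 / 160) Y.
  move=> theta th1; apply: filterS (near_level_le th1) => k hk j w jk.
  rewrite /Y normrM ger0_norm ?invr_ge0 ?(ltW s0)//.
  have h1 : `|Z j w - ee j w| <= 2 * c j.
    apply: le_trans (ler_normB _ _) _.
    by have := trunc_below_le (m \o iter j T) w (c0 j); have := eec j w; rewrite /Z; lra.
  apply: (@le_trans _ _ (s^-1 * (2 * (dl * (2 * Num.sqrt (theta ^+ k / ln k%:R)))))).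
    apply: ler_wpM2l; first by rewrite invr_ge0 ltW.
    apply: (le_trans h1); rewrite ler_wpM2l// /c ler_wpM2l ?(ltW dl0)//; exact: hk.
  rewrite [leLHS](_ : _ = (e / 16) ^+ 2 / 160 * Num.sqrt (theta ^+ k / ln k%:R))//.
  by rewrite /dl; field; rewrite gt_eqF.
have eb : 0 < e <= 1 by rewrite e0.
have d1 : 0 <= (e / 16) ^+ 2 / 160 <= e / 32.
  by rewrite divr_ge0 ?(ltW e16)//=; nra.
have d2 : 0 <= (e / 16) ^+ 2 / 160 <= (e / 16) ^+ 2 / 160.
  by rewrite lexx andbT divr_ge0 ?(ltW e16).
have up1 := upper_lil eb d1 mdsY sY uY.
have up2 := upper_lil eb d1 (mdsN mdsY) (small_stepsN sY) (unit_varianceN uY).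
have lo1 := lower_lil eb d2 mdsY sY uY.
have lo2 := lower_lil eb d2 (mdsN mdsY) (small_stepsN sY) (unit_varianceN uY).
apply: filterS2 kr (filterS2 _ (fun w a b => conj a b) (filterS2 _ (fun w a b => conj a b) up1 up2)
  (filterS2 _ (fun w a b => conj a b) lo1 lo2)) => w kr [[up1' up2'] [lo1' lo2']].
have e20 : 0 < e / 2 by lra.
(* The error consists of the large parts and the centerings, whose sum is negligible against
   [weight]. *)
have close : \forall n \near \oo,
    `|birkhoff_sum T m n w - s * block_sum Y 0 n w| <= e * q n.
  near=> n.
  have h1 : \sum_(j < n) r w j <= e / 2 * weight R n by near: n; exact: kr.
  have h2 : weight R n <= 2 * q n.
    have l0 : 0 <= ln (ln n%:R) :> R by near: n; exact: near_nat_lnln_ge.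
    have h : weight R n <= 2 * Num.sqrt (n%:R * ln (ln n%:R)).
      by near: n; exact: near_weight_le.
    apply: (le_trans h); rewrite ler_wpM2l//; apply: ler_wsqrtr.
    have h3 : 0 <= n%:R * ln (ln n%:R) :> R by rewrite mulr_ge0.
    lra.
  apply: (@le_trans _ _ (\sum_(j < n) r w j)); last first.
    apply: (le_trans h1).
    by apply: le_trans (ler_wpM2l (ltW e20) h2) _; rewrite mulrA divfK.
  rewrite /block_sum mulr_sumr /birkhoff_sum -sumrB.
  apply: le_trans (ler_norm_sum _ _ _) _; apply: ler_sum => j _.
  rewrite add0n /Y mulrA divff ?gt_eqF// mul1r.
  have -> : m (iter j T w) = Z j w + trunc_above (c j) (m \o iter j T) w.
    by rewrite /Z trunc_belowD.
  rewrite (_ : _ - _ = trunc_above (c j) (m \o iter j T) w + ee j w); last by ring.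
  exact: ler_normD.
have q0 n : 0 <= q n by exact: sqrtr_ge0.
split.
- near=> n.
  have hc : `|birkhoff_sum T m n w - s * block_sum Y 0 n w| <= e * q n by near: n.
  have h1 : block_sum Y 0 n w <= (1 + e) * q n by near: n; exact: up1'.
  have h2 : - block_sum Y 0 n w <= (1 + e) * q n.
    by rewrite -block_sumN; near: n; exact: up2'.
  exact: two_sided_arith (ltW s0) hc h1 h2.
- case: close => M _ hM n0; have [n] := lo1' (maxn M n0).
  rewrite geq_max => /andP[Mn nn0] h; exists n => //.
  have := hM n Mn; rewrite /= ler_norml => /andP[h1 h2].
  have h3 := ler_wpM2l (ltW s0) h; rewrite -/(q n) in h3.
  by move: h1 h2 h3; lra.
- case: close => M _ hM n0; have [n] := lo2' (maxn M n0).
  rewrite geq_max => /andP[Mn nn0]; rewrite block_sumN => h; exists n => //.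
  have := hM n Mn; rewrite /= ler_norml => /andP[h1 h2].
  have h3 := ler_wpM2l (ltW s0) h; rewrite -/(q n) in h3.
  by move: h1 h2 h3; lra.
Unshelve. all: by end_near. Qed.

End martingale_lil.

(** * Coboundaries *)

Section integrable_products.
Context (d : measure_display) (Omega : measurableType d) (R : realType).
Variable mu : probability Omega R.

Lemma young_integrable (u v : Omega -> R) (p r : R) : 0 < p -> 0 < r ->
  p^-1 + r^-1 = 1 -> measurable_fun setT u -> measurable_fun setT v ->
  mu.-integrable setT (fun x => (`|u x| `^ p)%:E) ->
  mu.-integrable setT (fun x => (`|v x| `^ r)%:E) ->
  mu.-integrable setT (EFin \o (fun w => u w * v w)).
Proof.
move=> p0 r0 pr mu' mv ui vi.
have i1 := integrableD measurableT (integrableZl measurableT p^-1 ui)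
  (integrableZl measurableT r^-1 vi).
apply: le_integrable i1 => //; first by apply/measurable_EFinP; exact: measurable_funM.
move=> w _ /=; rewrite lee_fin normrM.
have := conjugate_powR (normr_ge0 (u w)) (normr_ge0 (v w)) p0 r0 pr.
by move/le_trans; apply; rewrite mulrC [X in _ + X]mulrC ler_norm.
Qed.

Lemma powR_exprn (a q : R) k : 0 <= a -> (a ^+ k) `^ q = (a `^ q) ^+ k.
Proof. by move=> a0; rewrite -(powR_mulrn k a0) -(powR_mulrn k (powR_ge0 a q)) powRAC. Qed.

Lemma dyadic_between (x : R) : 1 < x -> exists k, 2 ^+ k < x <= 2 ^+ k.+1.
Proof.
move=> x1.
have ex : exists n, x <= 2 ^+ n.
  exists (Num.truncn x).+1; apply: (le_trans (ltW (truncnS_gt x))).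
  by rewrite -natrX ler_nat ltnW// ltn_expl.
case: (ex_minnP ex) => -[|n] xn nmin.
  by move: xn; rewrite expr0 leNgt x1.
exists n; rewrite xn andbT ltNge; apply/negP => h.
by have := nmin n h; rewrite ltnn.
Qed.

(** Dyadic slicing: where [|h|] lies between [2 ^ k] and [2 ^ k.+1], its power of exponent [q'] is
    at most [a ^ k.+1], while [|h|] exceeds [2 ^ k] with probability at most [C / b ^ k]. Since
    [a < b] the series is geometric; values up to 1 contribute at most 1. *)
Lemma weak_Lfun_integrable (q q' : R) (h : Omega -> R) : 0 < q' -> q' < q ->
  weak_Lfun mu q h -> mu.-integrable setT (fun x => (`|h x| `^ q')%:E).
Proof.
move=> q'0 q'q [mh hfin].
pose C := fine (weak_norm_pow mu q h).
have hge t : 0 < t -> ((t `^ q)%:E * mu [set w | (t < `|h w|)%R] <= weak_norm_pow mu q h)%E.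
  by move=> t0; apply: ereal_sup_ubound; exists t.
have Cfin : weak_norm_pow mu q h \is a fin_num.
  rewrite ge0_fin_numE//; apply: le_trans (hge 1 ltr01).
  by rewrite mule_ge0// lee_fin powR_ge0.
pose a : R := 2 `^ q'; pose b : R := 2 `^ q.
have a0 : 0 < a by rewrite powR_gt0.
have b0 : 0 < b by rewrite powR_gt0.
have ab : a < b.
  by rewrite -ltr_ln ?posrE// !ln_powR ltr_pM2r// ln_gt0// ltr1n.
pose A k := [set w | 2 ^+ k < `|h w|].
have mA k : measurable (A k).
  rewrite (_ : A k = (fun w => `|h w|) @^-1` `]2 ^+ k, +oo[%classic).
    by rewrite -[X in measurable X]setTI; apply: (measurableT_comp _ mh).
  by apply/seteqP; split => w /=; rewrite in_itv/= andbT.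
have muA k : (mu (A k) <= (C / b ^+ k)%:E)%E.
  have t0 : 0 < 2 ^+ k :> R by rewrite exprn_gt0.
  have := hge _ t0; rewrite powR_exprn// -/b -/(A k) -[X in (_ <= X)%E]fineK// -/C.
  rewrite -[mu (A k)]fineK ?fin_num_measure// -EFinM !lee_fin.
  by rewrite ler_pdivlMr ?exprn_gt0// mulrC.
have mp : measurable_fun setT (fun x => (`|h x| `^ q')%:E).
  apply/measurable_EFinP; apply: (measurableT_comp (measurable_powR _)).
  exact: measurableT_comp.
apply/integrableP; split => //.
pose f k w : R := a ^+ k.+1 * \1_(A k) w.
have f0 k w : 0 <= f k w by rewrite mulr_ge0// exprn_ge0// ltW.
have mf k : measurable_fun setT (EFin \o f k).
  by apply/measurable_EFinP; apply: measurable_funM => //; exact: measurable_indic.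
have mtot : measurable_fun setT (fun w => \sum_(0 <= k <oo) (f k w)%:E)%E.
  apply: (@ge0_emeasurable_sum _ _ _ setT (fun k w => (f k w)%:E) xpredT).
    by move=> j w _ _; rewrite lee_fin.
  by move=> j _; exact: mf.
apply: (@le_lt_trans _ _ (\int[mu]_w (1 + \sum_(0 <= k <oo) (f k w)%:E))%E).
  apply: ge0_le_integral => //.
  - exact: measurableT_comp.
  - exact: emeasurable_funD.
  move=> w _; rewrite gee0_abs ?lee_fin ?powR_ge0//.
  have [h1|h1] := leP `|h w| 1.
    apply: (@le_trans _ _ 1%E).
      have E : 1 `^ q' = 1 :> R by rewrite powR1.
      by rewrite lee_fin -E ge0_ler_powR ?nnegrE// ltW.
    by rewrite leeDl// nneseries_ge0// => k _ _; rewrite lee_fin.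
  have [k /andP[k1 k2]] := dyadic_between h1.
  apply: (@le_trans _ _ (f k w)%:E).
    rewrite lee_fin /f indicE mem_set// mulr1 /a -powR_exprn//.
    by rewrite ge0_ler_powR ?nnegrE ?exprn_ge0// ltW.
  apply: (@le_trans _ _ (\sum_(0 <= j < k.+1) (f j w)%:E)%E).
    rewrite big_nat_recr//= leeDr// sume_ge0// => j _; by rewrite lee_fin.
  apply: (@le_trans _ _ (\sum_(0 <= j <oo) (f j w)%:E)%E).
    by apply: nneseries_lim_ge => j _ _; rewrite lee_fin.
  by rewrite leeDr// lee_fin.
rewrite ge0_integralD//; last by move=> w _; rewrite nneseries_ge0// => k _ _; rewrite lee_fin.
rewrite integral_cst//= mul1e.
have -> : mu setT = 1%E := probability_setT mu.
rewrite integral_nneseries//; last by move=> n w _; rewrite lee_fin.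
rewrite lte_add_pinfty ?ltry//.
pose z := a / b.
have z1 : z < 1 by rewrite /z ltr_pdivrMr// mul1r.
have z0 : 0 < z by rewrite divr_gt0.
have C0 : 0 <= C.
  rewrite /C fine_ge0//; apply: le_trans (hge 1 ltr01).
  by rewrite mule_ge0// lee_fin powR_ge0.
apply: (@le_lt_trans _ _ (a * C / (1 - z))%:E); last exact: ltry.
apply: lime_le; first by apply: is_cvg_nneseries => n _ _; apply: integral_ge0 => w _; rewrite lee_fin.
apply: nearW => n.
have If k : (\int[mu]_w (f k w)%:E <= (a * C * z ^+ k)%:E)%E.
  under eq_integral do rewrite EFinM.
  rewrite ge0_integralZl//; last first.
  - by rewrite lee_fin exprn_ge0// ltW.
  - exact/measurable_EFinP/measurable_indic.
  rewrite integral_indic// setIT.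
  apply: (@le_trans _ _ ((a ^+ k.+1)%:E * (C / b ^+ k)%:E)%E).
    by apply: lee_wpmul2l (muA k); rewrite lee_fin exprn_ge0// ltW.
  rewrite -EFinM lee_fin /z exprMn exprVn exprS.
  by rewrite [leLHS](_ : _ = a * C * (a ^+ k / b ^+ k))//; ring.
apply: (@le_trans _ _ (\sum_(0 <= k < n) (a * C * z ^+ k)%:E)%E).
  by apply: lee_sum => k _; exact: If.
rewrite sumEFin lee_fin -mulr_sumr; apply: ler_wpM2l; first by rewrite mulr_ge0// ltW.
have z1' : 0 < 1 - z by lra.
rewrite -[leRHS]mul1r ler_pdivlMr// mulrC.
elim: (n) => [|k IH]; first by rewrite big_geq// mulr0.
rewrite big_nat_recr//= mulrDr.
have -> : (1 - z) * \sum_(0 <= i < k) z ^+ i = 1 - z ^+ k.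
  elim: (k) => [|i IHi]; first by rewrite big_geq// mulr0 expr0 subrr.
  by rewrite big_nat_recr//= mulrDr IHi exprS; ring.
by have := exprn_ge0 k.+1 (ltW z0); rewrite exprS; lra.
Qed.

End integrable_products.

(** * Growth of a function along orbits when its coboundary is integrable *)

Section coboundary.
Context (d : measure_display) (Omega : measurableType d) (R : realType).
Variables (mu : probability Omega R) (T : Omega -> Omega).
Hypothesis mT : measurable_fun setT T.
Hypothesis T_mp : measure_preserving mu T.
Hypothesis T_erg : ergodic mu T.

Lemma birkhoff_sum_coboundary (g : Omega -> R) n w :
  birkhoff_sum T (g \- (g \o T)) n w = g w - g (iter n T w).
Proof.
rewrite /birkhoff_sum; elim: n => [|n IH]; first by rewrite big_ord0 subrr.
by rewrite big_ord_recr /= IH; ring.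
Qed.

Lemma measure_iter (A : set Omega) n : measurable A ->
  measurable (iter n T @^-1` A) /\ mu (iter n T @^-1` A) = mu A.
Proof.
move=> mA; elim: n => [//|n [mB muB]].
rewrite (_ : iter n.+1 T @^-1` A = T @^-1` (iter n T @^-1` A)).
  by rewrite T_mp// muB; split => //; rewrite -[X in measurable X]setTI; exact: mT.
by apply/seteqP; split => w /=; rewrite -iterSr.
Qed.

(* By the ergodic theorem G (T^n w) / n converges to a constant, which is 0
   since G (T^n w) has the law of G and cannot tend to infinity. *)
Lemma coboundary_over_n (G : Omega -> R) : measurable_fun setT G ->
  (forall w, 0 <= G w) -> mu.-integrable setT (EFin \o (G \- (G \o T))) ->
  {ae mu, forall w, G (iter n T w) / n%:R @[n --> \oo] --> 0}.
Proof.
move=> mG G0 hi.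
have := birkhoff_ergodic mT T_mp T_erg hi.
set c := \int[mu]_x _ => bk.
have bk' : {ae mu, forall w, G (iter n T w) / n%:R @[n --> \oo] --> - c}.
  apply: filterS bk => w h.
  have h1 : (G w * n%:R^-1) @[n --> \oo] --> G w * 0.
    apply: cvgMl_tmp; apply/cvgrPdist_le => eps eps0; near=> n.
    have n0 : 0 < n%:R :> R by rewrite ltr0n; near: n; exact: nbhs_infty_gt.
    rewrite sub0r normrN ger0_norm ?invr_ge0//.
    rewrite -[leRHS]invrK lef_pV2 ?posrE ?invr_gt0//.
    by near: n; exact: nbhs_infty_ger.
  have := cvgB h1 h; rewrite mulr0 sub0r => h2.
  rewrite (_ : (fun n => G (iter n T w) / n%:R) = (fun n => G w * n%:R^-1) \-
    (fun n => birkhoff_sum T (G \- (G \o T)) n w / n%:R)); first exact: h2.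
  by apply/funext => n /=; rewrite birkhoff_sum_coboundary; ring.
suff c0 : c = 0 by move: bk'; rewrite c0 oppr0.
apply: contrapT => cN0.
pose D (K : nat) := [set w | G w <= K%:R].
have mD K : measurable (D K).
  rewrite (_ : D K = G @^-1` `]-oo, K%:R]%classic).
    by rewrite -[X in measurable X]setTI; exact: mG.
  by apply/seteqP; split => w /=; rewrite in_itv.
(* As the limit [- c] would be positive, almost every orbit would leave [D K] for good; but the
   preimages of [D K] all have the measure of [D K], so that measure would be 0. *)
have D0 K : mu (D K) = 0%E.
  have [|||||_ _ cv] := @dominated_convergence _ _ _ mu setT measurableT
    (fun n => EFin \o \1_(iter n T @^-1` D K)) (cst 0%E) (EFin \o cst 1).
  - move=> n; apply/measurable_EFinP; apply: measurable_indic.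
    by have [] := measure_iter n (mD K).
  - exact: measurable_cst.
  - apply: filterS bk' => w h _.
    have Nc0 : 0 < - c.
      rewrite lt_neqAle; apply/andP; split.
        by apply/eqP => E; apply: cN0; rewrite -[c]opprK -E oppr0.
      apply: (cvgr_to_ge h); apply: nearW => n.
      by rewrite divr_ge0.
    have cc : - c / 2 < - c by lra.
    have hge : \forall n \near \oo, - c / 2 <= G (iter n T w) / n%:R.
      by move/cvgr_ge : h => /(_ _ cc).
    apply: cvg_near_cst; near=> n.
    rewrite /= indicE memNset//= => GK.
    have h1 : - c / 2 <= G (iter n T w) / n%:R.
      by near: n.
    have n0 : 0 < n%:R :> R by rewrite ltr0n; near: n; exact: nbhs_infty_gt.
    have h2 : (K%:R + 1) / (- c / 2) <= n%:R by near: n; exact: nbhs_infty_ger.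
    move: h1 h2; rewrite ler_pdivlMr// ler_pdivrMr; last by lra.
    by move: GK; rewrite /D /= mulrC; lra.
  - exact: finite_measure_integrable_cst.
  - by apply: aeW => w n _ /=; rewrite lee_fin ger0_norm// indicE; case: (_ \in _).
  move: cv; rewrite integral0 (_ : [sequence _]_n = fun=> mu (D K)).
    by move/cvg_lim => <-//; rewrite lim_cst.
  apply/funext => n; have [mI muI] := measure_iter n (mD K).
  by rewrite /= integral_indic// setIT.
have : mu setT = 0%E.
  have -> : [set: Omega] = \bigcup_K D K.
    apply/seteqP; split => // w _; exists (Num.truncn (G w)).+1 => //=.
    exact/ltW/truncnS_gt.
  apply: measure_negligible; first exact: bigcupT_measurable.
  apply: negligible_bigcup => K; exists (D K); split; [exact: mD|exact: D0|by []].
by rewrite probability_setT => -[/eqP]; rewrite oner_eq0.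
Unshelve. all: by end_near. Qed.

End coboundary.

(** * The law of the iterated logarithm *)

Section assembly.
Context (d : measure_display) (Omega : measurableType d) (R : realType).
Variables (mu : probability Omega R) (T : Omega -> Omega).
Hypothesis mT : measurable_fun setT T.
Hypothesis T_mp : measure_preserving mu T.
Hypothesis T_erg : ergodic mu T.

(* The function g ^+ 2 - g ^+ 2 \o T = (g - g \o T) * (g + g \o T) is
   integrable even though g ^+ 2 need not be. *)
Lemma coboundary_small (g : Omega -> R) (p r : R) : 0 < p -> 0 < r ->
  p^-1 + r^-1 = 1 -> measurable_fun setT g ->
  mu.-integrable setT (fun x => (`|g x| `^ p)%:E) ->
  mu.-integrable setT (fun x => (`|(g \- (g \o T)) x| `^ r)%:E) ->
  {ae mu, forall w, forall e, 0 < e ->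
    \forall n \near \oo, `|g (iter n T w)| <= e * Num.sqrt n%:R}.
Proof.
move=> p0 r0 pr mg gi hi.
have mgT : measurable_fun setT (g \o T) by exact: measurableT_comp.
have mh : measurable_fun setT (g \- (g \o T)) by exact: measurable_funB.
have gTi : mu.-integrable setT (fun x => (`|(g \o T) x| `^ p)%:E).
  exact: (integrable_mp mT T_mp (f := fun x => `|g x| `^ p)).
pose G w := g w ^+ 2.
have Gi : mu.-integrable setT (EFin \o (G \- (G \o T))).
  rewrite (_ : EFin \o _ = (EFin \o (fun w => g w * (g \- (g \o T)) w)%R) \+
     (EFin \o (fun w => (g \o T) w * (g \- (g \o T)) w)%R))%E; last first.
    by apply/funext => w; rewrite /= -EFinD /G; congr EFin; ring.
  by apply: integrableD => //; exact: (young_integrable p0 r0 pr).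
have mG : measurable_fun setT G by exact: measurable_funX.
have := coboundary_over_n mT T_mp T_erg mG (fun w => sqr_ge0 _) Gi.
apply: filterS => w cv e e0.
have e2 : 0 < e ^+ 2 by rewrite exprn_gt0.
move/cvgrPdist_le : cv => /(_ _ e2) near_le.
near=> n.
have n0 : 0 < n%:R :> R by rewrite ltr0n; near: n; exact: nbhs_infty_gt.
have : `|0 - G (iter n T w) / n%:R| <= e ^+ 2 by near: n.
rewrite sub0r normrN ger0_norm; last by rewrite divr_ge0 ?sqr_ge0.
rewrite ler_pdivrMr// /G => h.
rewrite -sqrtr_sqr -[X in X * _](ger0_norm (ltW e0)) -sqrtr_sqr -sqrtrM ?sqr_ge0//.
exact: ler_wsqrtr.
Unshelve. all: by end_near. Qed.

Lemma limn_esup_eq (u : nat -> R) (C : R) :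
  (forall e, 0 < e -> \forall n \near \oo, u n <= C + e) ->
  (forall e, 0 < e -> forall n0, exists2 n, (n0 <= n)%N & C - e <= u n) ->
  limn_esup (fun n => (u n)%:E) = C%:E.
Proof.
move=> ub lb; have cv := @cvg_esups_inf R (fun n => (u n)%:E).
rewrite limn_esup_lim (cvg_lim _ cv)//.
apply/eqP; rewrite eq_le; apply/andP; split.
  apply/lee_addgt0Pr => e e0; have [N _ hN] := ub e e0.
  apply: (@le_trans _ _ (esups (fun n => (u n)%:E) N)).
    by apply: ereal_inf_lbound; exists N.
  apply: ge_ereal_sup => _ [n /= Nn <-]; rewrite -EFinD lee_fin; exact: hN.
apply: le_ereal_inf_tmp => _ [N _ <-].
apply/lee_addgt0Pr => e e0; have [n Nn hn] := lb e e0 N.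
rewrite -leeBlDr//; apply: (@le_trans _ _ (u n)%:E).
  by rewrite -EFinB lee_fin.
by apply: ereal_sup_ubound; exists n.
Qed.

Lemma birkhoff_sum_degenerate (m : Omega -> R) : measurable_fun setT m ->
  mu.-integrable setT (EFin \o (fun w => m w ^+ 2)) ->
  \int[mu]_w (m w ^+ 2) = 0 ->
  {ae mu, forall w n, birkhoff_sum T m n w = 0}.
Proof.
move=> mm m2i I0.
have I0' : (\int[mu]_w `|(m w ^+ 2)%:E| = 0)%E.
  transitivity (\int[mu]_w (m w ^+ 2)%:E)%E.
    by apply: eq_integral => w _; rewrite /= ger0_norm ?sqr_ge0.
  by rewrite -[LHS]fineK ?integrable_fin_num//; congr EFin.
have /(ae_eq_integral_abs mu measurableT) := I0'.
move=> /(_ (measurable_int _ m2i)) [N [mN N0 sN]].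
have Nj j : {ae mu, forall w, m (iter j T w) = 0}.
  have [mNj muNj] := measure_iter mT T_mp j mN.
  exists (iter j T @^-1` N); split; [exact: mNj|by rewrite muNj|].
  move=> w /= nz; apply: sN => /= /(_ I)[/eqP].
  by rewrite sqrf_eq0 => /eqP.
move/ae_foralln : Nj; apply: filterS => w hw n.
by rewrite /birkhoff_sum big1.
Qed.

(** Zero variance is covered too: the martingale part then vanishes almost surely and the law holds
    with constant 0. *)
Theorem lil_martingale_coboundary (m g : Omega -> R) : measurable_fun setT m ->
  mu.-integrable setT (EFin \o (fun w => m w ^+ 2)) ->
  martingale_differences mu (fun i => m \o iter i T) ->
  {ae mu, forall w, forall e, 0 < e ->
    \forall n \near \oo, `|g (iter n T w)| <= e * Num.sqrt n%:R} ->
  law_of_the_iterated_logarithm mu T (m \+ g \- (g \o T)).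
Proof.
move=> mm m2i mdm gs.
pose s : R := Num.sqrt (\int[mu]_w (m w ^+ 2)).
have s0 : 0 <= s by exact: sqrtr_ge0.
pose q n : R := Num.sqrt (2 * (n%:R * ln (ln n%:R))).
pose rho n : R := Num.sqrt (n%:R * ln (ln n%:R)).
have sq2 : 0 <= Num.sqrt (2 : R) by exact: sqrtr_ge0.
have qE n : q n = Num.sqrt 2 * rho n by rewrite /q sqrtrM.
pose P (e : R) w := [/\
    \forall n \near \oo, `|birkhoff_sum T m n w| <= (s * (1 + e) + e) * q n,
    forall n0, exists2 n, (n0 <= n)%N & (s * (1 - e) - e) * q n <= birkhoff_sum T m n w &
    forall n0, exists2 n, (n0 <= n)%N & (s * (1 - e) - e) * q n <= - birkhoff_sum T m n w].
have Pae e : 0 < e <= 1 -> {ae mu, forall w, P e w}.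
  move=> e01; have : 0 <= \int[mu]_w (m w ^+ 2) by apply: Rintegral_ge0 => w _; exact: sqr_ge0.
  rewrite le_eqVlt => /predU1P[I0|I0]; last exact: martingale_lil.
  have s00 : s = 0 by rewrite /s -I0 sqrtr0.
  apply: filterS (birkhoff_sum_degenerate mm m2i (esym I0)) => w S0.
  have e0 : 0 <= e by lra.
  split.
  - by apply: nearW => n; rewrite S0 normr0 s00 mul0r add0r mulr_ge0 ?sqrtr_ge0.
  - move=> n0; exists n0 => //; rewrite S0 s00 mul0r sub0r mulNr oppr_le0.
    by rewrite mulr_ge0 ?sqrtr_ge0.
  - move=> n0; exists n0 => //; rewrite S0 s00 mul0r sub0r mulNr oppr0 oppr_le0.
    by rewrite mulr_ge0 ?sqrtr_ge0.
(* The root of 2 appears because the ratio is normalised by [rho], without the factor 2 under the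
   root that [q] carries. *)
exists (Num.sqrt 2 * s).
(* Countably many tolerances, so that one null set serves them all. *)
have /ae_foralln Pall : forall k : nat, {ae mu, forall w, P k.+1%:R^-1 w}.
  by move=> k; apply: Pae; rewrite invr_gt0 ltr0n /= invf_le1// ler1n.
apply: filterS2 Pall gs => w Pall gs.
pose S n := birkhoff_sum T (m \+ g \- (g \o T)) n w.
have SE n : S n = birkhoff_sum T m n w + (g w - g (iter n T w)).
  rewrite /S (_ : m \+ g \- (g \o T) = m \+ (g \- (g \o T))); last first.
    by apply/funext => x /=; rewrite addrA.
  by rewrite birkhoff_sumD birkhoff_sum_coboundary.
have gsmall e : 0 < e -> \forall n \near \oo, `|g w - g (iter n T w)| <= e * rho n.
  move=> e0; have e2 : 0 < e / 2 by lra.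
  have gs2 := gs _ e2.
  near=> n.
  have h1 : `|g (iter n T w)| <= e / 2 * Num.sqrt n%:R by near: n.
  have h2 : `|g w| <= e / 2 * Num.sqrt n%:R.
    rewrite -ler_pdivrMl// -[leLHS]ger0_norm; last first.
      by rewrite mulr_ge0 ?invr_ge0 ?(ltW e2).
    rewrite -sqrtr_sqr; apply: ler_wsqrtr.
    by near: n; exact: nbhs_infty_ger.
  have l1 : 1 <= ln (ln n%:R) :> R by near: n; exact: near_nat_lnln_ge.
  have h3 : Num.sqrt n%:R <= rho n by apply: ler_wsqrtr; rewrite ler_peMr.
  apply: le_trans (ler_normB _ _) _.
  by have := ler_wpM2l (ltW e0) h3; lra.
have rho0 n : 0 <= rho n by exact: sqrtr_ge0.
have near_rho : \forall n \near \oo, 0 < rho n.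
  near=> n; rewrite sqrtr_gt0 mulr_gt0//.
    by rewrite ltr0n; near: n; exact: nbhs_infty_gt.
  by apply: lt_le_trans ltr01 _; near: n; exact: near_nat_lnln_ge.
(* In units of [rho n], tolerance [a] costs [Num.sqrt 2 * (s * a + a)] for the martingale and [a]
   for the coboundary, together [a * B]. *)
pose B : R := Num.sqrt 2 * (s + 1) + 1.
have B0 : 0 < B by rewrite ltr_wpDl// mulr_ge0// addr_ge0.
have pick e : 0 < e -> exists k : nat, k.+1%:R^-1 * B <= e.
  move=> e0; have [k _ /(_ k (leqnn k)) /= hk] := near_infty_natSinv_lt (PosNum (divr_gt0 e0 B0)).
  by exists k; rewrite -ler_pdivlMr// ltW.
(* The sign [sg] treats the lower limit as the upper limit of the opposite sequence. *)
have main (sg : R) : sg = 1 \/ sg = -1 -> 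
    (forall e, 0 < e -> \forall n \near \oo, sg * (S n / rho n) <= Num.sqrt 2 * s + e) /\
    (forall e, 0 < e -> forall n0, exists2 n, (n0 <= n)%N &
       Num.sqrt 2 * s - e <= sg * (S n / rho n)).
  move=> sg1; split => e e0; have [k hk] := pick e e0.
    have [up _ _] := Pall k; set a := k.+1%:R^-1 in hk up.
    have a0 : 0 < a by rewrite invr_gt0.
    have ga := gsmall a a0.
    near=> n.
    have r0 : 0 < rho n by near: n.
    have h1 : `|birkhoff_sum T m n w| <= (s * (1 + a) + a) * q n by near: n.
    have h2 : `|g w - g (iter n T w)| <= a * rho n by near: n.
    rewrite mulrA ler_pdivrMr// SE mulrDr.
    have h3 : sg * birkhoff_sum T m n w <= (s * (1 + a) + a) * (Num.sqrt 2 * rho n).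
      rewrite -qE; apply: le_trans h1; case: sg1 => ->.
        by rewrite mul1r ler_norm.
      by rewrite mulN1r -normrN ler_norm.
    have h4 : sg * (g w - g (iter n T w)) <= a * rho n.
      apply: le_trans h2; case: sg1 => ->; first by rewrite mul1r ler_norm.
      by rewrite mulN1r -normrN ler_norm.
    have := ler_wpM2r (rho0 n) hk; rewrite /B; lra.
  move=> n0; have [_ lo1 lo2] := Pall k; set a := k.+1%:R^-1 in hk lo1 lo2.
  have a0 : 0 < a by rewrite invr_gt0.
  case: (gsmall a a0) => M1 _ hM1; case: near_rho => M2 _ hM2.
  have [n nM hn] : exists2 n, (maxn n0 (maxn M1 M2) <= n)%N &
      (s * (1 - a) - a) * q n <= sg * birkhoff_sum T m n w.
    case: sg1 => ->.
      by have [n ? ?] := lo1 (maxn n0 (maxn M1 M2)); exists n => //; rewrite mul1r.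
    by have [n ? ?] := lo2 (maxn n0 (maxn M1 M2)); exists n => //; rewrite mulN1r.
  move: nM; rewrite !geq_max => /and3P[n0n Mn1 Mn2]; exists n => //.
  have r0 : 0 < rho n by exact: hM2.
  have h2 : `|g w - g (iter n T w)| <= a * rho n by exact: hM1.
  rewrite mulrA ler_pdivlMr// SE mulrDr.
  have h4 : - (a * rho n) <= sg * (g w - g (iter n T w)).
    rewrite lerNl; apply: le_trans h2; case: sg1 => ->.
      by rewrite mul1r -normrN ler_norm.
    by rewrite mulN1r opprK ler_norm.
  rewrite qE in hn.
  have := ler_wpM2r (rho0 n) hk; rewrite /B; lra.
have [up1 lo1] := main 1 (or_introl erefl).
have [up2 lo2] := main (-1) (or_intror erefl).
split.
  apply: limn_esup_eq => e e0.
    by apply: filterS (up1 e e0) => n; rewrite mul1r.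
  by move=> n0; have [n n0n] := lo1 e e0 n0; rewrite mul1r; exists n.
rewrite /limn_einf EFinN; congr (- _)%E.
rewrite -(limn_esup_eq (u := fun n => -1 * (S n / rho n)) up2 lo2).
by congr limn_esup; apply/funext => n /=; rewrite mulN1r.
Unshelve. all: by end_near. Qed.

End assembly.

Theorem theorem2p4 (R : realType) (d : measure_display)
    (Omega : measurableType d) (mu : probability Omega R)
    (T : Omega -> Omega)
    (T_bij : bimeasurable_bijection T)
    (T_mp : measure_preserving mu T)
    (T_erg : ergodic mu T)
    (p r : R) (p_gt1 : 1 < p) (p_lt2 : p < 2) (r_gt2 : 2 < r)
    (g : Omega -> R) :
  (r / (r - 1) < p ->
   weak_Lfun mu p g ->
   weak_Lfun mu r (g \- (g \o T)) ->
   forall m : Omega -> R,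
     m \in Lfun mu 2%:E ->
     martingale_differences mu (fun i => m \o iter i T) ->
     law_of_the_iterated_logarithm mu T (m \+ g \- (g \o T)))
  /\
  (p = r / (r - 1) ->
   g \in Lfun mu p%:E ->
   (g \- (g \o T)) \in Lfun mu r%:E ->
   forall m : Omega -> R,
     m \in Lfun mu 2%:E ->
     martingale_differences mu (fun i => m \o iter i T) ->
     law_of_the_iterated_logarithm mu T (m \+ g \- (g \o T))).
Proof.
have [_ T_meas _] := T_bij.
have mT : measurable_fun setT T by move=> _ A mA; rewrite setTI; exact: T_meas.
have Lfun_meas q (f : Omega -> R) : f \in Lfun mu q -> measurable_fun setT f.
  by rewrite inE => /andP[/[!inE]/= mf _].
split => pr gp hr m m2 mdm.
  have [mg _] := gp.
  (* The midpoint exceeds [r / (r - 1)], so its conjugate exponent [r'] is below [r]; as [p' < p]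
     too, the weak hypotheses give strong integrability with the conjugate exponents [p'] and
     [r']. *)
  pose p' := (p + r / (r - 1)) / 2.
  have rr : 1 < r / (r - 1) by rewrite ltr_pdivlMr; lra.
  have p'1 : 1 < p' by rewrite /p'; lra.
  have p'p : p' < p by rewrite /p'; lra.
  have p'r : r / (r - 1) < p' by rewrite /p'; lra.
  pose r' := p' / (p' - 1).
  have r'r : r' < r.
    move: p'r; rewrite /r' ltr_pdivrMr; last by lra.
    by rewrite ltr_pdivrMr; lra.
  have r'0 : 0 < r' by rewrite divr_gt0; lra.
  have p'0 : 0 < p' by lra.
  have conj : p'^-1 + r'^-1 = 1 by rewrite /r'; field; lra.
  apply: lil_martingale_coboundary => //; first exact: Lfun_meas m2.
    exact: Lfun2_integrable_sqr.
  apply: (coboundary_small mT T_mp T_erg p'0 r'0 conj mg).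
    exact: weak_Lfun_integrable p'p gp.
  exact: weak_Lfun_integrable r'r hr.
have p0 : 0 < p by lra.
have r0 : 0 < r by lra.
have conj : p^-1 + r^-1 = 1 by rewrite pr; field; lra.
apply: lil_martingale_coboundary => //; first exact: Lfun_meas m2.
  exact: Lfun2_integrable_sqr.
apply: (coboundary_small mT T_mp T_erg p0 r0 conj); first exact: Lfun_meas gp.
  by apply: Lfun_integrable gp; exact: ltW.
by apply: Lfun_integrable hr; lra.
Qed.
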